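(* Let $s\in(0,1)$, $\gamma\in(0,1]$, $n>2s$, let $\Omega\subset\mathbb{R}^n$ be a bounded domain, and let $\mathbb{G}$ be a Green kernel on $\Omega$ with Green operator $\mathcal{G}$, eigenpairs $(\lambda_k^{-1},\varphi_k)$ and heat semigroup $\mathcal{S}(t)$ as in the context. Assume: (1) $\mathbb{G}(x,y)=\mathbb{G}(y,x)\asymp |x-y|^{-(n-2s)}\left(\frac{\delta(x)\delta(y)}{|x-y|^2}\wedge 1\right)^{\gamma}$ for all $x\neq y$ in $\Omega$; (2) $\mathcal{G}:\delta^\gamma L^\infty(\Omega)\to\delta^\gamma C(\overline\Omega)$ is continuous; (3) for all $t\ge 0$, $0\le u_0\le 1$ implies $0\le \mathcal{S}(t)[u_0]\le 1$; (4) for every $\zeta\in\partial\Omega$ and $y\in\Omega$ the limit $D_\gamma\mathbb{G}(\zeta,y)=\lim_{x\to\zeta,\,x\in\Omega}\mathbb{G}(x,y)/\delta(x)^\gamma$ exists. Let $T>0$, $u_0\in L^1(\Omega,\delta^\gamma)$, $f\in L^1(0,T;L^1(\Omega,\delta^\gamma))$ and $h\in L^1((0,T)\times\partial\Omega)$. Then there is a unique $u\in L^1(0,T;L^1(\Omega,\delta^\gamma))$ that is a weak-dual solution with data $(u_0,f,h)$, i.e. such that for every $\phi\in\delta^\gamma L^\infty((0,T)\times\Omega)$ $$\int_\Omega\int_0^T u(t,x)\phi(T-t,x)\,dt\,dx=\int_\Omega u_0(x)\,\mathcal{H}[0,\phi,0](T,x)\,dx+\int_\Omega\int_0^T f(t,x)\,\mathcal{H}[0,\phi,0](T-t,x)\,dt\,dx+\int_0^T\int_{\partial\Omega}h(t,\zeta)\,D_\gamma\mathcal{H}[0,\phi,0](T-t,\zeta)\,d\zeta\,dt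 ,$$ and this solution is $u=\mathcal{H}[u_0,f,h]$, where $$\mathcal{H}[u_0,f,h](t,x)=\mathcal{S}(t)[u_0](x)+\int_0^t\mathcal{S}(t-\sigma)[f(\sigma,\cdot)](x)\,d\sigma+\int_0^t\int_{\partial\Omega}D_\gamma\mathbb{S}(t-\sigma,\zeta,x)\,h(\sigma,\zeta)\,d\zeta\,d\sigma .$$ Moreover there is a constant $C>0$ independent of $u_0,f,h$ such that $$\int_0^T\int_\Omega|u|\,\delta^\gamma\,dx\,dt\le C\left(\int_\Omega|u_0|\delta^\gamma\,dx+\int_0^T\int_\Omega|f|\delta^\gamma\,dx\,dt+\int_0^T\int_{\partial\Omega}|h|\,d\zeta\,dt\right).$$
   Context: Notation: $\delta(x)=\mathrm{dist}(x,\Omega^c)$; $a\wedge b=\min(a,b)$; $\asymp$ means two-sided bounds by positive constants independent of the variables. $\mathbb{G}:\Omega\times\Omega\to[0,\infty]$ is a measurable kernel and $\mathcal{G}[f](x)=\int_\Omega\mathbb{G}(x,y)f(y)\,dy$; $\mathcal{G}$ is the solution operator of $\mathrm{L}v=f$ with zero exterior/boundary data, i.e. $\mathrm{L}$ is the inverse of $\mathcal{G}$. Standing eigen-decomposition: $\mathcal{G}$ is a compact, self-adjoint, injective, positive operator on $L^2(\Omega)$, and there is an orthonormal basis $(\varphi_k)_{k\ge1}$ of $L^2(\Omega)$ with $\mathcal{G}[\varphi_k]=\lambda_k^{-1}\varphi_k$, $0<\lambda_1<\lambda_2\le\lambda_3\le\cdots\to\infty$. The heat semigroup on $L^2(\Omega)$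 is $\mathcal{S}(t)[u_0]=\sum_{k\ge1}e^{-\lambda_kt}\langle u_0,\varphi_k\rangle\varphi_k$, with $\langle\cdot,\cdot\rangle$ the $L^2(\Omega)$ inner product; it extends uniquely by continuity to $L^1(\Omega,\delta^\gamma)$. Spaces: $L^1(\Omega,\delta^\gamma)=\{u\in L^1_{loc}(\Omega):\int_\Omega|u|\delta^\gamma<\infty\}$; $L^1(0,T;L^1(\Omega,\delta^\gamma))=\{u\in L^1_{loc}((0,T)\times\Omega):\int_0^T\int_\Omega|u|\delta^\gamma\,dx\,dt<\infty\}$; $\delta^\gamma X=\{\delta^\gamma v:v\in X\}$ with norm $\|u\|_{\delta^\gamma X}=\|u/\delta^\gamma\|_X$; $\phi\in\delta^\gamma L^\infty((0,T)\times\Omega)$ means $\phi/\delta^\gamma\in L^\infty((0,T)\times\Omega)$. $d\zeta$ is surface measure on $\partial\Omega$. Heat kernel: for $t>0$, $\mathbb{S}(t,x,y)=\sum_{k\ge1}e^{-\lambda_kt}\varphi_k(x)\varphi_k(y)$ is the integral kernel of $\mathcal{S}(t)$ (well defined pointwise under the hypotheses, where $\varphi_k\in\delta^\gamma C(\overline\Omega)$). The $\gamma$-normal derivative of a function $v$ on $\Omega$ at $\zeta\in\partial\Omega$ is $D_\gamma v(\zeta)=\lim_{x\to\zeta,\,x\in\Omega}v(x)/\delta(x)^\gamma$, and $D_\gamma\mathbb{S}(t,\zeta,y)=\lim_{x\to\zeta}\mathbb{S}(t,x,y)/\delta(x)^\gamma$. In particular $\mathcal{H}[0,\phi,0](t,x)=\int_0^t\int_\Omega\mathbb{S}(t-\sigma,x,y)\phi(\sigma,y)\,dy\,d\sigma$,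 and $D_\gamma\mathcal{H}[0,\phi,0](t,\zeta)$ is the $\gamma$-normal derivative in $x$ at $\zeta$. The weak-dual formulation is the notion of solution for the problem $u_t+\mathrm{L}u=f$ in $(0,T)\times\Omega$, $u=0$ in $\Omega^c$ (if applicable), $u(0,\cdot)=u_0$, with singular boundary condition $\lim_{x\to\zeta}u(t,x)/u^\star(x)=h(t,\zeta)$, where $u^\star(x)=\int_{\partial\Omega}D_\gamma\mathbb{G}(\zeta,x)\,d\zeta$. *)

(* Defs.v *)
From HB Require Import structures.
From mathcomp Require Import all_boot all_order all_algebra.
From mathcomp Require Import all_classical all_reals all_analysis.
From mathcomp Require Import measurable_realfun.

Set Implicit Arguments.
Unset Strict Implicit.
Unset Printing Implicit Defensive.
Import Order.TTheory GRing.Theory Num.Theory.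
Import numFieldNormedType.Exports.
Local Open Scope classical_set_scope.
Local Open Scope ring_scope.

Definition measure_rV_display : measure_display -> measure_display.
Proof. exact. Qed.

(* The sigma-algebra generated by the coordinates, as for tuples in the library;
   when T is R it is the Borel sigma-algebra of R^n. *)
Section measurable_rV.
Context {d} {T : measurableType d}.
Variable n : nat.

Let coords : 'I_n -> 'rV[T]_n -> T := fun i x => x ord0 i.

Let rV_set0 : g_sigma_preimage coords set0.
Proof. exact: sigma_algebra0. Qed.

Let rV_setC A : g_sigma_preimage coords A -> g_sigma_preimage coords (~` A).
Proof. exact: sigma_algebraC. Qed.

Let rV_bigcup (F : _^nat) : (forall i, g_sigma_preimage coords (F i)) ->
  g_sigma_preimage coords (\bigcup_i (F i)).
Proof. exact: sigma_algebra_bigcup. Qed.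

HB.instance Definition _ := @isMeasurable.Build (measure_rV_display d)
  'rV[T]_n (g_sigma_preimage coords) rV_set0 rV_setC rV_bigcup.

End measurable_rV.


Lemma measurable_coord_rV d (T : measurableType d) n (i : 'I_n) :
  measurable_fun [set: 'rV[T]_n] (fun x => x ord0 i).
Proof.
move=> _ Y mY; rewrite setTI; apply: sub_sigma_algebra => /=.
rewrite -bigcup_seq/=; exists i => /=; first by rewrite mem_index_enum.
by exists Y => //; rewrite setTI.
Qed.

Lemma measurable_fun_rVP d1 d2 (T1 : measurableType d1) (T2 : measurableType d2)
    n (f : T1 -> 'rV[T2]_n) :
  (forall i, measurable_fun [set: T1] (fun x => f x ord0 i)) ->
  measurable_fun [set: T1] f.
Proof.
move=> mf.
apply: (measurability (\big[setU/set0]_(i < n)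
  preimage_set_system setT (fun x : 'rV[T2]_n => x ord0 i) measurable)) => //.
case: n => [|n] in f mf *; first by rewrite big_ord0 => X [].
rewrite -bigcup_mkord_ord => X [Y [i Ii [B mB <-]] <-].
have := mf (inord i) measurableT _ mB.
by rewrite !setTI.
Qed.

Section lebesgue_rV.
Context {R : realType}.

Definition cons_rV n (p : measurableTypeR R * 'rV[R]_n) : 'rV[R]_n.+1 :=
  row_mx (p.1)%:M p.2 : 'rV[R]_(1 + n).

Let uncons_rV n (x : 'rV[R]_n.+1) : measurableTypeR R * 'rV[R]_n :=
  (x ord0 ord0, rsubmx (x : 'rV[R]_(1 + n))).

Let uncons_rVK n : cancel (@cons_rV n) (@uncons_rV n).
Proof.
move=> [a x]; rewrite /uncons_rV /cons_rV row_mxKr; congr pair.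
transitivity (row_mx (a%:M : 'rV_1) x ord0 (lshift n (ord0 : 'I_1))).
  by congr (fun_of_matrix _ _ _); exact: val_inj.
by rewrite row_mxEl mxE eqxx.
Qed.

Lemma measurable_cons_rV n : measurable_fun [set: measurableTypeR R * 'rV[R]_n] (@cons_rV n).
Proof.
apply: measurable_fun_rVP => i.
have [j ->|j ->] := split_ordP (i : 'I_(1 + n)).
- rewrite (_ : (fun _ => _) = fst); first exact: measurable_fst.
  by apply/funext => p; apply: etrans (row_mxEl p.1%:M p.2 ord0 j) _; rewrite [j]ord1 mxE eqxx.
- rewrite (_ : (fun _ => _) = (fun x : 'rV[R]_n => x ord0 j) \o snd).
    exact: measurableT_comp (measurable_coord_rV j) measurable_snd.
  by apply/funext => p; exact: (row_mxEr p.1%:M p.2 ord0 j).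
Qed.

Let measurable_uncons_rV n : measurable_fun [set: 'rV[R]_n.+1] (@uncons_rV n).
Proof.
apply/measurable_fun_pairP; split; first exact: measurable_coord_rV.
apply: measurable_fun_rVP => i /=.
under eq_fun do rewrite mxE.
exact: measurable_coord_rV.
Qed.

Section step.
Variables (n : nat) (m : {sigma_finite_measure set 'rV[R]_n -> \bar R}).

Definition lebesgue_step : set 'rV[R]_n.+1 -> \bar R :=
  pushforward ((@lebesgue_measure R) \x m)%E (@cons_rV n).

Let step0 : lebesgue_step set0 = 0%E.
Proof. by rewrite /lebesgue_step /pushforward preimage_set0 measure0. Qed.

Let step_ge0 A : (0 <= lebesgue_step A)%E.
Proof. by rewrite /lebesgue_step /pushforward measure_ge0. Qed.

Let step_sigma_additive : semi_sigma_additive lebesgue_step.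
Proof.
move=> F mF tF mUF; rewrite /lebesgue_step /pushforward preimage_bigcup.
apply: measure_semi_sigma_additive.
- by move=> k; rewrite -[X in measurable X]setTI; exact: measurable_cons_rV.
- apply/trivIsetP => /= i j _ _ ij; rewrite -preimage_setI.
  by move/trivIsetP : tF => /(_ _ _ _ _ ij) ->//; rewrite preimage_set0.
- rewrite -preimage_bigcup -[X in measurable X]setTI.
  exact: measurable_cons_rV.
Qed.

HB.instance Definition _ := isMeasure.Build _ _ _ lebesgue_step
  step0 step_ge0 step_sigma_additive.

Let step_sigma_finite : sigma_finite setT lebesgue_step.
Proof.
have /sigma_finiteP[F [FT ndF Foo]] := sigma_finiteT (@lebesgue_measure R).
have /sigma_finiteP[G [GT ndG Goo]] := sigma_finiteT m.
exists (fun k => @uncons_rV n @^-1` (F k `*` G k)).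
  rewrite -preimage_bigcup (_ : \bigcup_k _ = setT) ?preimage_setT//.
  rewrite -subTset => -[a x] _.
  have [i _ Fia] : (\bigcup_i F i) a by rewrite -FT.
  have [j _ Gjx] : (\bigcup_j G j) x by rewrite -GT.
  exists (maxn i j) => //; split => /=.
  - by move: a Fia; exact/subsetPset/ndF/leq_maxl.
  - by move: x Gjx; exact/subsetPset/ndG/leq_maxr.
move=> k; have [mF Fkoo] := Foo k; have [mG Gkoo] := Goo k; split.
  rewrite -[X in measurable X]setTI; apply: measurable_uncons_rV => //.
  exact: measurableX.
rewrite /lebesgue_step /pushforward -comp_preimage.
rewrite (_ : _ \o _ = id); last exact/funext/uncons_rVK.
by rewrite product_measure1E// lte_mul_pinfty// ge0_fin_numE.
Qed.

HB.instance Definition _ := Measure_isSigmaFinite.Build _ _ _ lebesgue_step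
  step_sigma_finite.
End step.

(* Lebesgue measure on R^n as an iterated product measure *)
Fixpoint lebesgue_rV (n : nat) :
    {sigma_finite_measure set 'rV[R]_n -> \bar R} :=
  if n is n'.+1 then lebesgue_step (lebesgue_rV n') else \d_(0 : 'rV[R]_0).

End lebesgue_rV.

Section enorm.
Context {R : realType} {n : nat}.

(* The norm of the library on row vectors is the sup norm. *)
Definition enorm (x : 'rV[R]_n) : R := Num.sqrt (\sum_i x ord0 i ^+ 2).

Lemma ler_coord_enorm (x : 'rV[R]_n) i : `|x ord0 i| <= enorm x.
Proof.
rewrite -sqrtr_sqr ler_wsqrtr// (bigD1 i)//= lerDl.
by apply: sumr_ge0 => j _; exact: sqr_ge0.
Qed.

End enorm.

Section hausdorff.
Local Open Scope ereal_scope.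
Context {R : realType} {n : nat}.
Implicit Types (A X : set 'rV[R]_n) (d : nat) (e : R).

(* (diam A)^d; the sup with 0 gives 0 for A = set0 and d = 0 *)
Definition diam_pow d A : \bar R :=
  ereal_sup (0 |` [set (enorm (x - y) ^+ d)%:E | x in A & y in A]).

Definition fine_cover e A := [set F : (set 'rV[R]_n)^nat |
  (forall k x y, F k x -> F k y -> (enorm (x - y) <= e)%R) /\
  A `<=` \bigcup_k F k].

Definition hausdorff_delta d e A : \bar R :=
  ereal_inf [set \sum_(k <oo) diam_pow d (F k) | F in fine_cover e A].

Definition hausdorff d A : \bar R :=
  ereal_sup [set hausdorff_delta d e A | e in [set e : R | (0 < e)%R]].

Lemma diam_pow_ge0 d A : 0 <= diam_pow d A.
Proof. by apply: ereal_sup_ubound; left. Qed.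

Lemma diam_pow0 d : diam_pow d set0 = 0.
Proof.
apply/eqP; rewrite eq_le diam_pow_ge0 andbT.
by apply: ge_ereal_sup => _ [->//|[x []]].
Qed.

Lemma le_diam_pow d A B : A `<=` B -> diam_pow d A <= diam_pow d B.
Proof.
move=> AB; apply: ereal_sup_le => _ [->|[x Ax [y Ay <-]]]; first by left.
by right; exists x; [exact: AB|exists y => //; exact: AB].
Qed.

Lemma hausdorff_delta_ge0 d e A : 0 <= hausdorff_delta d e A.
Proof.
apply: le_ereal_inf_tmp => _ [F _ <-].
by apply: nneseries_ge0 => k _ _; exact: diam_pow_ge0.
Qed.

Lemma le_hausdorff_delta d e A B : A `<=` B ->
  hausdorff_delta d e A <= hausdorff_delta d e B.
Proof.
move=> AB; apply: ereal_inf_le_tmp => _ [F [Fe BF] <-].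
by exists F => //; split => //; exact: subset_trans AB BF.
Qed.

Lemma hausdorff_delta0 d e : hausdorff_delta d e set0 = 0.
Proof.
apply/eqP; rewrite eq_le hausdorff_delta_ge0 andbT.
apply: ereal_inf_lbound; exists (fun=> set0); first by split.
by rewrite eseries0// => k _ _; exact: diam_pow0.
Qed.

Lemma hausdorff_delta_sigma_subadditive d e :
  sigma_subadditive (hausdorff_delta d e).
Proof.
move=> A; have [[i ioo]|] := pselect (exists i, hausdorff_delta d e (A i) = +oo).
  rewrite (eseries_pinfty _ _ ioo) ?leey// => k _.
  by rewrite -ltNye (lt_le_trans _ (hausdorff_delta_ge0 _ _ _)).
rewrite -forallNE => Aoo.
suff add2e (r : {posnum R}) : hausdorff_delta d e (\bigcup_n A n) <=
    \sum_(i <oo) hausdorff_delta d e (A i) + r%:num%:E.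
  by apply/lee_addgt0Pr => _/posnumP[].
rewrite (le_trans _ (epsilon_trick _ _ _))//; last first.
  by move=> k; exact: hausdorff_delta_ge0.
pose P k (B : (set 'rV[R]_n)^nat) := fine_cover e (A k) B /\
  \sum_(i <oo) diam_pow d (B i) <=
    hausdorff_delta d e (A k) + (r%:num / (2 ^ k.+1)%:R)%:E.
have [G PG] : {G : ((set 'rV[R]_n)^nat)^nat & forall k, P k (G k)}.
  apply: (@choice _ _ P) => k; rewrite /P.
  have hfin : hausdorff_delta d e (A k) \is a fin_num.
    by rewrite ge0_fin_numE ?hausdorff_delta_ge0// ltey; apply/eqP; exact: Aoo.
  have r1 : (0 < r%:num / (2 ^ k.+1)%:R)%R by [].
  have [_ [B AB <-] Blt] := lb_ereal_inf_adherent r1 hfin.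
  by exists B; split => //; exact/ltW.
have G_ge0 x : 0 <= (diam_pow d \o uncurry G) x by exact: diam_pow_ge0.
apply: (@le_trans _ _ (\esum_(i in setT) (diam_pow d \o uncurry G) i)).
  apply: ereal_inf_lbound => /=.
  have /card_esym/ppcard_eqP[f] := card_nat2.
  exists (uncurry G \o f).
    split => [k x y|].
      by rewrite /=; case: (f k) => i j; exact: ((PG i).1.1 j x y).
    move=> t [i _ At]; have [j _ Gt] := (PG i).1.2 _ At.
    by exists (f^-1%FUN (i, j)) => //=; rewrite invK ?inE.
  rewrite -(esum_pred_image (diam_pow d \o uncurry G) _ xpredT)
    ?[fun=> _]set_true//.
  by rewrite image_eq.
rewrite (_ : esum _ _ = \sum_(i <oo) \sum_(j <oo) diam_pow d (G i j));
  last first.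
  pose J : nat -> set (nat * nat) := fun i => [set (i, j) | j in setT].
  rewrite (_ : setT = \bigcup_k J k); last first.
    by rewrite predeqE => -[a b]; split => // _; exists a => //; exists b.
  rewrite esum_bigcupT /=; last 2 first.
    - apply/trivIsetP => i j _ _ ij.
      rewrite predeqE => -[k m] /=; split => //= -[] [_] _ [<-{k} _].
      by move=> [m' _] [] /esym/eqP; rewrite (negbTE ij).
    - by move=> /= [k m]; exact: diam_pow_ge0.
  rewrite -(image_id [set: nat]) -fun_true esum_pred_image//; last first.
    by move=> k _; apply: esum_ge0 => i _; exact: diam_pow_ge0.
  apply: eq_eseriesr => /= j _.
  rewrite -(esum_pred_image (diam_pow d \o uncurry G) (pair j) predT)//=;
    last 2 first.
    - by move=> *; exact: diam_pow_ge0.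
    - by move=> ? ? _ _; exact: (@can_inj _ _ _ snd).
  by congr esum; rewrite predeqE => -[a b]; split; move=> [i _ <-]; exists i.
apply: lee_nneseries => k *; last exact: (PG k).2.
by apply: nneseries_ge0 => *; exact: diam_pow_ge0.
Qed.

Lemma hausdorff_ge0 d A : 0 <= hausdorff d A.
Proof.
apply: le_trans (hausdorff_delta_ge0 d 1 A) _.
by apply: ereal_sup_ubound; exists 1%R => //=.
Qed.

Lemma hausdorff0 d : hausdorff d set0 = 0.
Proof.
apply/eqP; rewrite eq_le hausdorff_ge0 andbT.
by apply: ge_ereal_sup => _ [e _ <-]; rewrite hausdorff_delta0.
Qed.

Lemma le_hausdorff d : {homo hausdorff d : A B / A `<=` B >-> A <= B}.
Proof.
move=> A B AB; apply: ge_ereal_sup => _ [e e0 <-].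
apply: le_trans (le_hausdorff_delta d e AB) _.
by apply: ereal_sup_ubound; exists e.
Qed.

Lemma hausdorff_sigma_subadditive d : sigma_subadditive (hausdorff d).
Proof.
move=> A; apply: ge_ereal_sup => _ [e e0 <-].
apply: le_trans (hausdorff_delta_sigma_subadditive _ _ _) _.
apply: lee_nneseries => k *; first exact: hausdorff_delta_ge0.
by apply: ereal_sup_ubound; exists e.
Qed.

HB.instance Definition _ d := isOuterMeasure.Build R 'rV[R]_n (hausdorff d)
  (hausdorff0 d) (hausdorff_ge0 d) (@le_hausdorff d)
  (@hausdorff_sigma_subadditive d).

End hausdorff.

Section hausdorff_measure.
Local Open Scope ereal_scope.
Context {R : realType} {n : nat}.
Variable d : nat.
Implicit Types (A B X : set 'rV[R]_n) (e r : R).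

Local Notation H := (@hausdorff R n d).
Local Notation Hd := (@hausdorff_delta R n d).

Let Hd_sep e r A B : (e < r)%R ->
  (forall x y, A x -> B y -> (r <= enorm (x - y))%R) ->
  Hd e A + Hd e B <= Hd e (A `|` B).
Proof.
move=> er AB; apply: le_ereal_inf_tmp => _ [F [Fe ABF] <-].
have leA : Hd e A <= \sum_(k <oo) diam_pow d (F k `&` A).
  apply: ereal_inf_lbound; exists (fun k => F k `&` A) => //; split.
    by move=> k x y [Fx _] [Fy _]; exact: Fe Fx Fy.
  by move=> x Ax; have [k _ Fx] := ABF x (or_introl Ax); exists k.
have leB : Hd e B <= \sum_(k <oo) diam_pow d (F k `&` B).
  apply: ereal_inf_lbound; exists (fun k => F k `&` B) => //; split.
    by move=> k x y [Fx _] [Fy _]; exact: Fe Fx Fy.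
  by move=> x Bx; have [k _ Fx] := ABF x (or_intror Bx); exists k.
apply: le_trans (leeD leA leB) _.
rewrite -nneseriesD; try by move=> *; exact: diam_pow_ge0.
apply: lee_nneseries => k *.
  by apply: adde_ge0; exact: diam_pow_ge0.
have [[x [Fx Ax]]|/forallNP FA0] := pselect (exists x, (F k `&` A) x).
  rewrite (_ : F k `&` B = set0) ?diam_pow0 ?adde0; last first.
    rewrite -subset0 => y [Fy By].
    by have := lt_le_trans er (AB _ _ Ax By); rewrite ltNge (Fe k).
  by apply: le_diam_pow; exact: subIsetl.
rewrite (_ : F k `&` A = set0) ?diam_pow0 ?add0e.
  by apply: le_diam_pow; exact: subIsetl.
by rewrite -subset0 => y /FA0.
Qed.

Let Hd_anti e1 e2 A : (e1 <= e2)%R -> Hd e2 A <= Hd e1 A.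
Proof.
move=> e12; apply: ereal_inf_le_tmp => _ [F [Fe AF] <-].
by exists F => //; split => // k x y Fx Fy; exact: le_trans (Fe _ _ _ Fx Fy) e12.
Qed.

Lemma hausdorff_sep r A B : (0 < r)%R ->
  (forall x y, A x -> B y -> (r <= enorm (x - y))%R) ->
  H A + H B <= H (A `|` B).
Proof.
move=> r0 AB.
have [->|ABoo] := eqVneq (H (A `|` B)) +oo; first by rewrite leey.
have ABfin : H (A `|` B) \is a fin_num.
  by rewrite ge0_fin_numE ?hausdorff_ge0// ltey.
have key e1 e2 : (0 < e1)%R -> (0 < e2)%R -> Hd e1 A + Hd e2 B <= H (A `|` B).
  move=> e10 e20; pose e := Num.min (Num.min e1 e2) (r / 2)%R.
  have e0 : (0 < e)%R by rewrite !lt_min e10 e20 divr_gt0.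
  have er : (e < r)%R.
    by rewrite gt_min; apply/orP; right; rewrite ltr_pdivrMr// ltr_pMr// ltr1n.
  have ee1 : (e <= e1)%R by rewrite !ge_min lexx.
  have ee2 : (e <= e2)%R by rewrite !ge_min lexx orbT.
  apply: le_trans (leeD (Hd_anti A ee1) (Hd_anti B ee2)) _.
  apply: le_trans (Hd_sep er AB) _.
  by apply: ereal_sup_ubound; exists e.
have finB : H B \is a fin_num.
  rewrite ge0_fin_numE ?hausdorff_ge0//; 
  rewrite (@le_lt_trans _ _ (H (A `|` B)))// ?ltey//.
  by apply: le_hausdorff; exact: subsetUr.
rewrite -leeBrDr//; apply: ge_ereal_sup => _ [e1 e10 <-].
rewrite leeBrDr// addeC -leeBrDr; last first.
  rewrite ge0_fin_numE ?hausdorff_delta_ge0//.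
  rewrite (@le_lt_trans _ _ (H (A `|` B)))// ?ltey//.
  apply: le_trans (key e1 e1 e10 e10); rewrite leeDl//.
  exact: hausdorff_delta_ge0.
apply: ge_ereal_sup => _ [e2 e20 <-].
rewrite leeBrDr; first by rewrite addeC; exact: key.
rewrite ge0_fin_numE ?hausdorff_delta_ge0//.
rewrite (@le_lt_trans _ _ (H (A `|` B)))// ?ltey//.
apply: le_trans (key e1 e1 e10 e10); rewrite leeDl//.
exact: hausdorff_delta_ge0.
Qed.

Lemma hausdorff_halfspace (i : 'I_n) (a : R) :
  H.-caratheodory [set x | (x ord0 i <= a)%R].
Proof.
apply: le_caratheodory_measurable => X.
set M := [set x | _].
change (H (X `&` M) + H (X `&` ~` M) <= H X).
have [->|Xoo] := eqVneq (H X) +oo; first by rewrite leey.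
have Xfin : H X \is a fin_num by rewrite ge0_fin_numE ?hausdorff_ge0// ltey.
pose lev k : R := (a + k.+1%:R^-1)%R.
have lev_anti j k : (j <= k)%N -> (lev k <= lev j)%R.
  by move=> jk; rewrite /lev lerD2l lef_pV2 ?posrE ?ltr0n// ler_nat.
have lev_lt k : (lev k.+1 < lev k)%R.
  by rewrite /lev ltrD2l ltf_pV2 ?posrE ?ltr0n// ltr_nat.
have a_lev k : (a < lev k)%R by rewrite /lev ltrDl invr_gt0 ltr0n.
(* sets separated along the i-th coordinate *)
have sep (s t : R) (A B : set 'rV[R]_n) : (s < t)%R ->
    (forall x, A x -> (t <= x ord0 i)%R) -> (forall x, B x -> (x ord0 i <= s)%R) ->
    H A + H B <= H (A `|` B).
  move=> st At Bs; apply: (@hausdorff_sep (t - s)%R); first by rewrite subr_gt0.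
  move=> x y Ax By; apply: le_trans (ler_coord_enorm (x - y) i).
  rewrite !mxE; apply: le_trans (ler_norm _).
  by apply: lerB; [exact: At|exact: Bs].
pose Y k := X `&` [set x | (lev k <= x ord0 i)%R].
pose D k := X `&` [set x | (lev k.+1 <= x ord0 i < lev k)%R].
have MY k : H (X `&` M) + H (Y k) <= H X.
  rewrite addeC; apply: le_trans (sep _ _ _ _ (a_lev k) _ _) _.
  - by move=> x [].
  - by move=> x [].
  - by apply: le_hausdorff => x [] [].
have sumD b N : \sum_(0 <= j < N) H (D (j.*2 + b).+1) <= H X.
  suff : \sum_(0 <= j < N) H (D (j.*2 + b).+1) <= H (Y (N.*2 + b)%N).
    by move/le_trans; apply; apply: le_hausdorff; exact: subIsetl.
  elim: N => [|N IHN]; first by rewrite big_geq// hausdorff_ge0.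
  rewrite big_nat_recr//=; apply: le_trans (leeD IHN (lexx _)) _.
  apply: le_trans (sep _ _ _ _ (lev_lt (N.*2 + b)%N) _ _) _.
  - by move=> x [].
  - by move=> x [_ /andP[_ /ltW]].
  - rewrite doubleS !addSn; apply: le_hausdorff => x [[Xx]|[Xx]] /=.
    + move=> lx; split => //=; apply: le_trans lx; apply: lev_anti.
      by rewrite -addn2 leq_addr.
    + by move=> /andP[].
pose g j := H (D (j.*2 + 0).+1) + H (D (j.*2 + 1).+1).
have g0 j : 0 <= g j by apply: adde_ge0; exact: hausdorff_ge0.
have goo : \sum_(0 <= j <oo) g j < +oo.
  apply: (@le_lt_trans _ _ (H X + H X)); last first.
    by rewrite lte_add_pinfty// ltey.
  apply: lime_le; first exact: is_cvg_nneseries.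
  by apply: nearW => N; rewrite big_split/=; exact: leeD.
have cover k : X `&` ~` M `<=` Y k.*2.+1 `|`
    \bigcup_(j in ~` `I_k) (D (j.*2 + 0).+1 `|` D (j.*2 + 1).+1).
  move=> x [Xx /negP]; rewrite -ltNge => ax.
  have : exists m, (lev m <= x ord0 i)%R.
    by have [m mx] := ltr_add_invr ax; exists m; exact: ltW.
  move=> ex; case: (ex_minnP ex) => m lmx mmin.
  have [mk|km] := leqP m k.*2.+1.
    by left; split => //=; apply: le_trans lmx; exact: lev_anti.
  right; case: m km lmx mmin => // -[|m]; first by rewrite ltnS ltn0.
  rewrite !ltnS => km lmx mmin; have lx : (x ord0 i < lev m.+1)%R.
    by rewrite ltNge; apply/negP => /mmin; rewrite ltnn.
  exists m./2 => /=.
    by apply/negP; rewrite -leqNgt geq_half_double.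
  rewrite -[m]odd_double_half addnC in lmx lx.
  by case: (odd m) lmx lx => lmx lx; [right|left]; split => //=; rewrite lmx.
have le_tail k : H (X `&` M) + H (X `&` ~` M) <=
    H X + \sum_(k <= j <oo) g j.
  apply: le_trans (leeD (lexx _) (le_hausdorff d (cover k))) _.
  apply: le_trans (leeD (lexx _) (outer_measureU2 _ _ _)) _.
  rewrite addeA; apply: leeD; first exact: MY.
  apply: le_trans (outer_measure_sigma_subadditive_tail _ _ _) _.
  apply: lee_nneseries => j *; first exact: hausdorff_ge0.
  exact: outer_measureU2.
have cvg_tail : H X + \sum_(k <= j <oo) g j @[k --> \oo] --> H X + 0.
  apply: cvgeD; first by rewrite fin_num_adde_defl.
  - exact: cvg_cst.
  - exact: nneseries_tail_cvg.
rewrite -[leRHS]adde0 -(cvg_lim _ cvg_tail)//.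
apply: lime_ge; first by apply/cvg_ex; exists (H X + 0).
by apply: nearW.
Qed.
End hausdorff_measure.

Section hausdorff_is_measure.
Local Open Scope ereal_scope.
Context {R : realType} {n : nat}.
Variable d : nat.

Local Notation H := (@hausdorff R n d).

Lemma hausdorff_caratheodory (A : set 'rV[R]_n) :
  measurable A -> H.-caratheodory A.
Proof.
suff mid : measurable_fun [set: caratheodory_type H]
    (id : caratheodory_type H -> 'rV[R]_n).
  by move=> mA; have := mid measurableT _ mA; rewrite setTI.
apply: measurable_fun_rVP => i.
apply: (measurability _ (RGenOInfty.measurableE R)).
move=> X [Y [a ->] <-]; rewrite setTI.
rewrite (_ : _ @^-1` _ = ~` [set x : 'rV[R]_n | (x ord0 i <= a)%R]).
  apply: caratheodory_measurable_setC; exact: hausdorff_halfspace.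
apply/seteqP; split => x /=; rewrite in_itv/= andbT.
  by move=> ax /(lt_le_trans ax); rewrite ltxx.
by move/negP; rewrite -ltNge.
Qed.

Definition hausdorff_measure : set 'rV[R]_n -> \bar R := H.

Let hausdorff_measure_sigma_additive : semi_sigma_additive hausdorff_measure.
Proof.
move=> F mF tF mUF.
apply: (@caratheodory_measure_sigma_additive _ _ H) => //.
  by move=> k; exact: hausdorff_caratheodory.
exact: hausdorff_caratheodory.
Qed.

HB.instance Definition _ := isMeasure.Build _ _ _ hausdorff_measure
  (hausdorff0 d) (hausdorff_ge0 d) hausdorff_measure_sigma_additive.

End hausdorff_is_measure.

Section surface_measure.
Context {R : realType}.

Definition unit_ball_volume (k : nat) : R :=
  fine (lebesgue_rV k [set x : 'rV[R]_k | enorm x <= 1]).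

Lemma surface_const_ge0 (k : nat) : 0 <= unit_ball_volume k / 2 ^+ k.
Proof.
by apply: divr_ge0; [apply: fine_ge0; exact: measure_ge0|exact: exprn_ge0].
Qed.

(* Surface measure on hypersurfaces of R^n: the (n-1)-dimensional Hausdorff
   measure, normalized so as to agree with Lebesgue measure on R^(n-1).  *)
Definition surface_measure (n : nat) : {measure set 'rV[R]_n -> \bar R} :=
  mscale (NngNum (surface_const_ge0 n.-1)) (hausdorff_measure n.-1).

End surface_measure.

Section domain.
Context {R : realType} {n : nat}.
Implicit Types (Omega : set 'rV[R]_n) (x y : 'rV[R]_n).

Definition bounded_domain Omega :=
  [/\ open Omega, connected Omega, Omega !=set0 & bounded_set Omega].

Definition boundary Omega : set 'rV[R]_n := closure Omega `\` interior Omega.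

Definition delta Omega x : R := inf [set enorm (x - y) | y in ~` Omega].

End domain.

Section spaces.
Context {R : realType} {n : nat}.
Variables (Omega : set 'rV[R]_n) (gamma : R).
Implicit Types (u v f : 'rV[R]_n -> R) (w : R -> 'rV[R]_n -> R).

Local Notation leb := (lebesgue_rV n).
Local Notation leb1 := (@lebesgue_measure R).
Local Notation weight x := (delta Omega x `^ gamma).

Definition L2 u := measurable_fun Omega u /\
  (\int[leb]_(x in Omega) (u x ^+ 2)%:E < +oo)%E.

Definition inner u v : R := \int[leb]_(x in Omega) (u x * v x).

Definition L2_cvg (u_ : nat -> 'rV[R]_n -> R) u :=
  (\int[leb]_(x in Omega) ((u_ k x - u x) ^+ 2)%:E)%E @[k --> \oo] --> 0%E.

(* Below, X_weight is the weighted version of X: L^1(Omega, delta^gamma) for L1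
   and delta^gamma L^oo for Linf; L1_L1_weight is L^1(0, T; L^1(Omega,
   delta^gamma)) and Linf_Linf_weight is delta^gamma L^oo((0, T) x Omega).
   In L^1(Omega, delta^gamma), integrability on compact subsets of Omega is
   automatic, since delta is bounded below by a positive constant there *)
Definition L1_weight u := measurable_fun Omega u /\
  (\int[leb]_(x in Omega) (`|u x| * weight x)%:E < +oo)%E.

Definition L1_weight_cvg (u_ : nat -> 'rV[R]_n -> R) u :=
  (\int[leb]_(x in Omega) (`|u_ k x - u x| * weight x)%:E)%E @[k --> \oo]
    --> 0%E.

Definition Linf_weight f := measurable_fun Omega f /\
  exists M, {ae leb, forall x, Omega x -> `|f x| <= M * weight x}.

Variable T : R.

Definition L1_L1_weight w :=
  measurable_fun (`]0, T[ `*` Omega)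
    (fun p : measurableTypeR R * 'rV[R]_n => w p.1 p.2) /\
  (\int[leb1]_(t in `]0%R, T[) \int[leb]_(x in Omega)
     (`|w t x| * weight x)%:E < +oo)%E.

Definition Linf_Linf_weight w :=
  measurable_fun (`]0, T[ `*` Omega)
    (fun p : measurableTypeR R * 'rV[R]_n => w p.1 p.2) /\
  exists M, {ae (leb1 \x leb)%E, forall p : measurableTypeR R * 'rV[R]_n,
    (`]0, T[ `*` Omega) p -> `|w p.1 p.2| <= M * weight p.2}.

(* The lateral boundary carries the product of surface and Lebesgue measure.
   The space factor comes first because product_measure1 needs sigma-finiteness
   of its second factor only: a bounded domain may have a boundary that is not
   sigma-finite for the surface measure. *)
Definition lateral_measure :
    {measure set ('rV[R]_n * measurableTypeR R) -> \bar R} :=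
  (@surface_measure R n \x leb1)%E.

(* h takes (t, zeta), whereas lateral_measure is on pairs (zeta, t) *)
Definition L1_lateral (h : R -> 'rV[R]_n -> R) :=
  measurable_fun (boundary Omega `*` `]0, T[)
    (fun p : 'rV[R]_n * measurableTypeR R => h p.2 p.1) /\
  (\int[lateral_measure]_(p in boundary Omega `*` `]0%R, T[)
     `|h p.2 p.1|%:E < +oo)%E.

End spaces.

Section green.
Context {R : realType} {n : nat}.
Variables (Omega : set 'rV[R]_n) (gamma : R).
Variable G : 'rV[R]_n -> 'rV[R]_n -> \bar R.
Implicit Types (f g : 'rV[R]_n -> R).

Local Notation leb := (lebesgue_rV n).
Local Notation weight x := (delta Omega x `^ gamma).

Definition nonneg_kernel :=
  (forall x y, Omega x -> Omega y -> (0 <= G x y)%E) /\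
  measurable_fun (Omega `*` Omega) (uncurry G).

Definition green f (x : 'rV[R]_n) : \bar R :=
  (\int[leb]_(y in Omega) (G x y * (f y)%:E))%E.

Definition fgreen f (x : 'rV[R]_n) : R := fine (green f x).

Definition L2_stable := forall f, L2 Omega f -> L2 Omega (fgreen f).

Definition L2_compact := forall (f_ : nat -> 'rV[R]_n -> R) (M : R),
  (forall k, L2 Omega (f_ k)) ->
  (forall k, \int[leb]_(x in Omega) (f_ k x ^+ 2)%:E <= M%:E)%E ->
  exists (e : nat -> nat) g, [/\ {homo e : i j / (i < j)%N}, L2 Omega g &
    L2_cvg Omega (fun k => fgreen (f_ (e k))) g].

Definition L2_self_adjoint := forall f g, L2 Omega f -> L2 Omega g ->
  inner Omega (fgreen f) g = inner Omega f (fgreen g).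

Definition L2_injective := forall f, L2 Omega f ->
  {ae leb, forall x, Omega x -> fgreen f x = 0} ->
  {ae leb, forall x, Omega x -> f x = 0}.

Definition L2_positive := forall f, L2 Omega f -> 0 <= inner Omega (fgreen f) f.

Definition green_L2_operator :=
  [/\ L2_stable, L2_compact, L2_self_adjoint, L2_injective & L2_positive].

Definition kernel_profile (s : R) (x y : 'rV[R]_n) : R :=
  enorm (x - y) `^ (- (n%:R - 2 * s)) *
  Num.min (delta Omega x * delta Omega y / enorm (x - y) ^+ 2) 1 `^ gamma.

Definition kernel_estimate (s : R) :=
  exists c C : R, [/\ 0 < c, 0 < C &
    forall x y, Omega x -> Omega y -> x != y ->
      [/\ G x y = G y x, ((c * kernel_profile s x y)%:E <= G x y)%E &
          (G x y <= (C * kernel_profile s x y)%:E)%E]].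

(* green_regular says that the Green operator maps delta^gamma L^oo(Omega) to
   delta^gamma C(closure Omega), green_continuous that it is continuous for the
   norms ||f / delta^gamma||_oo of these spaces. *)
Definition green_regular := forall f, Linf_weight Omega gamma f ->
  exists F : 'rV[R]_n -> R, {within closure Omega, continuous F} /\
    forall x, Omega x -> green f x = (weight x * F x)%:E.

Definition green_continuous := forall f, Linf_weight Omega gamma f ->
  forall e : R, 0 < e -> exists2 r : R, 0 < r &
    forall g, Linf_weight Omega gamma g ->
      {ae leb, forall x, Omega x -> `|g x - f x| <= r * weight x} ->
      forall x, Omega x -> `|fgreen g x - fgreen f x| <= e * weight x.

Definition green_normal_derivative :=
  forall zeta y, boundary Omega zeta -> Omega y ->
    exists l : R, (G x y * ((weight x)^-1)%:E)%E
      @[x --> within Omega (nbhs zeta)] --> l%:E.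

End green.

(* lambda k and phi k are the (k+1)-st eigenvalue and eigenfunction.  Each
   phi k is the representative of its class for which the eigenvalue equation
   holds at every point of Omega. *)
Definition eigendecomposition (R : realType) (n : nat) (Omega : set 'rV[R]_n)
    (G : 'rV[R]_n -> 'rV[R]_n -> \bar R)
    (lambda : nat -> R) (phi : nat -> 'rV[R]_n -> R) :=
  [/\ (forall k, L2 Omega (phi k)) /\
      (forall i j, inner Omega (phi i) (phi j) = (i == j)%:R),
      forall f, L2 Omega f -> L2_cvg Omega
        (fun N x => \sum_(k < N) inner Omega f (phi k) * phi k x) f,
      forall k x, Omega x ->
        green Omega G (phi k) x = ((lambda k)^-1 * phi k x)%:E,
      0 < lambda 0 < lambda 1 /\ (forall k, lambda k <= lambda k.+1) &
      lambda k @[k --> \oo] --> +oo].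

Section heat.
Context {R : realType} {n : nat}.
Variables (Omega : set 'rV[R]_n) (gamma : R).
Variables (lambda : nat -> R) (phi : nat -> 'rV[R]_n -> R).
Implicit Types (u v : 'rV[R]_n -> R) (f h w : R -> 'rV[R]_n -> R).
Implicit Types (t T : R) (x y zeta : 'rV[R]_n).

Local Notation leb := (lebesgue_rV n).
Local Notation leb1 := (@lebesgue_measure R).

(* v = S(t)[u] in L^2(Omega) *)
Definition heat_L2 t u v := L2 Omega v /\
  L2_cvg Omega (fun N x => \sum_(k < N)
    expR (- lambda k * t) * inner Omega u (phi k) * phi k x) v.

(* v = S(t)[u] for the continuous extension to L^1(Omega, delta^gamma) *)
Definition heat_L1 t u v :=
  [/\ L1_weight Omega gamma u, L1_weight Omega gamma v &
    exists u_ v_ : nat -> 'rV[R]_n -> R,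
      [/\ forall k, L2 Omega (u_ k), L1_weight_cvg Omega gamma u_ u,
          forall k, heat_L2 t (u_ k) (v_ k) &
          L1_weight_cvg Omega gamma v_ v]].

(* For t > 0, the representative of S(t)[u] that is continuous on Omega; it is
   0 by convention when u is not in L^1(Omega, delta^gamma). *)
Definition heat t u : 'rV[R]_n -> R :=
  xget (cst 0) [set v | heat_L1 t u v /\
    forall x, Omega x -> {for x, continuous v}].

Definition submarkovian := forall t u v, 0 <= t -> measurable_fun Omega u ->
  {ae leb, forall x, Omega x -> 0 <= u x <= 1} -> heat_L2 t u v ->
  {ae leb, forall x, Omega x -> 0 <= v x <= 1}.

Definition heat_kernel t x y : R :=
  limn (series (fun k => expR (- lambda k * t) * phi k x * phi k y)).

Definition normal_derivative v zeta : R :=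
  lim (v x / delta Omega x `^ gamma @[x --> within Omega (nbhs zeta)]).

Definition heat_kernel_normal t zeta y : R :=
  normal_derivative (fun x => heat_kernel t x y) zeta.

Definition heat_solution u f h t x : R :=
  heat t u x
  + \int[leb1]_(sigma in `]0, t[) heat (t - sigma) (f sigma) x
  + \int[lateral_measure]_(p in boundary Omega `*` `]0, t[)
      (heat_kernel_normal (t - p.2) p.1 x * h p.2 p.1).

Definition weak_dual_solution T u f h w :=
  forall psi, Linf_Linf_weight Omega gamma T psi ->
  let Hpsi := heat_solution (cst 0) psi (fun _ => cst 0) in
  \int[leb]_(x in Omega) (\int[leb1]_(t in `]0, T[) (w t x * psi (T - t) x)) =
    \int[leb]_(x in Omega) (u x * Hpsi T x)
    + \int[leb]_(x in Omega)
        (\int[leb1]_(t in `]0, T[) (f t x * Hpsi (T - t) x))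
    + \int[lateral_measure]_(p in boundary Omega `*` `]0, T[)
        (h p.2 p.1 * normal_derivative (Hpsi (T - p.2)) p.1).

End heat.

(* Main.v *)
Require Import Defs.
From HB Require Import structures.
From mathcomp Require Import all_boot all_order all_algebra.
From mathcomp Require Import all_classical all_reals all_analysis.
From mathcomp Require Import measurable_realfun.
From mathcomp Require Import lra ring.

Set Implicit Arguments.
Unset Strict Implicit.
Unset Printing Implicit Defensive.
Import Order.TTheory GRing.Theory Num.Theory.
Import numFieldNormedType.Exports.
Local Open Scope classical_set_scope.
Local Open Scope ring_scope.

(** Write w = delta^gamma. Splitting G at |x - y| = e into a near part of small
    mass and a far part bounded by C_e w(x) w(y), and absorbing the near part in
    phi_k = lambda_k G[phi_k], gives |phi_k| <= M_k w. The same argument for the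
    vector (phi_k)_{k < N} bounds sum_{k < N} phi_k^2 by a power of lambda_N
    times w^2, and integrating over Omega makes lambda_N grow polynomially, so
    that sum_k exp(- lambda_k t) M_k^2 is finite: the heat kernel is
    w(x) w(y) N(t, x, y) with N continuous up to the boundary, and N >= 0 by the
    sub-Markov property.  Since c w <= G[w] <= C w and t |-> S(t)G[w] is
    nonincreasing (its derivative is - S(t)w), S(t)w <= (C / c) w, i.e. the
    integral of w(y)^2 N(t, z, y) over y is bounded uniformly in t > 0 and z in
    the closure of Omega. Therefore the initial, interior and boundary terms of
    the solution are all integrals of the one nonnegative kernel w(x) N(t, z, x)
    against finite measures on the closed cylinder, and Fubini gives both the
    norm bound and the weak-dual identity. Uniqueness follows by testing the
    difference d of two solutions with sgn(d) w. *)

(** What shapes the absorption is that no bound is known beforehand. For a single eigenfunction only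
    integrability against w is available, so the near part is absorbed in the norm of L^1(w): by the
    symmetry of G, integrating it against w costs the same small factor, and the argument runs on
    the part of |phi_k| above a multiple of w. Once every phi_k is O(w), the supremum of the vector
    is finite and half of it can be absorbed directly; the length of the vector then enters only
    through its largest eigenvalue. The pointwise bound of the heat kernel gives no control as t
    tends to 0. Every integral in time rests instead on the bound of S(t)w, uniform down to t = 0;
    it yields the factor T in the final constant. The boundary of Omega may fail to be sigma-finite
    for surface measure, so Fubini is applied to the restriction of that measure to the set where h
    is nonzero. Test functions are bounded by w only almost everywhere, while the duality argument
    is pointwise; truncation mediates between the two. *)

Section enorm_facts.
Context {R : realType} {n : nat}.
Implicit Types x y z : 'rV[R]_n.

Lemma enorm_ge0 x : 0 <= enorm x.
Proof. exact: sqrtr_ge0. Qed.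

Lemma sqr_enorm x : enorm x ^+ 2 = \sum_i x ord0 i ^+ 2.
Proof. by rewrite sqr_sqrtr// sumr_ge0// => i _; exact: sqr_ge0. Qed.

Lemma enormN x : enorm (- x) = enorm x.
Proof. by congr Num.sqrt; apply: eq_bigr => i _; rewrite mxE sqrrN. Qed.

Lemma enormB x y : enorm (x - y) = enorm (y - x).
Proof. by rewrite -enormN opprB. Qed.

Lemma enorm0 : enorm (0 : 'rV[R]_n) = 0.
Proof. by rewrite /enorm big1 ?sqrtr0// => i _; rewrite mxE expr0n. Qed.

(** Weighted arithmetic-geometric mean inequality: with a = |y| / |x|, the terms (a x_i^2 + y_i^2 /
    a) / 2 sum to exactly |x| |y|. The weight needs both norms to be nonzero, hence the two
    degenerate cases. *)
Lemma cauchy_schwarz_enorm x y :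
  \sum_i x ord0 i * y ord0 i <= enorm x * enorm y.
Proof.
have [x0|x0] := eqVneq (enorm x) 0.
  rewrite x0 mul0r big1// => i _.
  have := ler_coord_enorm x i.
  by rewrite x0 normr_le0 => /eqP ->; rewrite mul0r.
have [y0|y0] := eqVneq (enorm y) 0.
  rewrite y0 mulr0 big1// => i _.
  have := ler_coord_enorm y i.
  by rewrite y0 normr_le0 => /eqP ->; rewrite mulr0.
have xp : 0 < enorm x by rewrite lt0r x0 enorm_ge0.
have yp : 0 < enorm y by rewrite lt0r y0 enorm_ge0.
set a := enorm y / enorm x.
have ap : 0 < a by rewrite divr_gt0.
apply: (@le_trans _ _ (\sum_i (a * x ord0 i ^+ 2 + a^-1 * y ord0 i ^+ 2) / 2)).
  apply: ler_sum => i _; rewrite ler_pdivlMr//.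
  rewrite -subr_ge0.
  rewrite (_ : _ - _ = a^-1 * (a * x ord0 i - y ord0 i) ^+ 2).
    by rewrite mulr_ge0 ?sqr_ge0// invr_ge0 ltW.
  by field; rewrite gt_eqF.
rewrite -mulr_suml big_split/= -!mulr_sumr -!sqr_enorm /a.
by rewrite le_eqVlt; apply/orP; left; apply/eqP; field; rewrite x0 y0.
Qed.

Lemma enorm_triangle x y : enorm (x + y) <= enorm x + enorm y.
Proof.
rewrite -(@ler_pXn2r _ 2)// ?nnegrE ?addr_ge0 ?enorm_ge0//.
rewrite sqr_enorm sqrrD !sqr_enorm.
under eq_bigr do rewrite mxE sqrrD.
rewrite !big_split/= lerD2r lerD2l mulr2n -mulr2n lerMn2r/=.
exact: cauchy_schwarz_enorm.
Qed.

Lemma le_enorm_dist x y z : enorm (x - z) <= enorm (x - y) + enorm (y - z).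
Proof. by rewrite (le_trans _ (enorm_triangle _ _))// addrA subrK. Qed.

Lemma ler_coord_norm x i : `|x ord0 i| <= `|x|.
Proof.
rewrite [leRHS]mx_normrE.
by apply: (le_bigmax _ (fun ij : 'I_1 * 'I_n => `|x ij.1 ij.2|) (ord0, i)).
Qed.

Lemma norm_rV_le x (r : R) : 0 <= r -> (forall i, `|x ord0 i| <= r) -> `|x| <= r.
Proof.
move=> r0 xr; rewrite [leLHS]mx_normrE.
by apply/bigmax_leP; split => // -[i j] _/=; rewrite [i]ord1.
Qed.

Lemma norm_le_enorm x : `|x| <= enorm x.
Proof. by apply: norm_rV_le => [|i]; [exact: enorm_ge0|exact: ler_coord_enorm]. Qed.

(** Neighbourhoods and boxes refer to the sup norm, the kernel and [delta] to the Euclidean one;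
    this bound and [norm_le_enorm] pass between them. *)
Lemma enorm_le_norm x : enorm x <= n%:R * `|x|.
Proof.
rewrite -(@ler_pXn2r _ 2)// ?nnegrE ?mulr_ge0 ?enorm_ge0//.
rewrite sqr_enorm (@le_trans _ _ (\sum_(i < n) `|x| ^+ 2))//.
  apply: ler_sum => i _.
  by rewrite -real_normK ?num_real// ler_pXn2r ?nnegrE// ler_coord_norm.
rewrite sumr_const card_ord exprMn -[leLHS]mulr_natl ler_wpM2r ?sqr_ge0//.
by rewrite -natrX ler_nat; case: n => // m; rewrite leq_pmulr.
Qed.

End enorm_facts.

(** * Borel sets of R^n and the sigma-algebra of the coordinates *)

Section measurable_open_rV.
Context {R : realType} {n : nat}.

(** Closed sup-norm ball, written coordinate by coordinate: it is then measurable for the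
    sigma-algebra generated by the coordinates, and its Lebesgue measure is computed factor by
    factor. *)
Definition cbox (x : 'rV[R]_n) (r : R) : set 'rV[R]_n :=
  [set y | forall i, x ord0 i - r <= y ord0 i <= x ord0 i + r].

Lemma cboxP (x y : 'rV[R]_n) (r : R) : 0 <= r -> cbox x r y <-> `|y - x| <= r.
Proof.
move=> r0; split=> [xy|yxr i].
  by apply: norm_rV_le => // i; rewrite !mxE ler_distl; exact: xy.
by rewrite -ler_distl (le_trans _ yxr)// (le_trans _ (ler_coord_norm _ i))// !mxE.
Qed.

Lemma measurable_cbox x r : measurable (cbox x r).
Proof.
rewrite (_ : cbox x r = \bigcap_(i in [set: 'I_n])
   ((fun y : 'rV[R]_n => y ord0 i) @^-1` `[x ord0 i - r, x ord0 i + r])); last first.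
  by apply/seteqP; split => y /= H i => [_|]; rewrite /= ?in_itv/=; [exact: H|have := H i Logic.I; rewrite /= in_itv].
apply: fin_bigcap_measurable => //.
move=> i _; rewrite -[X in measurable X]setTI.
exact: measurable_coord_rV.
Qed.

(** An open set is the union of the boxes with rational centre and radius that it contains, and each
    box is measurable. Boxes that stick out are replaced by the empty set, so that the union runs
    over a countable type. *)
Lemma open_measurable_rV (U : set 'rV[R]_n) : open U -> measurable U.
Proof.
move=> oU.
pose B (p : 'rV[rat]_n * rat) : set 'rV[R]_n :=
  if pselect (cbox (map_mx ratr p.1) (ratr p.2) `<=` U)
  then cbox (map_mx ratr p.1) (ratr p.2) else set0.
have -> : U = \bigcup_p B p.
  apply/seteqP; split=> [x Ux|x [p _]]; last first.
    by rewrite /B; case: pselect => // pU /pU.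
  have /nbhs_ballP[e /= e0 eU] := oU _ Ux.
  have [r] := rat_in_itvoo (divr_gt0 e0 (ltr0n _ 2)).
  rewrite in_itv/= => /andP[r0 re].
  have q_ (i : 'I_n) : {q : rat | x ord0 i - ratr r < ratr q < x ord0 i + ratr r}.
    apply: cid; have [|q] := @rat_in_itvoo R (x ord0 i - ratr r) (x ord0 i + ratr r).
      by rewrite ltrBlDr -addrA ltrDl addr_gt0.
    by rewrite in_itv => qi; exists q.
  pose q : 'rV[rat]_n := \row_i sval (q_ i).
  have xq : cbox (map_mx ratr q) (ratr r) x.
    move=> i; rewrite !mxE; case: (q_ i) => /= t /andP[t1 t2].
    by rewrite lerBlDr (ltW t2) -lerBlDr ltW.
  exists (q, r) => //; rewrite /B; case: pselect => //= -[] y.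
  move/cboxP => /(_ (ltW r0)) yq; apply: eU.
  rewrite mx_norm_ball/= /ball_/= -(subrKA (map_mx ratr q)).
  rewrite (le_lt_trans (ler_normD _ _))// (@lt_le_trans _ _ (e / 2 + e / 2))//.
    apply: ltrD; last by rewrite distrC (le_lt_trans yq).
    by rewrite (le_lt_trans _ re)//; apply/cboxP => //; exact: ltW.
  by rewrite -splitr.
apply: countable_bigcupT_measurable.
  exact: countableP.
by move=> p; rewrite /B; case: ifP => _ ; [exact: measurable_cbox|exact: measurable0].
Qed.

Lemma closed_measurable_rV (U : set 'rV[R]_n) : closed U -> measurable U.
Proof.
by move=> cU; rewrite -[U]setCK; apply: measurableC; apply: open_measurable_rV; exact: closed_openC.
Qed.

Lemma continuous_within_measurable_rV (D : set 'rV[R]_n) (f : 'rV[R]_n -> R) :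
  measurable D -> {within D, continuous f} -> measurable_fun D f.
Proof.
move=> mD cf; apply: (measurability _ (RGenOInfty.measurableE R)).
move=> _ [_ [a ->] <-].
have /continuousP/(_ `]a, +oo[%classic (rray_open a)) := cf.
move=> /open_subspaceP[V oV DV].
rewrite setIC -DV; exact: measurableI (open_measurable_rV oV) mD.
Qed.

End measurable_open_rV.

(** * Lebesgue measure of boxes, points and bounded sets *)

Section volume.
Context {R : realType}.
Local Notation leb n := (@lebesgue_rV R n).

Lemma cons_rV_head n (p : measurableTypeR R * 'rV[R]_n) :
  cons_rV p ord0 ord0 = p.1.
Proof.
rewrite /cons_rV (_ : ord0 = lshift n (ord0 : 'I_1)); last exact: val_inj.
by rewrite [LHS](row_mxEl (p.1)%:M p.2) mxE eqxx mulr1n.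
Qed.

Lemma cons_rV_tail n (p : measurableTypeR R * 'rV[R]_n) i :
  cons_rV p ord0 (rshift 1 i) = p.2 ord0 i.
Proof. exact: (row_mxEr (p.1)%:M p.2). Qed.

Lemma lebesgue_cbox n (x : 'rV[R]_n) r : 0 < r ->
  leb n (cbox x r) = ((2 * r) ^+ n)%:E.
Proof.
elim: n x => [|n IH] x r0.
  rewrite expr0/= diracE (_ : _ \in _)//; apply/mem_set => -[//].
rewrite [LHS]/= /lebesgue_step /pushforward.
pose x' : 'rV[R]_n := rsubmx (x : 'rV[R]_(1 + n)).
rewrite (_ : _ @^-1` _ = `[x ord0 ord0 - r, x ord0 ord0 + r] `*` cbox x' r).
  rewrite product_measure1E//; last exact: measurable_cbox.
  rewrite [X in (X * _)%E]lebesgue_measure_itv/= lte_fin ltrBlDr -addrA ltrDl addr_gt0//.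
  by rewrite IH// -EFinD -EFinM exprS; congr (_ * _)%:E; ring.
apply/seteqP; split=> [[a y] H|[a y] [/=]].
  split => [|i] /=; first by have := H ord0; rewrite cons_rV_head in_itv.
  by have := H (rshift 1 i); rewrite cons_rV_tail /x' mxE.
rewrite in_itv/= => Ha Hy i.
have [j ->|j ->] := split_ordP (i : 'I_(1 + n)).
  rewrite [j]ord1 (_ : lshift n ord0 = ord0) ?cons_rV_head//; exact: val_inj.
by have := Hy j; rewrite cons_rV_tail /x' mxE.
Qed.

Lemma lebesgue_rV_set1 n (x : 'rV[R]_n) : (0 < n)%N -> leb n [set x] = 0%E.
Proof.
move=> n0; apply/eqP; rewrite eq_le measure_ge0 andbT.
have m1 : measurable [set x].
  by apply: closed_measurable_rV; apply: accessible_closed_set1; exact: hausdorff_accessible.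
apply/lee_addgt0Pr => e e0; rewrite add0e.
(* One of the n factors 2 r is at most e and the others are at most 1. In dimension 0, where the
   measure is a Dirac mass, there is no such factor. *)
pose r := Num.min (e / 2) (1 / 2).
have r0 : 0 < r by rewrite lt_min !divr_gt0.
apply: (@le_trans _ _ (leb n (cbox x r))).
  apply: le_measure; rewrite ?inE//; first exact: measurable_cbox.
  by move=> _ -> i; rewrite lerBlDr lerDl (ltW r0).
rewrite lebesgue_cbox// lee_fin -(prednK n0) exprS.
apply: (@le_trans _ _ (2 * r)).
  rewrite ler_piMr ?mulr_ge0 ?(ltW r0)// exprn_ile1 ?mulr_ge0 ?(ltW r0)//.
  by rewrite mulrC -ler_pdivlMr// ge_min lexx orbT.
by rewrite mulrC -ler_pdivlMr// ge_min lexx.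
Qed.

Lemma bounded_rV_cbox n (A : set 'rV[R]_n) : bounded_set A ->
  exists2 r, 0 < r & A `<=` cbox 0 r.
Proof.
move=> [M [_ MA]]; exists (`|M| + 1); first by rewrite ltr_wpDl.
move=> x Ax; apply/cboxP; first by rewrite addr_ge0.
by rewrite subr0; apply: MA => //; rewrite (le_lt_trans (ler_norm _))// ltrDl.
Qed.

Lemma lebesgue_bounded_lty n (A : set 'rV[R]_n) : measurable A ->
  bounded_set A -> (leb n A < +oo)%E.
Proof.
move=> mA /bounded_rV_cbox[r r0 Ar].
apply: (@le_lt_trans _ _ (leb n (cbox 0 r))).
  by apply: le_measure; rewrite ?inE//; exact: measurable_cbox.
by rewrite lebesgue_cbox// ltry.
Qed.

Lemma lebesgue_open_gt0 n (U : set 'rV[R]_n) x : open U -> U x -> (0 < leb n U)%E.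
Proof.
move=> oU Ux; have /nbhs_ballP[e /= e0 eU] := oU _ Ux.
have e20 : 0 < e / 2 by rewrite divr_gt0.
apply: (@lt_le_trans _ _ (leb n (cbox x (e / 2)))).
  by rewrite lebesgue_cbox// lte_fin exprn_gt0// mulr_gt0.
apply: le_measure; rewrite ?inE//.
- exact: measurable_cbox.
- exact: open_measurable_rV.
move=> y /cboxP => /(_ (ltW e20)) yx; apply: eU.
rewrite mx_norm_ball/= /ball_/= distrC (le_lt_trans yx)//.
by rewrite ltr_pdivrMr// ltr_pMr// ltr1n.
Qed.

End volume.

(** * Lipschitz functions and integrals of negative powers of the distance *)

Lemma lipschitz_rV_continuous (R : realType) n (f : 'rV[R]_n -> R) (C : R) :
  (forall x y, `|f x - f y| <= C * `|x - y|) -> continuous f.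
Proof.
move=> fC x; apply/(@cvgrPdist_le _ _ _ (nbhs x)) => e e0.
have C0 : 0 < `|C| + 1 by rewrite ltr_wpDl.
apply/nbhs_ballP; exists (e / (`|C| + 1)); first exact: divr_gt0.
move=> y; rewrite mx_norm_ball/= /ball_/= ltr_pdivlMr// => xy.
rewrite (le_trans (fC _ _))// (le_trans _ (ltW xy))// mulrC ler_wpM2l//.
by rewrite (le_trans (ler_norm _))// lerDl.
Qed.

Lemma continuous_measurable_rV (R : realType) n (D : set 'rV[R]_n) f :
  measurable D -> continuous f -> measurable_fun D (f : 'rV[R]_n -> R).
Proof.
by move=> mD cf; apply: continuous_within_measurable_rV => //; exact: continuous_subspaceT.
Qed.

Lemma lipschitz_enorm (R : realType) n (x y : 'rV[R]_n) :
  `|enorm x - enorm y| <= n%:R * `|x - y|.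
Proof.
apply: le_trans (enorm_le_norm _).
rewrite ler_norml lerBlDr -{3}(subrK y x) enorm_triangle andbT.
by rewrite lerNl opprB lerBlDr enormB -{1}(subrK x y) enorm_triangle.
Qed.

Lemma continuous_enormB (R : realType) n (x : 'rV[R]_n) :
  continuous (fun y : 'rV[R]_n => enorm (x - y)).
Proof.
apply: (@lipschitz_rV_continuous _ _ _ n%:R) => y z.
rewrite (le_trans (lipschitz_enorm _ _))// ler_wpM2l// distrC.
by rewrite (_ : x - z - (x - y) = y - z)// opprB addrCA addrAC subrr add0r.
Qed.

Lemma measurable_enormB_powR (R : realType) n (D : set 'rV[R]_n) x a :
  measurable D -> measurable_fun D (fun y => enorm (x - y) `^ a).
Proof.
move=> mD; apply: (measurableT_comp (measurable_powR a)).
by apply: continuous_measurable_rV => //; exact: continuous_enormB.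
Qed.

(** Dyadic decomposition of the box: where r_(j+1) < |y - x| <= r_j = e / 2^j, the integrand is at
    most r_(j+1)^(-a), and the box of radius r_j has volume (2 r_j)^n. These products form a
    geometric series of ratio 2^(a - n), less than 1 as a < n; its sum gives the constant. *)
Lemma near_integral_bound (R : realType) n (a : R) : 0 < a -> a < n%:R ->
  exists2 C : R, 0 < C & forall (x : 'rV[R]_n) (e : R), 0 < e ->
    (\int[lebesgue_rV n]_(y in cbox x e) (enorm (x - y) `^ (- a))%:E
     <= (C * e `^ (n%:R - a))%:E)%E.
Proof.
move=> a0 an.
pose p : R := 2 `^ (a - n%:R).
have p0 : 0 < p by exact: powR_gt0.
have p1 : p < 1.
  rewrite /p -opprB powRN invf_lt1 ?powR_gt0//.
  have na0 : 0 < n%:R - a by rewrite subr_gt0.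
  by have := gt0_ltr_powR na0 (x := 1) (y := 2); rewrite powR1; apply; rewrite ?nnegrE ?ltr1n.
exists (2 `^ a * 2 ^+ n / (1 - p)).
  by rewrite divr_gt0 ?subr_gt0// mulr_gt0 ?exprn_gt0// powR_gt0.
move=> x e e0; pose r j : R := e / 2 ^+ j.
have r0 j : 0 < r j by rewrite divr_gt0// exprn_gt0.
pose f j (y : 'rV[R]_n) := ((r j.+1 `^ (- a)) * \1_(cbox x (r j)) y)%:E.
have f0 j y : (0 <= f j y)%E by rewrite lee_fin mulr_ge0// powR_ge0.
have mf j : measurable_fun (cbox x e) (f j).
  apply/measurable_EFinP; apply: measurable_funM => //.
  by apply: measurable_indic; exact: measurable_cbox.
have mcb := measurable_cbox x e.
apply: (@le_trans _ _ (\int[lebesgue_rV n]_(y in cbox x e) \sum_(0 <= j <oo) f j y)%E).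
  apply: ge0_le_integral => //.
  - by move=> y _; rewrite lee_fin powR_ge0.
  - by apply/measurable_EFinP; exact: measurable_enormB_powR.
  - by apply: ge0_emeasurable_sum.
  move=> y xy.
  have [->|yx] := eqVneq y x.
    (* At y = x the integrand is 0, by the convention that 0 to any nonzero power is 0, negative
       exponents included. *)
    rewrite subrr enorm0 powR0 ?oppr_eq0 ?gt_eqF//.
    by apply: nneseries_ge0.
  have t0 : 0 < `|y - x| by rewrite normr_gt0 subr_eq0.
  have te : `|y - x| <= e by apply/cboxP => //; exact: ltW.
  have ex : exists j, r j.+1 < `|y - x|.
    exists (Num.bound (e / `|y - x|)); rewrite /r ltr_pdivrMr ?exprn_gt0//.
    rewrite mulrC -ltr_pdivrMr//.
    apply: (lt_le_trans (archi_boundP _)); first by rewrite divr_ge0 ?ltW.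
    by rewrite -natrX ler_nat ltnW// ltnW// (leq_trans (ltn_expl _ (ltnSn 1)))// leq_exp2l.
  (* The least j with r_(j+1) < |y - x| also has |y - x| <= r_j: it is the shell of y. For j = 0 the
     upper bound comes from the box itself. *)
  case: (ex_minnP ex) => j rj jmin.
  have yj : `|y - x| <= r j.
    case: j jmin {rj} => [_|j jmin]; first by rewrite /r expr0 divr1.
    by rewrite leNgt; apply/negP => /jmin; rewrite ltnn.
  rewrite (@nneseriesD1 _ _ j)//; apply: (@le_trans _ _ (f j y)); last first.
    by rewrite leeDl// nneseries_ge0.
  rewrite lee_fin indicE mem_set/=; last by apply/cboxP => //; exact: ltW.
  rewrite mulr1 !powRN lef_pV2 ?posrE ?powR_gt0//; last first.
    by rewrite (lt_le_trans _ (norm_le_enorm _))// distrC.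
  apply: ge0_ler_powR; rewrite ?nnegrE ?enorm_ge0 ?(ltW (r0 _)) ?(ltW a0)//.
  by rewrite (le_trans (ltW rj))// distrC norm_le_enorm.
rewrite integral_nneseries//.
apply: (@le_trans _ _ (\sum_(0 <= j <oo) (e `^ (n%:R - a) * (2 `^ a * 2 ^+ n) * p ^+ j)%:E)%E).
  apply: lee_nneseries => j _.
    by move=> _; apply: integral_ge0.
  rewrite /f; under eq_integral do rewrite EFinM.
  rewrite ge0_integralZl//; last 2 first.
    by apply/measurable_EFinP/measurable_indic; exact: measurable_cbox.
    by rewrite lee_fin powR_ge0.
  rewrite integral_indic//; last exact: measurable_cbox.
  apply: (@le_trans _ _ ((r j.+1 `^ (- a))%:E * lebesgue_rV n (cbox x (r j)))%E).
    rewrite lee_wpmul2l ?lee_fin ?powR_ge0//.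
    by apply: le_measure; rewrite ?inE//; [apply: measurableI => //; exact: measurable_cbox|exact: measurable_cbox].
  rewrite lebesgue_cbox// -EFinM lee_fin le_eqVlt; apply/orP; left; apply/eqP.
  have two0 : (2 : R) != 0 by [].
  have rE k : r k = e * 2 `^ (- k%:R) by rewrite /r powR_invn.
  rewrite !rE !powRM ?powR_ge0 ?(ltW e0)// -powRrM !exprMn -!powR_mulrn ?powR_ge0 ?(ltW e0)//.
  rewrite /p -!powRrM [in RHS](addrC n%:R) powRD ?(gt_eqF e0) ?implybT//.
  suff -> : 2 `^ (- j.+1%:R * - a) = 2 `^ a * 2 `^ ((a - n%:R) * j%:R) / 2 `^ (- j%:R * n%:R).
    by field; rewrite gt_eqF// powR_gt0.
  by rewrite -powRN -!powRD ?two0 ?implybT//; congr (_ `^ _); rewrite -natr1; ring.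
have c0 : 0 <= e `^ (n%:R - a) * (2 `^ a * 2 ^+ n).
  by rewrite mulr_ge0 ?powR_ge0// mulr_ge0 ?powR_ge0.
apply: lime_le.
  by apply: is_cvg_nneseries => j _ _; rewrite lee_fin mulr_ge0// exprn_ge0// ltW.
apply: nearW => N; rewrite sumEFin lee_fin.
have := geometric_le_lim N c0 p0; rewrite ger0_norm ?(ltW p0)// => /(_ p1).
rewrite /series/= => /le_trans; apply.
by rewrite le_eqVlt; apply/orP; left; apply/eqP; field; rewrite subr_eq0 gt_eqF.
Qed.

(** * Distance to the complement and the weight w *)

Section delta_facts.
Context {R : realType} {n : nat}.
Variable Omega : set 'rV[R]_n.
Hypotheses (n_gt0 : (0 < n)%N) (bO : bounded_domain Omega).
Implicit Types x y : 'rV[R]_n.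

Let oO : open Omega. Proof. by case: bO. Qed.

Lemma domain_measurable : measurable Omega.
Proof. exact: open_measurable_rV. Qed.

Lemma domain_lebesgue_lty : (lebesgue_rV n Omega < +oo)%E.
Proof. by apply: lebesgue_bounded_lty; [exact: domain_measurable|case: bO]. Qed.

(** Without a point outside Omega the infimum defining [delta] would be taken over the empty set.
    Boundedness provides one as soon as there is a coordinate to move along. *)
Lemma domain_compl_neq0 : exists y, (~` Omega) y.
Proof.
have [r r0 Or] : exists2 r : R, 0 < r & Omega `<=` cbox 0 r.
  by apply: bounded_rV_cbox; case: bO.
exists (const_mx (r + 1)) => /Or /(_ (Ordinal n_gt0)).
by rewrite !mxE !add0r => /andP[_]; rewrite gerDl ler10.
Qed.

Let delta_lbound x : has_lbound [set enorm (x - y) | y in ~` Omega].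
Proof. by exists 0 => _ [y _ <-]; exact: enorm_ge0. Qed.

Let delta_neq0 x : [set enorm (x - y) | y in ~` Omega] !=set0.
Proof. by have [y Oy] := domain_compl_neq0; exists (enorm (x - y)), y. Qed.

Lemma delta_ge0 x : 0 <= delta Omega x.
Proof. by apply: lb_le_inf => // _ [y _ <-]; exact: enorm_ge0. Qed.

Lemma delta_le x y : (~` Omega) y -> delta Omega x <= enorm (x - y).
Proof. by move=> Oy; apply: ge_inf => //; exists y. Qed.

Lemma delta_triangle x y : delta Omega x <= delta Omega y + enorm (x - y).
Proof.
rewrite -lerBlDr; apply: lb_le_inf => // _ [z Oz <-].
by rewrite lerBlDl (le_trans (delta_le _ Oz))// le_enorm_dist.
Qed.

Lemma delta_gt0 x : Omega x -> 0 < delta Omega x.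
Proof.
move=> Ox; have /nbhs_ballP[e /= e0 eO] := oO Ox.
apply: (lt_le_trans e0); apply: lb_le_inf => // _ [y Oy <-].
rewrite leNgt; apply/negP => xy; apply: Oy; apply: eO.
by rewrite mx_norm_ball/= /ball_/= (le_lt_trans (norm_le_enorm _)).
Qed.

Lemma continuous_delta : continuous (delta Omega).
Proof.
apply: (@lipschitz_rV_continuous _ _ _ n%:R) => x y.
rewrite (le_trans _ (enorm_le_norm _))// ler_norml lerBlDl delta_triangle andbT.
by rewrite lerNl opprB lerBlDl enormB delta_triangle.
Qed.

Lemma domain_diam : exists2 D : R, 0 < D & forall x y, Omega x -> Omega y ->
  enorm (x - y) <= D /\ delta Omega x <= D.
Proof.
have [r r0 Or] : exists2 r : R, 0 < r & Omega `<=` cbox 0 r.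
  by apply: bounded_rV_cbox; case: bO.
have [z Oz] := domain_compl_neq0.
exists (n%:R * (r + r) + n%:R * (r + `|z|)).
  have n0 : 0 < (n%:R : R) by rewrite ltr0n.
  by rewrite addr_gt0// mulr_gt0// ltr_wpDr// ltW.
move=> x y /Or/cboxP => /(_ (ltW r0)); rewrite subr0 => xr.
move=> /Or/cboxP => /(_ (ltW r0)); rewrite subr0 => yr.
split.
  apply: (le_trans (enorm_le_norm _)); apply: ler_wpDr.
    by rewrite mulr_ge0// addr_ge0// ltW.
  by rewrite ler_wpM2l// (le_trans (ler_normB _ _))// lerD.
apply: (le_trans (delta_le x Oz)); apply: (le_trans (enorm_le_norm _)).
apply: ler_wpDl; first by rewrite mulr_ge0// addr_ge0// ltW.
by rewrite ler_wpM2l// (le_trans (ler_normB _ _))// lerD.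
Qed.

End delta_facts.

Section weight_facts.
Context {R : realType} {n : nat}.
Variables (Omega : set 'rV[R]_n) (gamma : R).
Hypotheses (n_gt0 : (0 < n)%N) (bO : bounded_domain Omega) (gamma_gt0 : 0 < gamma).
Local Notation w x := (delta Omega x `^ gamma).

Lemma weight_gt0 x : Omega x -> 0 < w x.
Proof. by move=> Ox; apply: powR_gt0; exact: delta_gt0. Qed.

Lemma continuous_weight x : Omega x -> {for x, continuous (fun y => w y)}.
Proof.
move=> Ox; apply: (@continuous_comp _ _ _ (delta Omega) (fun a => a `^ gamma)).
  exact: continuous_delta.
apply: differentiable_continuous; apply/derivable1_diffP.
by apply: derivable_powR; rewrite in_itv/= andbT delta_gt0.
Qed.

Lemma measurable_weight D : measurable D -> measurable_fun D (fun x => w x).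
Proof.
move=> mD; apply: (measurableT_comp (measurable_powR gamma)).
by apply: continuous_measurable_rV => //; exact: continuous_delta.
Qed.

Lemma weight_bounded : exists2 M : R, 0 < M & forall x, Omega x -> w x <= M.
Proof.
have [D D0 OD] := domain_diam n_gt0 bO.
exists (D `^ gamma) => [|x Ox]; first exact: powR_gt0.
have [_ xD] := OD _ _ Ox Ox.
by apply: ge0_ler_powR; rewrite ?nnegrE ?delta_ge0 ?(ltW D0) ?(ltW gamma_gt0).
Qed.

(* The key inequality: min(d(x)d(y)/r^2, 1) d(y) is at most 4 d(x) when
   d(y) <= d(x) + r, since either r <= d(x) and d(y) <= 2 d(x), or d(y) <= 2 r. *)
Lemma min_delta_bound (dx dy r : R) : 0 < dx -> 0 < dy -> 0 < r -> dy <= dx + r ->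
  Num.min (dx * dy / r ^+ 2) 1 * dy <= 4 * dx.
Proof.
move=> dx0 dy0 r0 dyr; have [rdx|dxr] := leP r dx.
  apply: (@le_trans _ _ (1 * dy)); last by rewrite mul1r; lra.
  by rewrite ler_wpM2r ?(ltW dy0)// ge_min lexx orbT.
apply: (@le_trans _ _ (dx * dy / r ^+ 2 * dy)).
  by rewrite ler_wpM2r ?(ltW dy0)// ge_min lexx.
rewrite (_ : _ * dy = dx * (dy / r) ^+ 2); last by field; rewrite gt_eqF.
rewrite mulrC ler_wpM2r ?(ltW dx0)//.
rewrite (_ : 4 = 2 ^+ 2)//; last by rewrite -natrX.
rewrite ler_pXn2r ?nnegrE ?divr_ge0 ?(ltW dy0) ?(ltW r0)//.
by rewrite ler_pdivrMr//; lra.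
Qed.

End weight_facts.

(** * Upper and lower bounds on the profile of the Green kernel *)

Section profile.
Context {R : realType}.
Variables gamma a dx dy r : R.
Hypotheses (gamma_gt0 : 0 < gamma) (a_gt0 : 0 < a) (dx0 : 0 < dx) (dy0 : 0 < dy).

Let profile := r `^ (- a) * Num.min (dx * dy / r ^+ 2) 1 `^ gamma.

Let dd : 0 <= dx * dy. Proof. by rewrite mulr_ge0 ?ltW. Qed.

Let m0 : 0 < r -> 0 <= Num.min (dx * dy / r ^+ 2) 1.
Proof. by move=> r0; rewrite le_min ler01 andbT divr_ge0 ?exprn_ge0 ?(ltW r0). Qed.

(** The inequality of [min_delta_bound] raised to the power gamma: multiplying the profile by the
    weight at y turns it, up to 4^gamma, into the weight at x times the bare singularity r^(-a). *)
Lemma profile_weight_le : 0 < r -> dy <= dx + r ->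
  profile * dy `^ gamma <= 4 `^ gamma * r `^ (- a) * dx `^ gamma.
Proof.
move=> r0 dyr; have u0 : 0 <= r `^ (- a) by exact: powR_ge0.
rewrite /profile -mulrA.
rewrite (_ : _ * dx `^ gamma = r `^ (- a) * (4 `^ gamma * dx `^ gamma)); last first.
  by rewrite mulrCA mulrA.
apply: (ler_wpM2l u0).
rewrite -!powRM ?(ltW dx0) ?(ltW dy0) ?m0//.
apply: (ge0_ler_powR (ltW gamma_gt0)).
- by rewrite nnegrE mulr_ge0 ?(ltW dy0) ?m0.
- by rewrite nnegrE mulr_ge0 ?(ltW dx0).
exact: min_delta_bound.
Qed.

Lemma profile_far_le e : 0 < e -> e <= r ->
  profile <= e `^ (- (a + 2 * gamma)) * dx `^ gamma * dy `^ gamma.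
Proof.
move=> e0 er; have r0 := lt_le_trans e0 er; rewrite /profile.
rewrite (_ : _ * dy `^ gamma = e `^ (- a) * (dx * dy / e ^+ 2) `^ gamma).
  apply: ler_pM; rewrite ?powR_ge0//.
    rewrite !powRN lef_pV2 ?posrE ?powR_gt0//.
    by apply: (ge0_ler_powR (ltW a_gt0)); rewrite ?nnegrE ?(ltW e0) ?(ltW r0).
  apply: (ge0_ler_powR (ltW gamma_gt0)); rewrite ?nnegrE ?m0//.
  - by rewrite divr_ge0 ?exprn_ge0 ?(ltW e0).
  rewrite ge_min; apply/orP; left; rewrite ler_wpM2l//.
  by rewrite lef_pV2 ?posrE ?exprn_gt0// ler_pXn2r ?nnegrE ?(ltW e0) ?(ltW r0).
rewrite powRM ?invr_ge0 ?exprn_ge0 ?(ltW e0)// powRM ?(ltW dx0) ?(ltW dy0)//.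
rewrite opprD powRD ?(gt_eqF e0) ?implybT//.
rewrite -powR_invn ?(ltW e0)// -powRrM mulNr.
by rewrite -!mulrA; congr (_ * _); rewrite mulrC -!mulrA.
Qed.

(** Both arguments of the minimum are at least dx dy / D^2, the constant 1 because dx and dy are at
    most D. *)
Lemma profile_ge D : 0 < r -> r <= D -> dx <= D -> dy <= D ->
  D `^ (- a) * (D ^+ 2)^-1 `^ gamma * (dx `^ gamma * dy `^ gamma) <= profile.
Proof.
move=> r0 rD dxD dyD; have D0 := lt_le_trans r0 rD.
have D2 : 0 <= (D ^+ 2)^-1 by rewrite invr_ge0 exprn_ge0// ltW.
rewrite /profile -mulrA -!powRM ?(ltW dx0) ?(ltW dy0)//.
apply: ler_pM; rewrite ?powR_ge0//.
  rewrite !powRN lef_pV2 ?posrE ?powR_gt0//.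
  by apply: (ge0_ler_powR (ltW a_gt0)); rewrite ?nnegrE ?(ltW D0) ?(ltW r0).
apply: (ge0_ler_powR (ltW gamma_gt0)); rewrite ?nnegrE ?m0//.
- by rewrite mulr_ge0.
rewrite mulrC le_min; apply/andP; split.
  rewrite ler_wpM2l// lef_pV2 ?posrE ?exprn_gt0//.
  by rewrite ler_pXn2r ?nnegrE ?(ltW D0) ?(ltW r0).
rewrite ler_pdivrMr ?exprn_gt0// mul1r expr2.
by apply: ler_pM; rewrite ?(ltW dx0) ?(ltW dy0).
Qed.

End profile.

Lemma measurable_set1_rV (R : realType) n (x : 'rV[R]_n) : measurable [set x].
Proof.
by apply: closed_measurable_rV; apply: accessible_closed_set1; exact: hausdorff_accessible.
Qed.

Lemma ae_neq_rV (R : realType) n (x : 'rV[R]_n) : (0 < n)%N ->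
  {ae lebesgue_rV n, forall y, y != x}.
Proof.
move=> n0; exists [set x]; split.
- exact: measurable_set1_rV.
- exact: lebesgue_rV_set1.
- by move=> y /= /negP; rewrite negbK => /eqP.
Qed.

(* Otherwise unification unfolds infima of reals and powers and diverges. *)
#[local] Opaque delta enorm kernel_profile powR.

(** * Near and far parts of the Green operator *)

Section green_estimates.
Context {R : realType} {n : nat}.
Variables (Omega : set 'rV[R]_n) (s gamma : R) (G : 'rV[R]_n -> 'rV[R]_n -> \bar R).
Hypotheses (s_gt0 : 0 < s) (gamma_gt0 : 0 < gamma) (sn : 2 * s < n%:R).
Hypotheses (bO : bounded_domain Omega) (G0 : nonneg_kernel Omega G).
Hypothesis GE : kernel_estimate Omega gamma G s.
Local Notation leb := (lebesgue_rV n).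
Local Notation w x := (delta Omega x `^ gamma).
Local Notation a := (n%:R - 2 * s).
Local Notation q := (a + 2 * gamma).

Lemma dimension_gt0 : (0 < n)%N.
Proof. by rewrite -(ltr_nat R) (lt_trans _ sn)// mulr_gt0. Qed.
Let n_gt0 := dimension_gt0.

Let a_gt0 : 0 < a. Proof. by rewrite subr_gt0. Qed.
Let mO : measurable Omega. Proof. exact: domain_measurable. Qed.

#[local] Transparent kernel_profile.
Lemma kernel_profile_weight_le x y : Omega x -> Omega y -> x != y ->
  kernel_profile Omega gamma s x y * w y
  <= 4 `^ gamma * enorm (x - y) `^ (- a) * w x.
Proof.
move=> Ox Oy xy; apply: profile_weight_le => //.
- exact: delta_gt0.
- exact: delta_gt0.
- by rewrite (lt_le_trans _ (norm_le_enorm _))// normr_gt0 subr_eq0.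
- by rewrite enormB; exact: delta_triangle.
Qed.

Lemma kernel_profile_far_le e x y : 0 < e -> Omega x -> Omega y -> e < `|x - y| ->
  kernel_profile Omega gamma s x y <= e `^ (- q) * w x * w y.
Proof.
move=> e0 Ox Oy exy; apply: profile_far_le => //.
- exact: delta_gt0.
- exact: delta_gt0.
- by rewrite (le_trans (ltW exy))// norm_le_enorm.
Qed.

Lemma kernel_profile_ge : exists2 c : R, 0 < c & forall x y, Omega x -> Omega y ->
  x != y -> c * (w x * w y) <= kernel_profile Omega gamma s x y.
Proof.
have [D D0 OD] := domain_diam n_gt0 bO.
exists (D `^ (- a) * (D ^+ 2)^-1 `^ gamma).
  by rewrite mulr_gt0// powR_gt0// invr_gt0 exprn_gt0.
move=> x y Ox Oy xy.
have [rD dxD] := OD _ _ Ox Oy; have [_ dyD] := OD _ _ Oy Ox.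
apply: profile_ge => //.
- exact: delta_gt0.
- exact: delta_gt0.
- by rewrite (lt_le_trans _ (norm_le_enorm _))// normr_gt0 subr_eq0.
Qed.

#[local] Opaque kernel_profile.
Lemma green_lower : exists2 c : R, 0 < c & forall x y, Omega x -> Omega y ->
  x != y -> ((c * (w x * w y))%:E <= G x y)%E.
Proof.
have [c0 [C0 [c00 C00 H]]] := GE; have [c cp Hc] := kernel_profile_ge.
exists (c0 * c); first by rewrite mulr_gt0.
move=> x y Ox Oy xy; have [_ /(le_trans _) h _] := H _ _ Ox Oy xy; apply: h.
by rewrite lee_fin -mulrA ler_wpM2l ?(ltW c00)//; exact: Hc.
Qed.

Lemma green_sym x y : Omega x -> Omega y -> x != y -> G x y = G y x.
Proof. by move=> Ox Oy xy; have [c [C [_ _ /(_ x y Ox Oy xy)[]]]] := GE. Qed.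

Lemma measurable_green_l x : Omega x -> measurable_fun Omega (G x).
Proof.
move=> Ox; apply: (@measurable_comp _ _ _ _ _ _ (Omega `*` Omega) (uncurry G) Omega (pair x)) => //.
- exact: measurableX.
- by move=> _ [y Oy <-].
- by case: G0.
- exact/measurable_funTS/pair1_measurable.
Qed.

(** The mass of G(x, .) w close to x, relative to w(x). The power e^(2s) is what the singularity of
    order n - 2s leaves after integration; since it tends to 0 with e, the near part can be
    absorbed. *)
Definition near_bound C := forall x e, Omega x -> 0 < e ->
  (\int[leb]_(y in Omega `&` cbox x e) (G x y * (w y)%:E)
   <= (C * e `^ (2 * s) * w x)%:E)%E.

Definition far_bound C := forall e x y, 0 < e -> Omega x -> Omega y ->
  e < `|x - y| -> (G x y <= (C * e `^ (- q) * w x * w y)%:E)%E.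

Lemma green_near_far : exists C, [/\ 0 < C, near_bound C & far_bound C].
Proof.
have [c0 [C0 [c00 C00 H]]] := GE.
have an : a < n%:R by rewrite gtrDl oppr_lt0 mulr_gt0.
have [C1 C10 H1] := near_integral_bound a_gt0 an.
pose K := C0 * 4 `^ gamma.
have K0 : 0 < K by rewrite mulr_gt0// powR_gt0.
(* The near bound needs K C1 and the far bound needs C0; the sum serves for both. *)
exists (K * C1 + C0); split; first by rewrite addr_gt0// mulr_gt0.
- move=> x e Ox e0.
  have mD : measurable (Omega `&` cbox x e).
    by apply: measurableI => //; exact: measurable_cbox.
  have wx : 0 < w x by exact: weight_gt0.
  apply: (@le_trans _ _ (\int[leb]_(y in Omega `&` cbox x e)
      ((K * w x)%:E * (enorm (x - y) `^ (- a))%:E))%E).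
    apply: ae_ge0_le_integral => //.
    - by move=> y [Oy _]; rewrite mule_ge0 ?lee_fin ?powR_ge0//; apply G0.1.
    - apply: emeasurable_funM; last by apply/measurable_EFinP; exact: measurable_weight.
      by apply: (measurable_funS mO) => //; exact: measurable_green_l.
    - by move=> y _; rewrite -EFinM lee_fin mulr_ge0 ?powR_ge0// mulr_ge0 ?(ltW K0) ?(ltW wx).
    - apply: emeasurable_funM => //; apply/measurable_EFinP.
      exact: measurable_enormB_powR.
    (* The kernel estimate says nothing on the diagonal, where G may be infinite; a single point is
       a null set. *)
    have := @ae_neq_rV R n x n_gt0; apply: filterS => y yx [Oy _].
    have xy : x != y by rewrite eq_sym.
    have [_ _ h] := H _ _ Ox Oy xy.
    have hw := kernel_profile_weight_le Ox Oy xy.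
    have wy : 0 <= w y by exact: powR_ge0.
    move: (kernel_profile _ _ _ _ _) (enorm _ `^ _) (w y) (w x) h hw wy => k u wy wx' h hw wy0.
    apply: (@le_trans _ _ ((C0 * k)%:E * wy%:E)%E); first by apply: lee_wpmul2r.
    rewrite -!EFinM lee_fin -mulrA /K -!mulrA ler_wpM2l ?(ltW C00)//.
    by rewrite (mulrC wx') mulrA.
  have Kw0 : 0 <= K * w x by apply: mulr_ge0; apply: ltW.
  rewrite ge0_integralZl//; last 2 first.
  - by apply/measurable_EFinP; exact: measurable_enormB_powR.
  - by move=> y _; rewrite lee_fin powR_ge0.
  apply: (@le_trans _ _ ((K * w x)%:E * (C1 * e `^ (2 * s))%:E)%E).
    apply: lee_wpmul2l; first by rewrite lee_fin.
    have := H1 x e e0; rewrite (_ : n%:R - a = 2 * s); last by rewrite opprB addrC subrK.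
    apply: le_trans; apply: ge0_subset_integral => //.
    - exact: measurable_cbox.
    - by apply/measurable_EFinP; apply: measurable_enormB_powR; exact: measurable_cbox.
    - by move=> y _; rewrite lee_fin powR_ge0.
  have := powR_ge0 e (2 * s); move: (e `^ _) => E E0.
  rewrite -EFinM lee_fin -subr_ge0.
  rewrite (_ : _ - _ = C0 * E * w x); last by ring.
  by apply: mulr_ge0; [apply: mulr_ge0 => //|]; exact: ltW.
- move=> e x y e0 Ox Oy exy.
  have xy : x != y by apply/eqP => xy; move: exy; rewrite xy subrr normr0 ltNge (ltW e0).
  have [_ _ /le_trans] := H _ _ Ox Oy xy; apply.
  rewrite lee_fin -!mulrA; apply: ler_pM; first exact: ltW.
  - by rewrite mulr_ge0 ?powR_ge0.
  - by rewrite lerDr; apply: ltW; rewrite !mulr_gt0// powR_gt0.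
  - by rewrite mulrA; exact: kernel_profile_far_le.
Qed.

Section with_near_far.
Variable C : R.
Hypotheses (C_gt0 : 0 < C) (nearC : near_bound C) (farC : far_bound C).

Lemma green_ge0 x y : Omega x -> Omega y -> (0 <= G x y)%E.
Proof. exact: G0.1. Qed.

Lemma green_split_le (f : 'rV[R]_n -> R) e x : measurable_fun Omega f ->
  0 < e -> Omega x ->
  (\int[leb]_(y in Omega) (G x y * `|f y|%:E) <=
   \int[leb]_(y in Omega `&` cbox x e) (G x y * `|f y|%:E) +
   (C * e `^ (- q) * w x)%:E * \int[leb]_(y in Omega) (`|f y| * w y)%:E)%E.
Proof.
move=> mf e0 Ox.
have mc := measurable_cbox x e.
have mG : measurable_fun Omega (fun y => (G x y * `|f y|%:E)%E).
  apply: emeasurable_funM; first exact: measurable_green_l.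
  by apply/measurable_EFinP; exact: measurableT_comp.
have G0' y : Omega y -> (0 <= G x y * `|f y|%:E)%E.
  by move=> Oy; rewrite mule_ge0 ?lee_fin//; exact: green_ge0.
rewrite -{1}(setUIDK Omega (cbox x e)) ge0_integral_setU//; last 5 first.
- exact: measurableI.
- exact: measurableD.
- by rewrite setUIDK.
- by rewrite setUIDK.
- by apply/disj_setPS => y [[_ ?] [_]].
rewrite leeD2l//.
set c := C * e `^ (- q) * w x.
have ce0 : 0 <= c.
  by apply: mulr_ge0; [apply: mulr_ge0; [exact: ltW|]|]; exact: powR_ge0.
have farc y : Omega y -> e < `|x - y| -> (G x y <= (c * w y)%:E)%E.
  by move=> Oy exy; exact: farC.
clearbody c.
have mfw : measurable_fun Omega (fun y => (`|f y| * w y)%:E).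
  apply/measurable_EFinP; apply: measurable_funM; first exact: measurableT_comp.
  exact: measurable_weight.
have fw0 y : Omega y -> (0 <= (`|f y| * w y)%:E)%E.
  by move=> _; rewrite lee_fin mulr_ge0// powR_ge0.
have DO : Omega `\` cbox x e `<=` Omega by move=> y [].
have mD : measurable (Omega `\` cbox x e) by exact: measurableD.
have mfw' := measurable_funS mO DO mfw.
apply: (@le_trans _ _ (\int[leb]_(y in Omega `\` cbox x e)
   (c%:E * (`|f y| * w y)%:E))%E).
  apply: ge0_le_integral => //.
  - by move=> y [Oy _]; exact: G0'.
  - exact: (measurable_funS mO DO mG).
  - by apply: emeasurable_funM; [exact: measurable_cst|exact: mfw'].
  move=> y [Oy xy].
  have exy : e < `|x - y|.
    by rewrite ltNge distrC; apply/negP => yx; apply: xy; apply/cboxP => //; exact: ltW.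
  apply: (@le_trans _ _ ((c * w y)%:E * `|f y|%:E)%E).
    by apply: lee_wpmul2r; [rewrite lee_fin|exact: farc].
  by rewrite -!EFinM lee_fin -mulrA (mulrC (w y)).
rewrite ge0_integralZl//; last by move=> y /DO/fw0.
by apply: lee_wpmul2l; [rewrite lee_fin|exact: ge0_subset_integral].
Qed.

(** For f already bounded by M w, the near part costs only M times a factor that is small with e,
    and the far part sees only the norm of f in L^1(w). *)
Lemma green_abs_le (f : 'rV[R]_n -> R) M e x : measurable_fun Omega f ->
  0 <= M -> (forall y, Omega y -> `|f y| <= M * w y) -> 0 < e -> Omega x ->
  (\int[leb]_(y in Omega) (G x y * `|f y|%:E) <=
   (M * C * e `^ (2 * s) * w x)%:E +
   (C * e `^ (- q) * w x)%:E * \int[leb]_(y in Omega) (`|f y| * w y)%:E)%E.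
Proof.
move=> mf M0 fM e0 Ox; apply: (le_trans (green_split_le mf e0 Ox)).
rewrite leeD2r//.
have mD : measurable (Omega `&` cbox x e).
  by apply: measurableI => //; exact: measurable_cbox.
have mG : measurable_fun (Omega `&` cbox x e) (G x).
  by apply: (measurable_funS mO) => //; exact: measurable_green_l.
have mw : measurable_fun (Omega `&` cbox x e) (fun y => (w y)%:E).
  by apply/measurable_EFinP; exact: measurable_weight.
apply: (@le_trans _ _ (\int[leb]_(y in Omega `&` cbox x e)
   (M%:E * (G x y * (w y)%:E)))%E).
  apply: ge0_le_integral => //.
  - by move=> y [Oy _]; rewrite mule_ge0 ?lee_fin//; exact: green_ge0.
  - apply: emeasurable_funM => //; apply/measurable_EFinP.
    by apply: measurableT_comp => //; apply: (measurable_funS mO).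
  - by apply: emeasurable_funM => //; exact: emeasurable_funM.
  move=> y [Oy _]; rewrite muleCA -EFinM; apply: lee_wpmul2l; first exact: green_ge0.
  by rewrite lee_fin; exact: fM.
rewrite ge0_integralZl//; last 2 first.
- exact: emeasurable_funM.
- by move=> y [Oy _]; rewrite mule_ge0 ?lee_fin ?powR_ge0//; exact: green_ge0.
rewrite (_ : M * C * _ * _ = M * (C * e `^ (2 * s) * w x)); last by rewrite !mulrA.
by rewrite EFinM; apply: lee_wpmul2l; [rewrite lee_fin|exact: nearC].
Qed.

End with_near_far.

End green_estimates.

(** * A priori bound for subsolutions of the eigenvalue equation *)

Section absorption.
Context {R : realType} {n : nat}.
Variables (Omega : set 'rV[R]_n) (s gamma : R) (G : 'rV[R]_n -> 'rV[R]_n -> \bar R).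
Hypotheses (s_gt0 : 0 < s) (gamma_gt0 : 0 < gamma) (sn : 2 * s < n%:R).
Hypotheses (bO : bounded_domain Omega) (G0 : nonneg_kernel Omega G).
Hypothesis GE : kernel_estimate Omega gamma G s.
Variable C : R.
Hypotheses (C_gt0 : 0 < C) (nearC : near_bound Omega s gamma G C)
  (farC : far_bound Omega s gamma G C).
Local Notation leb := (lebesgue_rV n).
Local Notation w x := (delta Omega x `^ gamma).
Local Notation q := (n%:R - 2 * s + 2 * gamma).

Let n_gt0 : (0 < n)%N := dimension_gt0 s_gt0 sn.
Let mO : measurable Omega. Proof. exact: domain_measurable. Qed.

Let mw D : measurable D -> measurable_fun D (fun y => (w y)%:E).
Proof. by move=> mD; apply/measurable_EFinP; exact: measurable_weight. Qed.

Let G_ge0 x y : Omega x -> Omega y -> (0 <= G x y)%E.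
Proof. exact: G0.1. Qed.

Let wE0 x : (0 <= (w x)%:E)%E. Proof. by rewrite lee_fin powR_ge0. Qed.

Lemma cbox_sym (x y : 'rV[R]_n) e : cbox x e y <-> cbox y e x.
Proof.
split=> H i; have /andP[h1 h2] := H i.
  by rewrite lerBlDr h2 -lerBlDr h1.
by rewrite lerBlDr h2 -lerBlDr h1.
Qed.

(** A box whose radius is at least the diameter contains Omega, so the near bound is already
    global. *)
Lemma green_weight_le : exists2 C1 : R, 0 < C1 & forall x, Omega x ->
  (\int[leb]_(y in Omega) (G x y * (w y)%:E) <= (C1 * w x)%:E)%E.
Proof.
have [D D0 OD] := domain_diam n_gt0 bO.
exists (C * D `^ (2 * s)); first by rewrite mulr_gt0// powR_gt0.
move=> x Ox; apply: le_trans (nearC Ox D0).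
rewrite (_ : Omega `&` cbox x D = Omega)//.
apply/seteqP; split=> [y []//|y Oy]; split=> //; apply/cboxP; first exact: ltW.
by rewrite (le_trans (norm_le_enorm _))//; have [] := OD _ _ Oy Ox.
Qed.

Lemma measurable_near (e : R) :
  measurable [set p : 'rV[R]_n * 'rV[R]_n | cbox p.1 e p.2].
Proof.
rewrite (_ : [set p | _] = \bigcap_(i in [set: 'I_n])
   ((fun p : 'rV[R]_n * 'rV[R]_n => p.2 ord0 i - p.1 ord0 i) @^-1` `[- e, e])); last first.
  have E (a b : R) : (- e <= b - a <= e) = (a - e <= b <= a + e).
    by rewrite -ler_norml ler_distl.
  apply/seteqP; split => p /= H i => [_|]; first by rewrite /= in_itv/= E; exact: H.
  by have := H i Logic.I; rewrite /= in_itv/= E.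
apply: fin_bigcap_measurable => // i _; rewrite -[X in measurable X]setTI.
apply: measurable_funB => //.
- exact: measurableT_comp (measurable_coord_rV i) measurable_snd.
- exact: measurableT_comp (measurable_coord_rV i) measurable_fst.
Qed.

(* Tonelli and the symmetry of G: integrating the near part of G psi against
   the weight w costs the same factor as the near bound. *)
Lemma near_double_integral_le (psi : 'rV[R]_n -> R) e : 0 < e ->
  measurable_fun Omega psi -> (forall x, 0 <= psi x) ->
  let near x := (\int[leb]_(y in Omega `&` cbox x e) (G x y * (psi y)%:E) * (w x)%:E)%E in
  measurable_fun Omega near /\
  (\int[leb]_(x in Omega) near x <=
   (C * e `^ (2 * s))%:E * \int[leb]_(y in Omega) (psi y * w y)%:E)%E.
Proof.
move=> e0 mpsi psi0.
pose A := (Omega `*` Omega) `&` [set p : 'rV[R]_n * 'rV[R]_n | cbox p.1 e p.2].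
pose h (p : 'rV[R]_n * 'rV[R]_n) := (G p.1 p.2 * (psi p.2)%:E * (w p.1)%:E)%E.
have mOO : measurable (Omega `*` Omega) by exact: measurableX.
have mA : measurable A by apply: measurableI => //; exact: measurable_near.
have AO : A `<=` Omega `*` Omega by move=> ? [].
have h0 p : A p -> (0 <= h p)%E.
  case=> -[ox1 ox2] _; rewrite mule_ge0// mule_ge0 ?lee_fin//.
  exact: G_ge0.
have mh : measurable_fun A h.
  apply: emeasurable_funM; last first.
    apply: measurableT_comp (mw measurableT) _; apply: measurable_funTS.
    exact: measurable_fst.
  apply: emeasurable_funM.
    apply: (measurable_funS mOO AO).
    have [_] := G0; rewrite (_ : uncurry G = fun p => G p.1 p.2)//.
    by apply/funext => -[].
  apply/measurable_EFinP; apply: (measurable_funS mOO AO).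
  apply: (@measurable_comp _ _ _ _ _ _ Omega psi _ snd) => //.
  - by move=> _ [p [_ ? ] <-].
  - exact: measurable_funTS measurable_snd.
pose H := h \_ A.
have mH : measurable_fun setT H by apply/(measurable_restrictT _ mA).
have H0 p : (0 <= H p)%E.
  by rewrite /H /patch; case: ifPn => // /set_mem /h0.
have mc x := measurable_cbox x e.
have mOc x : measurable (Omega `&` cbox x e) by exact: measurableI.
have HE x y : Omega x -> Omega y -> cbox x e y -> H (x, y) = h (x, y).
  by move=> Ox Oy xy; rewrite /H patchE ifT// inE; split.
have Hout x y : ~ A (x, y) -> H (x, y) = 0%E.
  by move=> nA; rewrite /H patchE ifF//; apply/negbTE/negP => /set_mem.
have mG x := measurable_funS mO (@subIsetl _ Omega (cbox x e)) _.
move=> near.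
have nearE : near \_ Omega = fun x => (\int[leb]_y H (x, y))%E.
  apply/funext => x; rewrite patchE.
  case: ifPn => [/set_mem Ox|/negP nOx]; last first.
    rewrite integral0_eq// => y _; apply: Hout => -[[] /= Ox].
    by exfalso; apply: nOx; rewrite inE.
  rewrite /near -ge0_integralZr//; last 2 first.
  - apply: emeasurable_funM; first by apply: mG; exact: measurable_green_l.
    by apply: mG; exact/measurable_EFinP.
  - by move=> y [Oy _]; rewrite mule_ge0 ?lee_fin//; exact: G_ge0.
  rewrite integral_mkcond; apply: eq_integral => y _; rewrite patchE.
  case: ifPn => [/set_mem[Oy xy]|/negP nxy]; first by rewrite HE.
  rewrite Hout// => -[[_ Oy] xy]; apply: nxy; rewrite inE.
  by split.
split.
  by apply/(measurable_restrictT _ mO); rewrite nearE; exact: (measurable_fun_fubini_tonelli_F H).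
rewrite integral_mkcond nearE (fubini_tonelli H)//.
have psiw0 y : (0 <= (psi y * w y)%:E)%E by rewrite lee_fin mulr_ge0 ?powR_ge0.
have mpsiw : measurable_fun Omega (fun y => (psi y * w y)%:E).
  apply/measurable_EFinP; apply: measurable_funM => //.
  exact: measurable_weight.
have c0 : (0 <= (C * e `^ (2 * s))%:E)%E.
  by rewrite lee_fin mulr_ge0 ?powR_ge0// ltW.
rewrite -ge0_integralZl// [leRHS]integral_mkcond.
apply: ge0_le_integral => //.
- by move=> y _; exact: integral_ge0.
- exact: (measurable_fun_fubini_tonelli_G H).
- apply/(measurable_restrictT _ mO); apply: emeasurable_funM => //.
move=> y _; rewrite patchE; case: ifPn => [/set_mem Oy|/negP nOy]; last first.
  rewrite integral0_eq// => x _; apply: Hout => -[[_ /= Oy]].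
  by exfalso; apply: nOy; rewrite inE.
apply: (@le_trans _ _ (\int[leb]_(x in Omega `&` cbox y e) ((psi y)%:E * (G y x * (w x)%:E)))%E).
  rewrite [leRHS]integral_mkcond.
  apply: (ae_ge0_le_integral measurableT).
  - by move=> x _; exact: H0.
  - exact: measurableT_comp mH (measurable_pair2 _).
  - move=> x _; rewrite patchE; case: ifPn => // /set_mem[Ox _].
    rewrite mule_ge0 ?lee_fin// mule_ge0//; exact: G_ge0.
  - apply/(measurable_restrictT _ (mOc y)).
    apply: emeasurable_funM; first exact: measurable_cst.
    apply: emeasurable_funM; last exact: mw.
    by apply: mG; exact: measurable_green_l.
  have := @ae_neq_rV R n y n_gt0; apply: filterS => x xy _.
  rewrite patchE; case: ifPn => [/set_mem[Ox yx]|/negP nyx].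
    rewrite HE//; last exact/cbox_sym.
    by rewrite /h/= -muleA muleCA (green_sym GE Ox Oy xy).
  rewrite Hout// => -[[Ox _]] /cbox_sym yx; apply: nyx; rewrite inE.
  by split.
rewrite (ge0_integralZl _ (mOc y)); last 3 first.
- apply: emeasurable_funM; last exact: mw.
  by apply: mG; exact: measurable_green_l.
- by move=> x [Ox _]; apply: mule_ge0; [exact: G_ge0|exact: wE0].
- by rewrite lee_fin.
apply: (@le_trans _ _ ((psi y)%:E * (C * e `^ (2 * s) * w y)%:E)%E).
  by apply: lee_wpmul2l; [rewrite lee_fin|exact: nearC].
by rewrite -!EFinM lee_fin mulrCA.
Qed.

(** With this radius, the near part of lam G has norm at most 1/2, both on multiples of w and on
    L^1(w). *)
Lemma absorb_radius lam : 0 < lam ->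
  exists2 e : R, 0 < e & lam * C * e `^ (2 * s) = 2^-1.
Proof.
move=> lam0; have s2 : 2 * s != 0 by rewrite mulf_neq0 ?gt_eqF.
have lC : 0 < 2 * (lam * C) by rewrite !mulr_gt0.
exists ((2 * (lam * C)) `^ (- (2 * s)^-1)); first exact: powR_gt0.
rewrite -powRrM mulNr mulVf// powR_inv1 ?(ltW lC)//.
by rewrite invfM mulrCA mulfV ?mulr1// gt_eqF// mulr_gt0.
Qed.

(** Nothing bounds f beforehand, so the near part cannot be absorbed pointwise. The part [psi] of
    |f| above 2 B w satisfies psi <= lam G psi with G cut to the near part; integrated against w
    this gives J <= J / 2 for its finite norm J, hence psi = 0 almost everywhere. A last use of the
    hypothesis turns |f| <= 2 B w almost everywhere into a bound at every point. *)
Lemma subsolution_bound lam (f : 'rV[R]_n -> R) : 0 < lam ->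
  L1_weight Omega gamma f ->
  (forall x, Omega x -> (`|f x|%:E <=
     lam%:E * \int[leb]_(y in Omega) (G x y * `|f y|%:E))%E) ->
  exists2 M : R, 0 <= M & forall x, Omega x -> `|f x| <= M * w x.
Proof.
move=> lam0 [mf foo] fle.
have [e e0 eC] := absorb_radius lam0.
pose L := fine (\int[leb]_(y in Omega) (`|f y| * w y)%:E).
have fw0 y : (0 <= (`|f y| * w y)%:E)%E by rewrite lee_fin mulr_ge0 ?powR_ge0.
have LE : (\int[leb]_(y in Omega) (`|f y| * w y)%:E = L%:E)%E.
  by rewrite fineK// ge0_fin_numE// integral_ge0.
have L0 : 0 <= L by apply: fine_ge0; exact: integral_ge0.
(* Chosen so that lam times the far part of G|f| at x is at most B w(x). *)
pose B := lam * (C * e `^ (- q)) * L.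
have B0 : 0 <= B.
  by apply: mulr_ge0 => //; apply: mulr_ge0; [exact: ltW|apply: mulr_ge0; [exact: ltW|exact: powR_ge0]].
(* The level 2 B w is the one that the inequality reproduces: the far part yields B w, and the near
   part of 2 B w yields half of 2 B w. *)
pose psi y := Num.max (`|f y| - 2 * B * w y) 0.
have psi0 y : 0 <= psi y by rewrite le_max lexx orbT.
have mabsf : measurable_fun Omega (fun y => `|f y|) by exact: measurableT_comp.
have mww : measurable_fun Omega (fun y => w y) by exact: measurable_weight.
have mpsi : measurable_fun Omega psi.
  apply: measurable_maxr => //; apply: measurable_funB => //.
  by apply: measurable_funM.
have fpsi y : `|f y| <= psi y + 2 * B * w y by rewrite -lerBlDr le_max lexx.
have psif y : psi y <= `|f y|.
  by rewrite ge_max normr_ge0 andbT gerBl mulr_ge0 ?powR_ge0// mulr_ge0.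
have mc x := measurable_cbox x e.
have mOc x : measurable (Omega `&` cbox x e) by exact: measurableI.
have mS x d (U : sigmaRingType d) (g : _ -> U) : measurable_fun Omega g ->
  measurable_fun (Omega `&` cbox x e) g.
  by move=> mg; apply: (measurable_funS mO) => // ? [].
have psile x : Omega x -> ((psi x)%:E <=
    lam%:E * \int[leb]_(y in Omega `&` cbox x e) (G x y * (psi y)%:E))%E.
  move=> Ox.
  have mGx : measurable_fun (Omega `&` cbox x e) (G x).
    by apply: mS; exact: measurable_green_l.
  have mGp : measurable_fun (Omega `&` cbox x e) (fun y => (G x y * (psi y)%:E)%E).
    by apply: emeasurable_funM => //; apply: mS; exact/measurable_EFinP.
  have mGw : measurable_fun (Omega `&` cbox x e) (fun y => (G x y * (w y)%:E)%E).
    by apply: emeasurable_funM => //; exact: mw.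
  set I := (\int[leb]_(y in _) _)%E.
  have I0 : (0 <= I)%E.
    by apply: integral_ge0 => y [Oy _]; apply: mule_ge0; [exact: G_ge0|rewrite lee_fin].
  have near : (\int[leb]_(y in Omega `&` cbox x e) (G x y * `|f y|%:E) <=
     I + (2 * B * (C * e `^ (2 * s) * w x))%:E)%E.
    apply: (@le_trans _ _ (\int[leb]_(y in Omega `&` cbox x e)
       (G x y * (psi y)%:E + (2 * B)%:E * (G x y * (w y)%:E)))%E).
      apply: (ge0_le_integral _ (mOc x)).
      - by move=> y [Oy _]; apply: mule_ge0; [exact: G_ge0|rewrite lee_fin].
      - apply: emeasurable_funM => //; apply: mS; exact/measurable_EFinP.
      - apply: emeasurable_funD => //; apply: emeasurable_funM => //.
      - move=> y [Oy _]; rewrite muleCA -EFinM -ge0_muleDr ?lee_fin//; last first.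
          by rewrite mulr_ge0 ?powR_ge0// mulr_ge0.
        by apply: lee_wpmul2l; [exact: G_ge0|rewrite -EFinD lee_fin].
    rewrite (ge0_integralD _ (mOc x)); last 4 first.
    - by move=> y [Oy _]; apply: mule_ge0; [exact: G_ge0|rewrite lee_fin].
    - exact: mGp.
    - move=> y [Oy _]; apply: mule_ge0; first by rewrite lee_fin mulr_ge0.
      by apply: mule_ge0; [exact: G_ge0|exact: wE0].
    - by apply: emeasurable_funM => //.
    apply: leeD2l; rewrite (ge0_integralZl _ (mOc x)); last 3 first.
    - exact: mGw.
    - by move=> y [Oy _]; apply: mule_ge0; [exact: G_ge0|exact: wE0].
    - by rewrite lee_fin mulr_ge0.
    rewrite [leRHS]EFinM; apply: lee_wpmul2l; first by rewrite lee_fin mulr_ge0.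
    exact: nearC.
  have := fle x Ox.
  move=> /le_trans -/(_ (lam%:E * (I + (2 * B * (C * e `^ (2 * s) * w x))%:E +
     (C * e `^ (- q) * w x)%:E * L%:E))%E) h.
  have {h near} : (`|f x|%:E <= lam%:E * (I + (2 * B * (C * e `^ (2 * s) * w x))%:E +
     (C * e `^ (- q) * w x)%:E * L%:E))%E.
    apply: h; apply: lee_wpmul2l; first by rewrite lee_fin ltW.
    have hs : (\int[leb]_(y in Omega) (G x y * `|f y|%:E) <=
      \int[leb]_(y in Omega `&` cbox x e) (G x y * `|f y|%:E) +
      (C * e `^ (- q) * w x)%:E * \int[leb]_(y in Omega) (`|f y| * w y)%:E)%E.
      exact: green_split_le.
    by apply: (le_trans hs); rewrite LE; apply: leeD2r.
  have e2 : 0 <= e `^ (2 * s) by exact: powR_ge0.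
  have eq0 : 0 <= e `^ (- q) by exact: powR_ge0.
  have wx0 : 0 <= w x by exact: powR_ge0.
  have C0 := ltW C_gt0.
  rewrite -EFinM -addeA -EFinD ge0_muleDr//; last first.
    rewrite lee_fin; apply: addr_ge0; last by rewrite !mulr_ge0.
    by apply: mulr_ge0; [exact: mulr_ge0|rewrite !mulr_ge0].
  rewrite -EFinM.
  rewrite (_ : lam * _ = 2 * B * w x); last first.
    rewrite (_ : lam * _ = 2 * B * w x * (lam * C * e `^ (2 * s)) + B * w x).
      by rewrite eC; field.
    by rewrite /B; ring.
  move=> h; rewrite EFin_max ge_max; apply/andP; split.
    by rewrite EFinB leeBlDr.
  by apply: mule_ge0 => //; rewrite lee_fin ltW.
have [mnear nearle] := near_double_integral_le e0 mpsi psi0.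
pose J := fine (\int[leb]_(y in Omega) (psi y * w y)%:E).
have pw0 y : (0 <= (psi y * w y)%:E)%E by rewrite lee_fin mulr_ge0 ?powR_ge0.
have mpw : measurable_fun Omega (fun y => (psi y * w y)%:E).
  by apply/measurable_EFinP; apply: measurable_funM.
have mfw : measurable_fun Omega (fun y => (`|f y| * w y)%:E).
  by apply/measurable_EFinP; apply: measurable_funM.
(* psi <= |f| makes J finite; otherwise J <= J / 2 would say nothing. *)
have JE : (\int[leb]_(y in Omega) (psi y * w y)%:E = J%:E)%E.
  rewrite fineK// ge0_fin_numE ?integral_ge0//; apply: le_lt_trans foo.
  by apply: ge0_le_integral => // y Oy; rewrite lee_fin ler_wpM2r ?powR_ge0.
have J0 : J <= 2^-1 * J.
  rewrite -lee_fin EFinM -JE.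
  apply: (@le_trans _ _ (\int[leb]_(x in Omega) (lam%:E *
     (\int[leb]_(y in Omega `&` cbox x e) (G x y * (psi y)%:E) * (w x)%:E)))%E).
    apply: (ge0_le_integral _ mO) => //.
    - by apply: emeasurable_funM; [exact: measurable_cst|exact: mnear].
    - move=> x Ox; rewrite muleA EFinM; apply: lee_wpmul2r => //; exact: psile.
  rewrite (ge0_integralZl _ mO); last 3 first.
  - exact: mnear.
  - move=> x Ox; apply: mule_ge0 => //; apply: integral_ge0 => y [Oy _].
    by apply: mule_ge0; [exact: G_ge0|rewrite lee_fin].
  - by rewrite lee_fin ltW.
  apply: (@le_trans _ _ (lam%:E * ((C * e `^ (2 * s))%:E * \int[leb]_(y in Omega) (psi y * w y)%:E))%E).
    by apply: lee_wpmul2l; [rewrite lee_fin ltW|exact: nearle].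
  by rewrite muleA -EFinM mulrA eC.
have {}J0 : J = 0.
  by apply/eqP; rewrite eq_le fine_ge0 ?integral_ge0// andbT; lra.
have aef : {ae leb, forall y, Omega y -> `|f y| <= 2 * B * w y}.
  have : ae_eq leb Omega (fun y => (psi y * w y)%:E) (cst 0%E).
    apply/(ae_eq_integral_abs _ mO mpw).
    under eq_integral do rewrite gee0_abs//.
    by rewrite JE J0.
  apply: filterS => y py Oy; have := py Oy => -[] /eqP.
  rewrite mulf_eq0 orbC gt_eqF ?weight_gt0//= => /eqP p0.
  by have := fpsi y; rewrite p0 add0r.
(* G sees |f| only up to null sets, so the almost everywhere bound may be inserted on the right-hand
   side of the hypothesis. *)
have [C1 C10 HC1] := green_weight_le.
exists (lam * (2 * B * C1)); first by apply: mulr_ge0; [exact: ltW|apply: mulr_ge0; [exact: mulr_ge0|exact: ltW]].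
move=> x Ox; rewrite -lee_fin; apply: (le_trans (fle x Ox)).
rewrite (_ : _ * w x = lam * (2 * B * (C1 * w x))); last by ring.
rewrite EFinM; apply: lee_wpmul2l; first by rewrite lee_fin ltW.
have mGx : measurable_fun Omega (G x) by exact: measurable_green_l.
apply: (@le_trans _ _ (\int[leb]_(y in Omega) ((2 * B)%:E * (G x y * (w y)%:E)))%E).
  apply: (ae_ge0_le_integral mO).
  - by move=> y Oy; apply: mule_ge0; [exact: G_ge0|rewrite lee_fin].
  - by apply: emeasurable_funM => //; exact/measurable_EFinP.
  - move=> y Oy; apply: mule_ge0; first by rewrite lee_fin mulr_ge0.
    by apply: mule_ge0; [exact: G_ge0|exact: wE0].
  - by apply: emeasurable_funM => //; apply: emeasurable_funM => //; exact: mw.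
  move: aef; apply: filterS => y fy Oy.
  rewrite muleCA -EFinM; apply: lee_wpmul2l; first exact: G_ge0.
  by rewrite lee_fin fy.
rewrite (ge0_integralZl _ mO); last 3 first.
- by apply: emeasurable_funM => //; exact: mw.
- by move=> y Oy; apply: mule_ge0; [exact: G_ge0|exact: wE0].
- by rewrite lee_fin mulr_ge0.
by rewrite [leRHS]EFinM; apply: lee_wpmul2l; [rewrite lee_fin mulr_ge0|exact: HC1].
Qed.

End absorption.

(** * Square-integrable functions and orthonormal families *)

Section L2_facts.
Context {R : realType} {n : nat}.
Variables (Omega : set 'rV[R]_n) (mO : measurable Omega).
Local Notation leb := (lebesgue_rV n).
Implicit Types f g : 'rV[R]_n -> R.

Lemma L2_prod_integrable f g : L2 Omega f -> L2 Omega g ->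
  leb.-integrable Omega (EFin \o (fun x => f x * g x)).
Proof.
move=> [mf foo] [mg goo]; apply/integrableP; split.
  by apply/measurable_EFinP; exact: measurable_funM.
apply: (@le_lt_trans _ _ (\int[leb]_(x in Omega) ((f x ^+ 2)%:E + (g x ^+ 2)%:E))%E).
  apply: ge0_le_integral => //.
  - by apply/measurableT_comp => //; apply/measurable_EFinP; exact: measurable_funM.
  - by apply: emeasurable_funD; apply/measurable_EFinP; exact: measurable_funX.
  move=> x _ /=; rewrite lee_fin normrM.
  rewrite -[in leRHS](real_normK (num_real (f x))) -[in leRHS](real_normK (num_real (g x))).
  have := sqr_ge0 (`|f x| - `|g x|).
  by have := normr_ge0 (f x); have := normr_ge0 (g x); nra.
rewrite ge0_integralD//; last 4 first.
- by move=> x _; rewrite lee_fin sqr_ge0.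
- by apply/measurable_EFinP; exact: measurable_funX.
- by move=> x _; rewrite lee_fin sqr_ge0.
- by apply/measurable_EFinP; exact: measurable_funX.
by rewrite lte_add_pinfty.
Qed.

Lemma L2_sqr_integrable f : L2 Omega f ->
  leb.-integrable Omega (EFin \o (fun x => f x ^+ 2)).
Proof. by move=> Lf; exact: L2_prod_integrable. Qed.

Lemma L2_integrable_sqr f : measurable_fun Omega f ->
  leb.-integrable Omega (EFin \o (fun x => f x ^+ 2)) -> L2 Omega f.
Proof.
move=> mf /integrableP[_ foo]; split => //; apply: le_lt_trans foo.
rewrite le_eqVlt; apply/orP; left; apply/eqP; apply: eq_integral => x _ /=.
by rewrite ger0_norm// sqr_ge0.
Qed.

Lemma L2D f g : L2 Omega f -> L2 Omega g -> L2 Omega (fun x => f x + g x).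
Proof.
move=> Lf Lg; have [mf _] := Lf; have [mg _] := Lg.
apply: L2_integrable_sqr; first exact: measurable_funD.
rewrite (_ : _ \o _ = (EFin \o (fun x => f x ^+ 2)) \+
  ((EFin \o (fun x => f x * g x)) \+ ((EFin \o (fun x => f x * g x)) \+ (EFin \o (fun x => g x ^+ 2))))).
  by do 3?[apply: integrableD => //]; try exact: L2_sqr_integrable; exact: L2_prod_integrable.
by apply/funext => x /=; rewrite -!EFinD; congr EFin; ring.
Qed.

Lemma L2Z f a : L2 Omega f -> L2 Omega (fun x => a * f x).
Proof.
move=> Lf; have [mf _] := Lf.
apply: L2_integrable_sqr; first exact: measurable_funM.
rewrite (_ : _ \o _ = (fun x => (a ^+ 2)%:E * (f x ^+ 2)%:E)%E).
  by apply: integrableZl => //; exact: L2_sqr_integrable.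
by apply/funext => x /=; rewrite exprMn.
Qed.

Lemma L2B f g : L2 Omega f -> L2 Omega g -> L2 Omega (fun x => f x - g x).
Proof.
move=> Lf Lg; rewrite (_ : (fun x => _) = (fun x => f x + -1 * g x)).
  by apply: L2D => //; exact: L2Z.
by apply/funext => x; rewrite mulN1r.
Qed.

Lemma L20 : L2 Omega (cst 0).
Proof.
apply: L2_integrable_sqr; first exact: measurable_cst.
rewrite (_ : _ \o _ = cst 0%E); first exact: integrable0.
by apply/funext => x /=; rewrite expr0n.
Qed.

Lemma L2_sum (N : nat) (a : nat -> R) (f : nat -> 'rV[R]_n -> R) :
  (forall k, L2 Omega (f k)) -> L2 Omega (fun x => \sum_(k < N) a k * f k x).
Proof.
move=> Lf; elim: N => [|N IH].
  rewrite (_ : (fun x => _) = cst 0); first exact: L20.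
  by apply/funext => x; rewrite big_ord0.
rewrite (_ : (fun x => _) = (fun x => (\sum_(k < N) a k * f k x) + a N * f N x)).
  by apply: L2D => //; exact: L2Z.
by apply/funext => x; rewrite big_ord_recr.
Qed.

Lemma innerC f g : inner Omega f g = inner Omega g f.
Proof. by apply: eq_Rintegral => x _; rewrite mulrC. Qed.

Lemma innerDl f g h : L2 Omega f -> L2 Omega g -> L2 Omega h ->
  inner Omega (fun x => f x + g x) h = inner Omega f h + inner Omega g h.
Proof.
move=> Lf Lg Lh; rewrite /inner -RintegralD//; try exact: L2_prod_integrable.
by apply: eq_Rintegral => x _; rewrite mulrDl.
Qed.

Lemma innerZl f g a : L2 Omega f -> L2 Omega g ->
  inner Omega (fun x => a * f x) g = a * inner Omega f g.
Proof.
move=> Lf Lg; rewrite /inner -RintegralZl//; try exact: L2_prod_integrable.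
by apply: eq_Rintegral => x _; rewrite mulrA.
Qed.

Lemma innerBl f g h : L2 Omega f -> L2 Omega g -> L2 Omega h ->
  inner Omega (fun x => f x - g x) h = inner Omega f h - inner Omega g h.
Proof.
move=> Lf Lg Lh; rewrite /inner -RintegralB//; try exact: L2_prod_integrable.
by apply: eq_Rintegral => x _; rewrite mulrBl.
Qed.

Lemma innerBr f g h : L2 Omega f -> L2 Omega g -> L2 Omega h ->
  inner Omega f (fun x => g x - h x) = inner Omega f g - inner Omega f h.
Proof. by move=> Lf Lg Lh; rewrite innerC innerBl// !(innerC _ f). Qed.

Lemma inner_suml (N : nat) (a : nat -> R) (f : nat -> 'rV[R]_n -> R) g :
  (forall k, L2 Omega (f k)) -> L2 Omega g ->
  inner Omega (fun x => \sum_(k < N) a k * f k x) g =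
  \sum_(k < N) a k * inner Omega (f k) g.
Proof.
move=> Lf Lg; elim: N => [|N IH].
  rewrite big_ord0 /inner (_ : \int[_]_(x in _) _ = \int[leb]_(x in Omega) 0).
    by rewrite Rintegral_cst// mul0r.
  by apply: eq_Rintegral => x _; rewrite big_ord0 mul0r.
rewrite big_ord_recr/= -IH -innerZl//.
rewrite -innerDl//; [|exact: L2_sum|exact: L2Z].
by congr inner; apply/funext => x; rewrite big_ord_recr.
Qed.

Lemma integral_sqr_inner f : L2 Omega f ->
  (\int[leb]_(x in Omega) (f x ^+ 2)%:E)%E = (inner Omega f f)%:E.
Proof.
move=> Lf; rewrite /inner/= fineK; first by apply: eq_integral.
have := L2_prod_integrable Lf Lf; exact: integrable_fin_num.
Qed.

Section orthonormal.
Variable phi : nat -> 'rV[R]_n -> R.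
Hypotheses (Lphi : forall k, L2 Omega (phi k))
  (on : forall i j, inner Omega (phi i) (phi j) = (i == j)%:R).

Lemma inner_sum_phi (N : nat) (a : nat -> R) j :
  inner Omega (fun x => \sum_(k < N) a k * phi k x) (phi j) =
  if (j < N)%N then a j else 0.
Proof.
rewrite inner_suml//; under eq_bigr do rewrite on.
case: ifPn => jN.
  rewrite (bigD1 (Ordinal jN))//= eqxx mulr1 big1 ?addr0// => i ij.
  by rewrite (_ : (i == j :> nat) = false) ?mulr0//; apply/negbTE; apply: contra ij => /eqP ij; apply/eqP/val_inj.
rewrite big1// => i _; rewrite (_ : (i == j :> nat) = false) ?mulr0//.
by apply/negbTE; apply: contra jN => /eqP <-.
Qed.

Lemma norm_sum_phi (N : nat) (a : nat -> R) :
  (\int[leb]_(x in Omega) ((\sum_(k < N) a k * phi k x) ^+ 2)%:E)%E =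
  (\sum_(k < N) a k ^+ 2)%:E.
Proof.
rewrite integral_sqr_inner; last exact: L2_sum.
rewrite inner_suml//; last exact: L2_sum.
congr EFin; apply: eq_bigr => k _; rewrite innerC inner_sum_phi ltn_ord.
by rewrite expr2.
Qed.

Lemma bessel (N : nat) f : L2 Omega f ->
  \sum_(k < N) inner Omega f (phi k) ^+ 2 <= inner Omega f f.
Proof.
move=> Lf; pose c k := inner Omega f (phi k).
pose S x := \sum_(k < N) c k * phi k x.
have LS : L2 Omega S by exact: L2_sum.
have LfS : L2 Omega (fun x => f x - S x) by exact: L2B.
have : 0 <= inner Omega (fun x => f x - S x) (fun x => f x - S x).
  by apply: Rintegral_ge0 => x _; rewrite -expr2 sqr_ge0.
have SS : inner Omega S S = \sum_(k < N) c k ^+ 2.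
  by apply: EFin_inj; rewrite -integral_sqr_inner// norm_sum_phi.
have fS : inner Omega f S = \sum_(k < N) c k ^+ 2.
  rewrite innerC inner_suml//; apply: eq_bigr => k _.
  by rewrite innerC expr2.
rewrite innerBl// !innerBr//.
by rewrite SS (innerC S f) fS subrr subr0 subr_ge0.
Qed.

End orthonormal.
End L2_facts.

(** * Eigenfunctions and the spectral function *)

Section eigenfunctions.
Context {R : realType} {n : nat}.
Variables (Omega : set 'rV[R]_n) (s gamma : R) (G : 'rV[R]_n -> 'rV[R]_n -> \bar R).
Variables (lambda : nat -> R) (phi : nat -> 'rV[R]_n -> R).
Hypotheses (s_gt0 : 0 < s) (gamma_gt0 : 0 < gamma) (sn : 2 * s < n%:R).
Hypotheses (bO : bounded_domain Omega) (G0 : nonneg_kernel Omega G).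
Hypothesis GE : kernel_estimate Omega gamma G s.
Hypothesis ED : eigendecomposition Omega G lambda phi.
Local Notation leb := (lebesgue_rV n).
Local Notation w x := (delta Omega x `^ gamma).
Local Notation q := (n%:R - 2 * s + 2 * gamma).

Let n_gt0 : (0 < n)%N := dimension_gt0 s_gt0 sn.
Let mO : measurable Omega. Proof. exact: domain_measurable. Qed.

Let mw : measurable_fun Omega (fun y => w y).
Proof. exact: measurable_weight. Qed.

Let w0 x : 0 <= w x. Proof. exact: powR_ge0. Qed.

Let wE0 x : (0 <= (w x)%:E)%E. Proof. by rewrite lee_fin. Qed.

Let G_ge0 x y : Omega x -> Omega y -> (0 <= G x y)%E.
Proof. exact: G0.1. Qed.

Lemma lambda_mono i j : (i <= j)%N -> lambda i <= lambda j.
Proof.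
have [_ _ _ [_ H] _] := ED; elim: j => [|j IH]; first by rewrite leqn0 => /eqP ->.
rewrite leq_eqVlt => /orP[/eqP -> //|]; rewrite ltnS => /IH /le_trans; apply.
exact: H.
Qed.

Lemma lambda_gt0 k : 0 < lambda k.
Proof.
have [_ _ _ [/andP[l0 _] _] _] := ED.
by apply: (lt_le_trans l0); exact: lambda_mono.
Qed.

Lemma phi_L2 k : L2 Omega (phi k).
Proof. by have [[]] := ED. Qed.

Lemma phi_on i j : inner Omega (phi i) (phi j) = (i == j)%:R.
Proof. by have [[]] := ED. Qed.

Lemma phi_measurable k : measurable_fun Omega (phi k).
Proof. by have [] := phi_L2 k. Qed.

Lemma green_phi k x : Omega x -> green Omega G (phi k) x = ((lambda k)^-1 * phi k x)%:E.
Proof. by have [_ _ H _ _] := ED; exact: H. Qed.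

Lemma bounded_L2 (f : 'rV[R]_n -> R) (M : R) : measurable_fun Omega f ->
  (forall x, Omega x -> `|f x| <= M) -> L2 Omega f.
Proof.
move=> mf fM; apply: L2_integrable_sqr => //.
apply: measurable_bounded_integrable => //.
- exact: domain_lebesgue_lty.
- exact: measurable_funX.
exists (M ^+ 2); split; first exact: num_real.
move=> b Mb x Ox /=; rewrite normrX (le_trans _ (ltW Mb))//.
by rewrite ler_pXn2r ?nnegrE// ?(le_trans (normr_ge0 _) (fM x Ox))//; exact: fM.
Qed.

Lemma weight_L2 : L2 Omega (fun x => w x).
Proof.
have [M M0 wM] := weight_bounded n_gt0 bO gamma_gt0.
apply: (@bounded_L2 _ M) => // x Ox; rewrite ger0_norm//; exact: wM.
Qed.

Lemma weighted_bounded_L2 (f : 'rV[R]_n -> R) (M : R) : measurable_fun Omega f ->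
  (forall x, Omega x -> `|f x| <= M * w x) -> L2 Omega f.
Proof.
move=> mf fM; have [W W0 wW] := weight_bounded n_gt0 bO gamma_gt0.
apply: (@bounded_L2 _ (`|M| * W)) => // x Ox.
apply: (le_trans (fM x Ox)); apply: (@le_trans _ _ (`|M| * w x)).
  by apply: ler_wpM2r => //; exact: ler_norm.
by apply: ler_wpM2l => //; exact: wW.
Qed.

Lemma L2_L1_weight (f : 'rV[R]_n -> R) : L2 Omega f -> L1_weight Omega gamma f.
Proof.
move=> Lf; have [mf _] := Lf; split => //.
have /integrableP[_ ] := L2_prod_integrable mO Lf weight_L2.
by under eq_integral do rewrite /= normrM (ger0_norm (w0 _)).
Qed.

Lemma green_fin_num x y : Omega x -> Omega y -> x != y -> G x y \is a fin_num.
Proof.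
move=> Ox Oy xy; have [c [C [_ _ /(_ x y Ox Oy xy)[_ _ Gle]]]] := GE.
by rewrite ge0_fin_numE ?G_ge0// (le_lt_trans Gle) ?ltry.
Qed.

(** G(x, .) is finite off the point x, which is null; with real-valued integrands the linearity of
    the integral in f becomes available. *)
Lemma green_fineE (f : 'rV[R]_n -> R) x : Omega x -> measurable_fun Omega f ->
  (\int[leb]_(y in Omega) (G x y * (f y)%:E) =
   \int[leb]_(y in Omega) (fine (G x y) * f y)%:E)%E.
Proof.
move=> Ox mf; have mG : measurable_fun Omega (G x) by exact: measurable_green_l.
apply: (ae_eq_integral _ _ mO).
- by apply: emeasurable_funM => //; exact/measurable_EFinP.
- apply/measurable_EFinP; apply: measurable_funM => //.
  exact: measurableT_comp.
have := @ae_neq_rV R n x n_gt0; apply: filterS => y yx Oy.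
by rewrite EFinM fineK// green_fin_num// eq_sym.
Qed.

Lemma integrable_green x (f : 'rV[R]_n -> R) (M : R) : Omega x -> measurable_fun Omega f -> 0 <= M ->
  (forall y, Omega y -> `|f y| <= M * w y) ->
  leb.-integrable Omega (EFin \o (fun y => fine (G x y) * f y)).
Proof.
move=> Ox mf M0 fM; have mG : measurable_fun Omega (G x) by exact: measurable_green_l.
have [C [C_gt0 nearC farC]] := green_near_far s_gt0 gamma_gt0 sn bO G0 GE.
apply/integrableP; split.
  apply/measurable_EFinP; apply: measurable_funM => //; exact: measurableT_comp.
have e0 : 0 < 1 :> R by [].
have := green_abs_le s_gt0 sn bO G0 C_gt0 nearC farC mf M0 fM e0 Ox.
have mf' : measurable_fun Omega (fun y => `|f y|) by exact: measurableT_comp.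
rewrite (green_fineE Ox mf').
move=> h; apply: (@le_lt_trans _ _ (\int[leb]_(y in Omega) (fine (G x y) * `|f y|)%:E)%E).
  rewrite le_eqVlt; apply/orP; left; apply/eqP; apply: eq_integral => y /set_mem Oy /=.
  by rewrite normrM [`|fine _|]ger0_norm// fine_ge0// G_ge0.
apply: (le_lt_trans h); have Lf := weighted_bounded_L2 mf fM.
have [_ foo] := L2_L1_weight Lf.
rewrite lte_add_pinfty ?ltry// lte_mul_pinfty// ?fin_numE//.
by rewrite lee_fin mulr_ge0// mulr_ge0 ?powR_ge0// ltW.
Qed.

(** The eigenvalue equation, valid at every point, makes |phi k| a subsolution. The dependence of M
    on k is not controlled here. *)
Lemma phi_bounded k : exists2 M : R, 0 <= M & forall x, Omega x -> `|phi k x| <= M * w x.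
Proof.
have [C [C_gt0 nearC farC]] := green_near_far s_gt0 gamma_gt0 sn bO G0 GE.
apply: (subsolution_bound s_gt0 sn bO G0 GE C_gt0 nearC farC (lambda_gt0 k)).
  exact/L2_L1_weight/phi_L2.
move=> x Ox; have lk := lambda_gt0 k.
have mG : measurable_fun Omega (G x) by exact: measurable_green_l.
have mphi := phi_measurable k.
rewrite (_ : `|phi k x|%:E = ((lambda k)%:E * `| green Omega G (phi k) x |)%E); last first.
  rewrite green_phi// abse_EFin -EFinM normrM gtr0_norm ?invr_gt0//.
  by rewrite mulrA mulfV ?mul1r// gt_eqF.
apply: lee_wpmul2l; first by rewrite lee_fin ltW.
apply: (le_trans (le_abse_integral _ mO _)).
  by apply: emeasurable_funM => //; exact/measurable_EFinP.
rewrite le_eqVlt; apply/orP; left; apply/eqP; apply: eq_integral => y /set_mem Oy.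
by rewrite abseM gee0_abs ?G_ge0.
Qed.


Let P N x : 'rV[R]_N := \row_(k < N) phi k x.

Let sqr_P N x : enorm (P N x) ^+ 2 = \sum_(k < N) phi k x ^+ 2.
Proof. by rewrite sqr_enorm; apply: eq_bigr => k _; rewrite mxE. Qed.

(** Only finiteness matters: it makes the supremum of |P| / w finite, so that half of it can be
    absorbed. The size of M is then forgotten. *)
Let P_bounded N : exists2 M : R, 0 <= M & forall x, Omega x -> enorm (P N x) <= M * w x.
Proof.
have M_ (k : 'I_N) : {M : R | 0 <= M /\ forall x, Omega x -> `|phi k x| <= M * w x}.
  by apply: cid; have [M M0 H] := phi_bounded k; exists M.
pose M := \sum_(k < N) sval (M_ k).
have M0 : 0 <= M by apply: sumr_ge0 => k _; case: (M_ k) => ? [].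
exists (N%:R * M); first by rewrite mulr_ge0.
move=> x Ox; apply: (le_trans (enorm_le_norm _)); rewrite -mulrA ler_wpM2l//.
apply: norm_rV_le => [|k]; first by rewrite mulr_ge0.
rewrite mxE; have [Mk0 /(_ x Ox) /le_trans] := svalP (M_ k); apply.
rewrite ler_wpM2r// /M (bigD1 k)//= lerDl.
by apply: sumr_ge0 => i _; case: (M_ i) => ? [].
Qed.

Let g N x y := \sum_(k < N) (lambda k * phi k x) * phi k y.

Let mg N x : measurable_fun Omega (g N x).
Proof.
rewrite /g; apply: measurable_sum => k; apply: measurable_funM => //.
exact: phi_measurable.
Qed.

(* phi k = lambda k G (phi k) turns P into G g. *)
Let sqr_P_le N x : Omega x ->
  ((enorm (P N x) ^+ 2)%:E <= \int[leb]_(y in Omega) (G x y * `|g N x y|%:E))%E.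
Proof.
move=> Ox; have mg' : measurable_fun Omega (fun y => `|g N x y|) by exact: measurableT_comp.
have ik k : leb.-integrable Omega (EFin \o (fun y => fine (G x y) * phi k y)).
  have [M M0 H] := phi_bounded k; apply: (integrable_green Ox _ M0 H).
  exact: phi_measurable.
have -> : (enorm (P N x) ^+ 2)%:E = (\int[leb]_(y in Omega) (fine (G x y) * g N x y)%:E)%E.
  transitivity (\int[leb]_(y in Omega) (\sum_(k < N) (lambda k * phi k x)%:E * (fine (G x y) * phi k y)%:E))%E; last first.
    apply: eq_integral => y _; rewrite /g mulr_sumr -sumEFin; apply: eq_bigr => k _.
    by rewrite -EFinM; congr EFin; ring.
  rewrite integral_sum//; last by move=> k; apply: (integrableZl mO); exact: ik.
  rewrite sqr_P -sumEFin; apply: eq_bigr => k _.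
  rewrite (integralZl mO (ik k)).
  rewrite (_ : integral _ _ _ = green Omega G (phi k) x); last first.
    by rewrite -green_fineE//; exact: phi_measurable.
  rewrite green_phi// -EFinM expr2; congr EFin.
  by field; rewrite gt_eqF// lambda_gt0.
have mG : measurable_fun Omega (G x) by exact: measurable_green_l.
have mGg : measurable_fun Omega (fun y => fine (G x y) * g N x y).
  by apply: measurable_funM => //; exact: measurableT_comp.
rewrite (green_fineE Ox mg'); apply: (le_trans (lee_abs _)).
apply: (le_trans (le_abse_integral _ mO _)); first exact/measurable_EFinP.
rewrite le_eqVlt; apply/orP; left; apply/eqP; apply: eq_integral => y /set_mem Oy.
by rewrite abse_EFin normrM ger0_norm// fine_ge0// G_ge0.
Qed.

(** Cauchy-Schwarz in R^N for the vectors (lambda k phi k x) and P(y): the bound carries no factor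
    N, which estimates of the separate terms would introduce. *)
Let g_le N x y L : (forall k, (k < N)%N -> lambda k <= L) -> 0 <= L ->
  `|g N x y| <= L * enorm (P N x) * enorm (P N y).
Proof.
move=> lL L0.
pose a : 'rV[R]_N := \row_(k < N) (lambda k * phi k x).
have gE : g N x y = \sum_i a ord0 i * P N y ord0 i.
  by apply: eq_bigr => k _; rewrite !mxE.
have ae : enorm a <= L * enorm (P N x).
  rewrite -(@ler_pXn2r _ 2)// ?nnegrE ?mulr_ge0 ?enorm_ge0//.
  rewrite exprMn sqr_P sqr_enorm mulr_sumr; apply: ler_sum => k _.
  have lk0 := ltW (lambda_gt0 k); have lkL := lL k (ltn_ord k).
  by rewrite mxE exprMn ler_wpM2r ?sqr_ge0// ler_pXn2r.
rewrite (le_trans (y := enorm a * enorm (P N y)))//; last first.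
  by rewrite ler_wpM2r ?enorm_ge0.
rewrite ler_norml; apply/andP; split; last by rewrite gE cauchy_schwarz_enorm.
rewrite lerNl -(enormN a) gE -sumrN.
rewrite (eq_bigr (fun i => (- a) ord0 i * P N y ord0 i)); first exact: cauchy_schwarz_enorm.
by move=> i _; rewrite [(- a) _ _]mxE mulNr.
Qed.

Let W := inner Omega (fun x => w x) (fun x => w x).

Let W0 : 0 <= W.
Proof. by apply: Rintegral_ge0 => x _; rewrite mulr_ge0. Qed.

(** By orthonormality g has squared L^2 norm at most (L S)^2 in y, with S = |P(x)|, and w lies in
    L^2. Young's inequality with weights 1 / (2 L S) and L S / 2 keeps the result linear in S, as
    the later division by S requires. *)
Let g_L1 N x L : (forall k, (k < N)%N -> lambda k <= L) -> 0 < L -> 0 < enorm (P N x) ->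
  (\int[leb]_(y in Omega) (`|g N x y| * w y)%:E <=
   (L * enorm (P N x) * ((1 + W) / 2))%:E)%E.
Proof.
move=> lL L0 S0; set S := enorm _ in S0 *; have LS : 0 < L * S by rewrite mulr_gt0.
apply: (@le_trans _ _ (\int[leb]_(y in Omega)
   ((2 * (L * S))^-1%:E * (g N x y ^+ 2)%:E + (L * S / 2)%:E * (w y ^+ 2)%:E))%E).
  apply: (ge0_le_integral _ mO).
  - by move=> y _; rewrite lee_fin mulr_ge0.
  - by apply/measurable_EFinP/measurable_funM => //; exact: measurableT_comp.
  - by apply: emeasurable_funD; apply: emeasurable_funM => //; apply/measurable_EFinP/measurable_funX.
  move=> y _; rewrite -!EFinM -EFinD lee_fin -subr_ge0.
  rewrite -(real_normK (num_real (g N x y))).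
  rewrite (_ : _ - _ = (`|g N x y| - L * S * w y) ^+ 2 / (2 * (L * S))).
    by rewrite divr_ge0 ?sqr_ge0// mulr_ge0// ltW.
  by field; rewrite (gt_eqF L0) (gt_eqF S0).
have c1 : 0 <= (2 * (L * S))^-1 by rewrite invr_ge0 mulr_ge0// ltW.
have c2 : 0 <= L * S / 2 by rewrite divr_ge0// ltW.
rewrite (ge0_integralD _ mO); last 4 first.
- by move=> y _; rewrite -EFinM lee_fin mulr_ge0 ?sqr_ge0.
- by apply: emeasurable_funM => //; apply/measurable_EFinP/measurable_funX.
- by move=> y _; rewrite -EFinM lee_fin mulr_ge0 ?sqr_ge0.
- by apply: emeasurable_funM => //; apply/measurable_EFinP/measurable_funX.
rewrite (ge0_integralZl _ mO); last 3 first.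
- exact/measurable_EFinP/measurable_funX.
- by move=> y _; rewrite lee_fin sqr_ge0.
- by rewrite lee_fin.
rewrite (ge0_integralZl _ mO); last 3 first.
- exact/measurable_EFinP/measurable_funX.
- by move=> y _; rewrite lee_fin sqr_ge0.
- by rewrite lee_fin.
rewrite (norm_sum_phi mO phi_L2 phi_on N (fun k => lambda k * phi k x)).
rewrite (integral_sqr_inner mO weight_L2) -!EFinM -EFinD lee_fin.
have le2 : \sum_(k < N) (lambda k * phi k x) ^+ 2 <= (L * S) ^+ 2.
  rewrite exprMn sqr_P mulr_sumr; apply: ler_sum => k _.
  have lk0 := ltW (lambda_gt0 k); have lkL := lL k (ltn_ord k).
  by rewrite exprMn ler_wpM2r ?sqr_ge0// ler_pXn2r// nnegrE ltW.
rewrite -/W; apply: (@le_trans _ _ ((2 * (L * S))^-1 * (L * S) ^+ 2 + L * S / 2 * W)).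
  by rewrite lerD2r ler_wpM2l.
by rewrite le_eqVlt; apply/orP; left; apply/eqP; field; rewrite (gt_eqF L0) (gt_eqF S0).
Qed.

(** Let b be the supremum of |P| / w and S = |P(x)|. The near-far bound for g, where |g| <= L S b w,
    gives S^2 <= S (b / 2 + K') w(x) with K' a power of L up to a constant. Dividing by S and taking
    the supremum yields b <= b / 2 + K', and b is finite. *)
Lemma spectral_function_bound : exists A p : R, [/\ 0 < A, 0 <= p &
  forall N L, 0 < L -> (forall k, (k < N)%N -> lambda k <= L) ->
  forall x, Omega x -> \sum_(k < N) phi k x ^+ 2 <= (A * L `^ p * w x) ^+ 2].
Proof.
have [C [C_gt0 nearC farC]] := green_near_far s_gt0 gamma_gt0 sn bO G0 GE.
pose r := q / (2 * s); pose K := (1 + W) / 2.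
have q0 : 0 < q by rewrite addr_gt0 ?subr_gt0// mulr_gt0.
have s20 : 2 * s != 0 by rewrite mulf_neq0 ?gt_eqF.
have K0 : 0 < K by rewrite divr_gt0// ltr_pwDl.
have r0 : 0 <= r by rewrite divr_ge0 ?ltW// mulr_gt0.
pose A := 2 * C * K * (2 * C) `^ r.
have A0 : 0 < A.
  apply: mulr_gt0; first by apply: mulr_gt0 => //; exact: mulr_gt0.
  by apply: powR_gt0; exact: mulr_gt0.
exists A, (1 + r); split; [exact: A0|exact: addr_ge0|].
move=> N L L0 lL.
have LC : 0 < 2 * (L * C) by rewrite !mulr_gt0.
(* The radius of [absorb_radius] for lam = L, kept explicit because its power e^(-q) determines how
   the bound grows with L. *)
pose e := (2 * (L * C)) `^ (- (2 * s)^-1).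
have e0 : 0 < e by exact: powR_gt0.
have eC : L * C * e `^ (2 * s) = 2^-1.
  rewrite /e -powRrM mulNr mulVf// powR_inv1 ?(ltW LC)//.
  by rewrite invfM mulrCA mulfV ?mulr1// gt_eqF// mulr_gt0.
have eq : e `^ (- q) = (2 * C) `^ r * L `^ r.
  rewrite /e -powRrM mulrNN mulrC -powRM ?(ltW L0)//; last by rewrite mulr_ge0// ltW.
  by rewrite /r; congr (_ `^ _); ring.
have [M M0 PM] := P_bounded N.
pose E := [set enorm (P N x) / w x | x in Omega].
have wx x : Omega x -> 0 < w x by move=> Ox; exact: weight_gt0.
have ubE : has_ubound E.
  by exists M => _ [x Ox <-]; rewrite ler_pdivrMr ?wx//; exact: PM.
have [x0 Ox0] : Omega !=set0 by case: bO.
have E0 : E !=set0 by exists (enorm (P N x0) / w x0), x0.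
pose b := sup E.
have Pb x : Omega x -> enorm (P N x) <= b * w x.
  by move=> Ox; rewrite -ler_pdivrMr ?wx//; apply: sup_ubound => //; exists x.
have b0 : 0 <= b.
  by have := Pb _ Ox0; rewrite -(pmulr_lge0 _ (wx _ Ox0)); apply: le_trans; exact: enorm_ge0.
have key x : Omega x -> enorm (P N x) <= (b / 2 + C * e `^ (- q) * L * K) * w x.
  move=> Ox; set S := enorm _.
  have eq0 : 0 <= e `^ (- q) by exact: powR_ge0.
  have [S0|S0] := eqVneq S 0.
    rewrite S0 mulr_ge0// addr_ge0 ?divr_ge0// mulr_ge0 ?(ltW K0)// mulr_ge0 ?(ltW L0)//.
    by rewrite mulr_ge0// ltW.
  have Sp : 0 < S by rewrite lt0r S0 enorm_ge0.
  have gb y : Omega y -> `|g N x y| <= L * S * b * w y.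
    move=> Oy; apply: (le_trans (g_le _ _ lL (ltW L0))).
    rewrite -[leRHS]mulrA ler_wpM2l ?mulr_ge0 ?(ltW L0) ?(ltW Sp)//.
    exact: Pb.
  have LSb : 0 <= L * S * b by rewrite mulr_ge0// mulr_ge0 ?(ltW L0) ?(ltW Sp).
  have := sqr_P_le N Ox.
  move=> /le_trans /(_ (green_abs_le s_gt0 sn bO G0 C_gt0 nearC farC (mg N x) LSb gb e0 Ox)).
  have Ce0 : 0 <= C * e `^ (- q) * w x by rewrite mulr_ge0// mulr_ge0// ltW.
  move=> /le_trans /(_ (leeD2l _ (lee_wpmul2l (x := (C * e `^ (- q) * w x)%:E) Ce0 (g_L1 lL L0 Sp)))).
  rewrite -/S -EFinM -EFinD lee_fin expr2.
  rewrite [X in (S * S <= X) -> _](_ : _ = S * ((b * (L * C * e `^ (2 * s)) + C * e `^ (- q) * L * K) * w x)).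
    by rewrite ler_pM2l// eC.
  by rewrite /K; ring.
have bK : b <= b / 2 + C * e `^ (- q) * L * K.
  apply: ge_sup => // _ [x Ox <-]; rewrite ler_pdivrMr ?wx//; exact: key.
have {}bK : b <= A * L `^ (1 + r).
  have -> : A * L `^ (1 + r) = 2 * (C * e `^ (- q) * L * K).
    rewrite powRD ?(gt_eqF L0) ?implybT// powRr1 ?(ltW L0)// eq /A; ring.
  by lra.
move=> x Ox; rewrite -sqr_P ler_pXn2r ?nnegrE ?enorm_ge0//.
  by apply: (le_trans (Pb x Ox)); rewrite ler_wpM2r.
by apply: mulr_ge0 => //; apply: mulr_ge0; [exact: ltW|exact: powR_ge0].
Qed.

End eigenfunctions.

(** * Growth of eigenvalues and eigenfunctions *)

Lemma nonneg_series_cvg (R : realType) (u : R^nat) (B : R) : (forall k, 0 <= u k) ->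
  (forall N, \sum_(k < N) u k <= B) -> cvgn (series u).
Proof.
move=> u0 uB; apply: nondecreasing_is_cvgn.
  apply/nondecreasing_seqP => N; rewrite /series/= big_nat_recr//= lerDl; exact: u0.
by exists B => _ [N _ <-]; rewrite /series/= big_mkord.
Qed.

Lemma nonneg_series_le (R : realType) (u : R^nat) N : (forall k, 0 <= u k) ->
  cvgn (series u) -> \sum_(k < N) u k <= limn (series u).
Proof.
move=> u0 cu; rewrite -(big_mkord xpredT).
apply: (nondecreasing_cvgn_le _ cu N).
by apply/nondecreasing_seqP => m; rewrite /series/= big_nat_recr//= lerDl; exact: u0.
Qed.

Lemma sum_invr_sqr_le (R : realType) N : \sum_(k < N) (k.+1%:R ^+ 2)^-1 <= 2 :> R.
Proof.
case: N => [|N]; first by rewrite big_ord0.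
(* Strengthened so that the induction closes, by 1 / (N+2)^2 <= 1 / (N+1) - 1 / (N+2). *)
apply: (@le_trans _ _ (2 - N.+1%:R^-1)); last by rewrite gerBl.
elim: N => [|N IH]; first by rewrite big_ord_recr big_ord0/= add0r expr1n invr1; lra.
rewrite big_ord_recr/=; apply: (le_trans (lerD IH (lexx _))).
rewrite -[leLHS]addrA lerD2l -subr_ge0.
rewrite (_ : _ - _ = (N.+1%:R)^-1 * ((N.+2%:R ^+ 2)^-1)).
  by rewrite mulr_ge0// invr_ge0 exprn_ge0.
have : N.+1%:R != 0 :> R by rewrite pnatr_eq0.
have : N.+2%:R != 0 :> R by rewrite pnatr_eq0.
rewrite -[N.+2%:R]natr1; move: (N.+1%:R) => a a1 a0.
field.
by rewrite a0 a1.
Qed.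

Lemma expRN_le_power (R : realType) (x : R) j : 0 < x ->
  expR (- x) <= (j.+1)`!%:R / x ^+ j.+1.
Proof.
move=> x0; have := expR_ge1Dxn j (ltW x0).
have xj : 0 < x ^+ j.+1 by rewrite exprn_gt0.
have fj : 0 < (j.+1)`!%:R :> R by rewrite ltr0n fact_gt0.
move=> h; rewrite expRN -[leRHS]invrK lef_pV2 ?posrE ?expR_gt0 ?invr_gt0 ?divr_gt0//.
by rewrite invf_div (le_trans _ h)// lerDr.
Qed.

Section spectral_package.
Context {R : realType} {n : nat}.
Variables (Omega : set 'rV[R]_n) (s gamma : R) (G : 'rV[R]_n -> 'rV[R]_n -> \bar R).
Variables (lambda : nat -> R) (phi : nat -> 'rV[R]_n -> R).
Hypotheses (s_gt0 : 0 < s) (gamma_gt0 : 0 < gamma) (sn : 2 * s < n%:R).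
Hypotheses (bO : bounded_domain Omega) (G0 : nonneg_kernel Omega G).
Hypothesis GE : kernel_estimate Omega gamma G s.
Hypothesis ED : eigendecomposition Omega G lambda phi.
Local Notation leb := (lebesgue_rV n).
Local Notation w x := (delta Omega x `^ gamma).

Let n_gt0 : (0 < n)%N := dimension_gt0 s_gt0 sn.
Let mO : measurable Omega. Proof. exact: domain_measurable. Qed.

(** The spectral bound, integrated over Omega, counts the eigenfunctions: k + 1 is at most a
    constant times a power of 1 + lambda k. At every t > 0 the exponential therefore beats M k ^+ 2
    with enough left over to sum in k. *)
Lemma eigenfunction_growth : exists M : nat -> R, [/\ forall k, 1 <= M k,
  forall k x, Omega x -> `|phi k x| <= M k * w x &
  forall t, 0 < t -> cvgn (series (fun k => expR (- lambda k * t) * M k ^+ 2))].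
Proof.
have [A [p [A0 p0 bound]]] := spectral_function_bound s_gt0 gamma_gt0 sn bO G0 GE ED.
have lam0 := lambda_gt0 ED.
pose W := inner Omega (fun x => w x) (fun x => w x).
have wL2 : L2 Omega (fun x => w x) by apply: (weight_L2 s_gt0 gamma_gt0 sn bO).
have mw2 : measurable_fun Omega (fun x => (w x ^+ 2)%:E).
  by apply/measurable_EFinP; apply: measurable_funX; have [] := wL2.
have W0 : 0 <= W by apply: Rintegral_ge0 => x _; rewrite mulr_ge0 ?powR_ge0.
have [m pm m0] : exists2 m : nat, p <= m%:R & (0 < m)%N.
  exists (Num.bound p).+1 => //.
  by rewrite (le_trans (ltW (archi_boundP p0)))// ler_nat leqW.
(* Adding 1 puts the base above 1, so that the exponent p may be raised to the integer m and [M]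
   stays at least 1. The price is the factor exp(t) in [B]. *)
pose L k := 1 + lambda k.
have L1 k : 1 <= L k by rewrite lerDl ltW.
have L0 k : 0 < L k by rewrite (lt_le_trans _ (L1 k)).
have lL k : lambda k `^ p <= L k ^+ m.
  rewrite -powR_mulrn ?(ltW (L0 k))//; apply: (@le_trans _ _ (L k `^ p)).
    by apply: (ge0_ler_powR p0); rewrite ?nnegrE ?(ltW (L0 k)) ?(ltW (lam0 k))// lerDr.
  exact: ler_powR.
have lp0 k : 0 <= lambda k `^ p by exact: powR_ge0.
have bk k x : Omega x -> \sum_(i < k.+1) phi i x ^+ 2 <= (A * L k ^+ m * w x) ^+ 2.
  move=> Ox; have lk i : (i < k.+1)%N -> lambda i <= lambda k.
    by rewrite ltnS; exact: (lambda_mono ED).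
  apply: (le_trans (bound _ _ (lam0 k) lk x Ox)).
  have w0 : 0 <= w x by exact: powR_ge0.
  rewrite ler_pXn2r// ?nnegrE ?mulr_ge0 ?(ltW A0) ?exprn_ge0 ?(ltW (L0 k))//.
  by rewrite ler_wpM2r// ler_wpM2l// ltW.
(* Each of the k + 1 eigenfunctions has unit norm, so the left-hand side is the integral of the sum
   of their squares. *)
have count k : k.+1%:R <= A ^+ 2 * W * (L k ^+ m) ^+ 2.
  rewrite -lee_fin; apply: (@le_trans _ _ (\int[leb]_(x in Omega)
      (((A * L k ^+ m) ^+ 2)%:E * (w x ^+ 2)%:E))%E); last first.
    rewrite (ge0_integralZl _ mO); last 3 first.
    - exact: mw2.
    - by move=> x _; rewrite lee_fin sqr_ge0.
    - by rewrite lee_fin sqr_ge0.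
    by rewrite (integral_sqr_inner mO wL2) -EFinM lee_fin exprMn mulrAC.
  have mphi i : measurable_fun Omega (fun x => (phi i x ^+ 2)%:E).
    by apply/measurable_EFinP; apply: measurable_funX; exact: (phi_measurable ED).
  apply: (@le_trans _ _ (\int[leb]_(x in Omega) (\sum_(i < k.+1) (phi i x ^+ 2)%:E))%E).
    rewrite (ge0_integral_sum _ mO); last 2 first.
    - by move=> i; exact: mphi.
    - by move=> i x _; rewrite lee_fin sqr_ge0.
    rewrite (eq_bigr (fun=> 1%E)); last first.
      by move=> i _; rewrite (integral_sqr_inner mO (phi_L2 ED i)) (phi_on ED) eqxx.
    by rewrite sumEFin sumr_const card_ord.
  apply: (ge0_le_integral _ mO).
  - by move=> x _; apply: sume_ge0 => i _; rewrite lee_fin sqr_ge0.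
  - by apply: emeasurable_sum => i; exact: mphi.
  - apply: emeasurable_funM; first exact: measurable_cst.
    exact: mw2.
  - by move=> x Ox; rewrite sumEFin -EFinM lee_fin -exprMn; exact: bk.
exists (fun k => (A + 1) * L k ^+ m); split.
- move=> k; rewrite -[leLHS]mulr1 ler_pM// ?lerDr ?(ltW A0)//.
  by rewrite -[leLHS](expr1n R m) ler_pXn2r// nnegrE ltW.
- move=> k x Ox; have w0 : 0 <= w x by exact: powR_ge0.
  have ALw : 0 <= A * L k ^+ m * w x.
    by rewrite mulr_ge0// mulr_ge0 ?exprn_ge0// ltW.
  apply: (@le_trans _ _ (A * L k ^+ m * w x)).
    rewrite -(@ler_pXn2r _ 2)// ?nnegrE// real_normK ?num_real//.
    apply: le_trans (bk k x Ox); rewrite big_ord_recr/= lerDr.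
    by apply: sumr_ge0 => i _; exact: sqr_ge0.
  by rewrite ler_wpM2r// ler_wpM2r ?exprn_ge0 ?(ltW (L0 k))// lerDl.
move=> t t0.
(* With l = (L k)^m, the exponential gives l^(-6), M k ^+ 2 takes back l^2, and the remaining l^(-4)
   is at most a constant over (k + 1)^2 by [count]. *)
pose j := (6 * m).-1.
pose B := (A + 1) ^+ 2 * expR t * ((j.+1)`!%:R / t ^+ j.+1) * (A ^+ 2 * W) ^+ 2.
have B0 : 0 <= B.
  by rewrite !mulr_ge0 ?expR_ge0 ?invr_ge0 ?exprn_ge0 ?addr_ge0 ?(ltW A0) ?(ltW t0).
apply: (@nonneg_series_cvg _ _ (B * 2)).
  by move=> k; rewrite mulr_ge0 ?expR_ge0// sqr_ge0.
move=> N; apply: (@le_trans _ _ (B * \sum_(k < N) (k.+1%:R ^+ 2)^-1)); last first.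
  by rewrite ler_wpM2l// sum_invr_sqr_le.
rewrite mulr_sumr; apply: ler_sum => k _.
have -> : expR (- lambda k * t) = expR t * expR (- (L k * t)).
  by rewrite -expRD /L; congr expR; ring.
have Lt : 0 < L k * t by rewrite mulr_gt0.
have hL := expRN_le_power j Lt.
have j1 : j.+1 = (6 * m)%N by rewrite prednK// muln_gt0.
have LM : 0 < L k ^+ m by rewrite exprn_gt0.
apply: (@le_trans _ _ (expR t * ((j.+1)`!%:R / (L k * t) ^+ j.+1) * ((A + 1) * L k ^+ m) ^+ 2)).
  by rewrite ler_wpM2r ?sqr_ge0// ler_wpM2l// expR_ge0.
rewrite /B; move: (j.+1)`!%:R (ler0n R (j.+1)`!) => F F0.
have {}count := count k.
rewrite j1 exprMn (mulnC 6) !exprM.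
have tm : 0 < (t ^+ m) ^+ 6 by rewrite !exprn_gt0.
have c0 : 0 < k.+1%:R :> R by rewrite ltr0n.
move: count c0 LM tm.
move: (k.+1%:R : R) (A ^+ 2 * W) (L k ^+ m) ((t ^+ m) ^+ 6) => c D l U cD c0 l0 U0.
have D0 : 0 < D by rewrite -(pmulr_lgt0 _ (exprn_gt0 2 l0)) (lt_le_trans c0).
have El : 0 <= (A + 1) ^+ 2 * expR t * (F / U).
  by rewrite mulr_ge0 ?divr_ge0 ?(ltW U0)// mulr_ge0 ?sqr_ge0 ?expR_ge0.
rewrite (_ : _ * _ ^+ 2 = (A + 1) ^+ 2 * expR t * (F / U) * (l ^+ 4)^-1); last first.
  by field; rewrite !gt_eqF.
rewrite -[leRHS]mulrA ler_wpM2l// -[D ^+ 2]invrK -invfM lef_pV2 ?posrE ?exprn_gt0//; last first.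
  by rewrite mulr_gt0 ?invr_gt0 ?exprn_gt0.
rewrite ler_pdivrMl ?exprn_gt0// (_ : _ * _ = (D * l ^+ 2) ^+ 2); last by ring.
by rewrite ler_pXn2r// nnegrE ltW// (lt_le_trans c0).
Qed.

End spectral_package.

(** * Series dominated by a summable sequence *)

Section dominated_series.
Context {R : realType}.
Implicit Types u a l : R^nat.

Lemma dominated_series_cvg u a : (forall k, `|u k| <= a k) -> cvgn (series a) ->
  cvgn (series u).
Proof.
move=> ua ca; apply: normed_cvg; apply: series_le_cvg ca => // k.
  exact: normr_ge0.
exact: le_trans (ua k).
Qed.

Lemma dominated_series_tail u a N : (forall k, `|u k| <= a k) -> cvgn (series a) ->
  `|limn (series u) - \sum_(k < N) u k| <= limn (series a) - \sum_(k < N) a k.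
Proof.
move=> ua ca; have cu := dominated_series_cvg ua ca.
have a0 k : 0 <= a k by exact: le_trans (ua k).
have cl : `|series u m - \sum_(k < N) u k| @[m --> \oo] -->
    `|limn (series u) - \sum_(k < N) u k|.
  by apply: cvg_norm; apply: cvgB => //; exact: cvg_cst.
rewrite -(cvg_lim _ cl)//; apply: limr_le; first by apply/cvg_ex; eexists; exact: cl.
near=> m.
have Nm : (N <= m)%N by near: m; exists N.
have E v : series v m = \sum_(k < N) v k + \sum_(N <= k < m) v k :> R.
  by rewrite /series/= (@big_cat_nat _ _ _ N)//= big_mkord.
rewrite E addrAC subrr add0r.
apply: (@le_trans _ _ (\sum_(N <= k < m) a k)).
  by apply: (le_trans (ler_norm_sum _ _ _)); apply: ler_sum => k _; exact: ua.
rewrite lerBrDl -E; apply: (nondecreasing_cvgn_le _ ca m).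
by apply/nondecreasing_seqP => i; rewrite /series/= big_nat_recr//= lerDl.
Unshelve. all: by end_near. Qed.

Lemma dominated_series_le u a : (forall k, `|u k| <= a k) -> cvgn (series a) ->
  `|limn (series u)| <= limn (series a).
Proof.
by move=> ua ca; have := dominated_series_tail 0 ua ca; rewrite !big_ord0 !subr0.
Qed.

Lemma series_tail_cvg0 a : cvgn (series a) ->
  (limn (series a) - \sum_(k < N) a k) @[N --> \oo] --> 0.
Proof.
move=> ca; rewrite -[X in _ --> X](subrr (limn (series a))); apply: cvgB; first exact: cvg_cst.
by under eq_fun do rewrite -(big_mkord xpredT).
Qed.

(** Dominated convergence for series, along an arbitrary proper filter: it serves both for points
    tending to a point of the closure of Omega and for times tending to 0. *)
Lemma tannery (T : Type) (X : set_system T) {PX : ProperFilter X}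
    (f : nat -> T -> R) l a :
  (forall k, f k x @[x --> X] --> l k) ->
  (\forall x \near X, forall k, `|f k x| <= a k) -> cvgn (series a) ->
  limn (series (f ^~ x)) @[x --> X] --> limn (series l).
Proof.
move=> fl fa ca.
have la k : `|l k| <= a k.
  have cn : `|f k x| @[x --> X] --> `|l k| by exact: cvg_norm.
  rewrite -(cvg_lim _ cn)//; apply: limr_le; first by apply/cvg_ex; eexists; exact: cn.
  by apply: filterS fa => x.
apply/cvgrPdist_le => e e0.
have e3 : 0 < e / 3 by rewrite divr_gt0.
have /cvgrPdist_le /(_ _ e3) [N _ HN] := series_tail_cvg0 ca.
have := HN N (leqnn N); rewrite sub0r normrN => {}HN.
have tail u : (forall k, `|u k| <= a k) -> `|limn (series u) - \sum_(k < N) u k| <= e / 3.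
  move=> ua; apply: (le_trans (dominated_series_tail N ua ca)).
  by apply: le_trans HN; exact: ler_norm.
have fin : (\sum_(k < N) f k x) @[x --> X] --> \sum_(k < N) l k.
  elim: N {HN tail} => [|N IH].
    by under eq_fun do rewrite big_ord0; rewrite big_ord0; exact: cvg_cst.
  under eq_fun do rewrite big_ord_recr; rewrite big_ord_recr/=.
  by apply: cvgD; [exact: IH|exact: fl].
move/cvgrPdist_le : fin => /(_ _ e3) fin.
apply: filterS2 fa fin => x fx finx.
have t1 := tail _ la; have t2 := tail _ fx.
rewrite (_ : _ - _ = (limn (series l) - \sum_(k < N) l k)
  + (\sum_(k < N) l k - \sum_(k < N) f k x)
  - (limn (series (f ^~ x)) - \sum_(k < N) f k x)); last by ring.
apply: (le_trans (ler_normB _ _)).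
rewrite (_ : e = e / 3 + e / 3 + e / 3); last by field.
by apply: lerD => //; apply: (le_trans (ler_normD _ _)); exact: lerD.
Qed.

End dominated_series.

(** * Passage from Omega to its closure *)

Section closure_facts.
Context {R : realType} {n : nat}.
Variable Omega : set 'rV[R]_n.

Lemma within_closure_proper z : closure Omega z -> ProperFilter (within Omega (nbhs z)).
Proof. by move=> cz; exact: within_nbhs_proper. Qed.

Lemma within_closure_cvg (f : 'rV[R]_n -> R) z : {within closure Omega, continuous f} ->
  closure Omega z -> f x @[x --> within Omega (nbhs z)] --> f z.
Proof.
move=> /subspace_continuousP cf cz; apply: cvg_trans (cf z cz).
by apply: cvg_app; apply: within_subset; exact: subset_closure.
Qed.

Lemma within_closure_le (f : 'rV[R]_n -> R) (c : R) :
  {within closure Omega, continuous f} ->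
  (forall x, Omega x -> f x <= c) -> forall z, closure Omega z -> f z <= c.
Proof.
move=> cf fc z cz; have fz := within_closure_cvg cf cz.
have PF := within_closure_proper cz.
rewrite -(cvg_lim _ fz)//; apply: limr_le; first by apply/cvg_ex; eexists; exact: fz.
by near=> x; apply: fc; near: x; exact: withinT.
Unshelve. all: by end_near. Qed.

End closure_facts.

(** * Fubini's theorem for real-valued integrals *)

Section fubini_Rintegral.
Context d1 d2 (X : measurableType d1) (Y : measurableType d2) (R : realType).
Variables (m1 : {sigma_finite_measure set X -> \bar R}) (m2 : {sigma_finite_measure set Y -> \bar R}).
Variable f : X * Y -> R.

Lemma measurable_Rintegral_snd : measurable_fun [set: X * Y] f ->
  measurable_fun [set: X] (fun x => \int[m2]_y f (x, y)).
Proof.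
move=> mf; have mEf : measurable_fun [set: X * Y] (EFin \o f) by exact/measurable_EFinP.
rewrite /Rintegral; apply: (measurableT_comp (f := fine)) => //.
rewrite (_ : (fun x => _) = (fun x => (\int[m2]_y (EFin \o f)^\+ (x, y) - \int[m2]_y (EFin \o f)^\- (x, y))%E)).
  apply: emeasurable_funB.
    by apply: (measurable_fun_fubini_tonelli_F (m2 := m2) (EFin \o f)^\+%E) => //; exact: measurable_funepos.
  by apply: (measurable_fun_fubini_tonelli_F (m2 := m2) (EFin \o f)^\-%E) => //; exact: measurable_funeneg.
apply/funext => x; rewrite integralE; congr (_ - _)%E; apply: eq_integral => y _.
- by rewrite !funeposE.
- by rewrite !funenegE.
Qed.

Hypothesis intf : (m1 \x m2)%E.-integrable setT (EFin \o f).

Lemma Rintegral12 : \int[m1]_x (\int[m2]_y f (x, y)) = \int[(m1 \x m2)%E]_p f p.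
Proof.
rewrite {3}/Rintegral -(integral12_prod_meas1 intf) {1}/Rintegral; congr fine.
apply: ae_eq_integral => //.
- apply/measurable_EFinP; apply: measurable_Rintegral_snd.
  by have /measurable_int/measurable_EFinP := intf.
- by have := integrable_fubini_F intf; exact: measurable_int.
have := ae_integrable1 intf; apply: filterS => x ix _.
by rewrite /Rintegral fineK//; exact: integrable_fin_num ix.
Qed.

End fubini_Rintegral.

Section fubini_Rintegral_swap.
Context d1 d2 (X : measurableType d1) (Y : measurableType d2) (R : realType).
Variables (m1 : {sigma_finite_measure set X -> \bar R}) (m2 : {sigma_finite_measure set Y -> \bar R}).
Variable f : X * Y -> R.

Lemma measurable_Rintegral_fst : measurable_fun [set: X * Y] f ->
  measurable_fun [set: Y] (fun y => \int[m1]_x f (x, y)).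
Proof.
move=> mf; apply: (@measurable_Rintegral_snd _ _ _ _ _ m1 (fun p => f (p.2, p.1))).
by apply: (measurableT_comp mf); exact: measurable_swap.
Qed.

Hypothesis intf : (m1 \x m2)%E.-integrable setT (EFin \o f).

Lemma Rintegral21 : \int[m2]_y (\int[m1]_x f (x, y)) = \int[(m1 \x m2)%E]_p f p.
Proof.
rewrite {3}/Rintegral -(integral21_prod_meas1 intf) {1}/Rintegral; congr fine.
apply: ae_eq_integral => //.
- apply/measurable_EFinP; apply: measurable_Rintegral_fst.
  by have /measurable_int/measurable_EFinP := intf.
- exact: measurable_fubini_G intf.
have := ae_integrable2 intf; apply: filterS => x ix _.
by rewrite /Rintegral fineK//; exact: integrable_fin_num ix.
Qed.

End fubini_Rintegral_swap.

(** * Integral operators from L^1 to a weighted L^1, and their adjoints *)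

Section kernel_duality.
Context d1 d2 (X : measurableType d1) (Y : measurableType d2) (R : realType).
Variables (m1 : {sigma_finite_measure set X -> \bar R}) (m2 : {sigma_finite_measure set Y -> \bar R}).
Variables (kappa : X * Y -> R) (omega : X -> R) (g : Y -> R) (C : R).
Hypothesis mk : measurable_fun [set: X * Y] kappa.
Hypothesis k0 : forall p, 0 <= kappa p.
Hypothesis mo : measurable_fun [set: X] omega.
Hypothesis o0 : forall x, 0 <= omega x.
Hypothesis C0 : 0 <= C.
Hypothesis kC : forall y, (\int[m1]_x (kappa (x, y) * omega x)%:E <= C%:E)%E.
Hypothesis ig : m2.-integrable setT (EFin \o g).

Definition kernel_op (x : X) : R := \int[m2]_y (kappa (x, y) * g y).

Let mg : measurable_fun setT g.
Proof. by have /measurable_int/measurable_EFinP := ig. Qed.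

Let mkg : measurable_fun [set: X * Y] (fun p => kappa p * g p.2).
Proof. by apply: measurable_funM => //; exact: measurableT_comp mg measurable_snd. Qed.

Let mog : measurable_fun [set: X * Y] (fun p => kappa p * g p.2 * omega p.1).
Proof. by apply: measurable_funM => //; exact: measurableT_comp mo measurable_fst. Qed.

Lemma kernel_op_measurable : measurable_fun [set: X] kernel_op.
Proof. exact: (measurable_Rintegral_snd m2 mkg). Qed.

(** Schur's test at exponent 1: by Tonelli it suffices to bound, for each y, the integral of the
    kernel against [omega], and this is [kC]. *)
Let norm_le : (\int[m2]_y \int[m1]_x `|kappa (x, y) * g y * omega x|%:E
  <= C%:E * \int[m2]_y `|g y|%:E)%E.
Proof.
have mag : measurable_fun setT (fun y => `|g y|%:E).
  by apply/measurable_EFinP; exact: measurableT_comp.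
rewrite -(ge0_integralZl _ measurableT)//.
apply: ge0_le_integral => //.
- by move=> y _; apply: integral_ge0 => x _; rewrite lee_fin.
- apply: (measurable_fun_fubini_tonelli_G (m1 := m1) (fun p => `|kappa p * g p.2 * omega p.1|%:E)) => //.
  by apply/measurable_EFinP; exact: measurableT_comp.
- by apply: emeasurable_funM.
move=> y _; rewrite (eq_integral (fun x => `|g y|%:E * (kappa (x, y) * omega x)%:E)%E); last first.
  move=> x _; rewrite -EFinM !normrM (ger0_norm (k0 _)) (ger0_norm (o0 _)); congr EFin.
  by rewrite mulrAC mulrC mulrA.
have msec : measurable_fun setT (fun x => (kappa (x, y) * omega x)%:E).
  apply/measurable_EFinP; apply: measurable_funM => //.
  by apply: (measurableT_comp mk); exact: measurable_pair2.
rewrite ge0_integralZl//; last by move=> x _; rewrite lee_fin mulr_ge0.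
by rewrite muleC; apply: lee_wpmul2r.
Qed.

Let Ig_lty : (C%:E * \int[m2]_y `|g y|%:E < +oo)%E.
Proof.
have /integrableP[_ goo] := ig.
rewrite lte_mul_pinfty//.
Qed.

Lemma kernel_op_norm : (\int[m1]_x (`|kernel_op x| * omega x)%:E
  <= C%:E * \int[m2]_y `|g y|%:E)%E.
Proof.
apply: le_trans norm_le.
rewrite -(fubini_tonelli (fun p => `|kappa p * g p.2 * omega p.1|%:E)) //; last first.
  by apply/measurable_EFinP; exact: measurableT_comp.
apply: ge0_le_integral => //.
- by move=> x _; rewrite lee_fin mulr_ge0.
- apply/measurable_EFinP; apply: measurable_funM => //.
  by apply: measurableT_comp => //; exact: kernel_op_measurable.
- apply: (measurable_fun_fubini_tonelli_F (m2 := m2) (fun p => `|kappa p * g p.2 * omega p.1|%:E)) => //.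
  by apply/measurable_EFinP; exact: measurableT_comp.
move=> x _; rewrite (eq_integral (fun y => (omega x)%:E * `|kappa (x, y) * g y|%:E)%E); last first.
  by move=> y _; rewrite -EFinM normrM (ger0_norm (o0 _)) mulrC.
have msec : measurable_fun setT (fun y => (kappa (x, y) * g y)).
  by apply: (measurableT_comp mkg); exact: measurable_pair1.
rewrite (ge0_integralZl _ measurableT)//; last 2 first.
- by apply/measurable_EFinP; exact: measurableT_comp.
- by rewrite lee_fin.
rewrite mulrC EFinM; apply: lee_wpmul2l; first by rewrite lee_fin.
rewrite /kernel_op /Rintegral.
apply: (@le_trans _ _ `|\int[m2]_y (kappa (x, y) * g y)%:E|%E).
  by case: (integral _ _ _) => [r||] /=; rewrite ?normr0 ?leey.
apply: le_trans (le_abse_integral _ measurableT _) _; first exact/measurable_EFinP.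
by apply: ge0_le_integral => //; try (apply/measurable_EFinP; exact: measurableT_comp).
Qed.

Let int_og : (m1 \x m2)%E.-integrable setT (EFin \o (fun p => kappa p * g p.2 * omega p.1)).
Proof.
apply/integrable21ltyP; first exact/measurable_EFinP.
exact: le_lt_trans norm_le Ig_lty.
Qed.

(** Fubini gives integrability of the section multiplied by omega(x), and a nonzero omega(x) can be
    divided out. *)
Lemma kernel_op_integrable :
  {ae m1, forall x, omega x != 0 -> m2.-integrable setT (EFin \o (fun y => kappa (x, y) * g y))}.
Proof.
have := ae_integrable1 int_og; apply: filterS => x ix ox.
have := integrableZl measurableT ((omega x)^-1) ix.
apply: eq_integrable => // y _; rewrite /= -EFinM; congr EFin.
by rewrite mulrC mulfK.
Qed.

Variables (psi : X -> R) (B : R).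
Hypothesis mpsi : measurable_fun [set: X] psi.
Hypothesis psiB : forall x, `|psi x| <= B * omega x.

Let int_psi : (m1 \x m2)%E.-integrable setT (EFin \o (fun p => kappa p * g p.2 * psi p.1)).
Proof.
apply: (le_integrable measurableT _ _ (integrableZl measurableT `|B| int_og)).
- apply/measurable_EFinP; apply: measurable_funM => //.
  exact: measurableT_comp mpsi measurable_fst.
move=> p _ /=; rewrite lee_fin !normrM normr_id mulrCA ler_wpM2l ?mulr_ge0//.
rewrite (ger0_norm (o0 _)); apply: (le_trans (psiB _)).
by rewrite ler_wpM2r// ler_norm.
Qed.

Let kernel_op_psi : {ae m1, forall x,
  kernel_op x * psi x = \int[m2]_y (kappa (x, y) * g y * psi x)}.
Proof.
have := kernel_op_integrable; apply: filterS => x ix.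
(* Where psi vanishes both sides are 0; elsewhere |psi| <= B omega makes omega nonzero and hence the
   section integrable. *)
have [px|px] := eqVneq (psi x) 0.
  by rewrite px mulr0; under eq_Rintegral do rewrite mulr0; rewrite Rintegral_cst// mul0r.
have ox : omega x != 0.
  apply: contra_neq px => ox; have := psiB x; rewrite ox mulr0 => h.
  by apply/eqP; rewrite -normr_le0.
by rewrite /kernel_op -(RintegralZr (psi x) measurableT (ix ox)).
Qed.

Lemma kernel_op_pairing_integrable : m1.-integrable setT (EFin \o (fun x => kernel_op x * psi x)).
Proof.
apply/integrableP; split.
  by apply/measurable_EFinP; apply: measurable_funM => //; exact: kernel_op_measurable.
apply: (@le_lt_trans _ _ (`|B|%:E * \int[m1]_x (`|kernel_op x| * omega x)%:E)%E).
  rewrite -(ge0_integralZl _ measurableT)//; last 2 first.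
  - apply/measurable_EFinP; apply: measurable_funM => //.
    by apply: measurableT_comp => //; exact: kernel_op_measurable.
  - by move=> x _; rewrite lee_fin mulr_ge0.
  apply: ge0_le_integral => //.
  - apply/measurable_EFinP; apply: measurableT_comp => //; apply: measurable_funM => //.
    exact: kernel_op_measurable.
  - apply: emeasurable_funM => //; apply/measurable_EFinP; apply: measurable_funM => //.
    by apply: measurableT_comp => //; exact: kernel_op_measurable.
  move=> x _; rewrite /= -EFinM lee_fin normrM mulrCA ler_wpM2l//.
  by apply: (le_trans (psiB _)); rewrite ler_wpM2r// ler_norm.
by rewrite lte_mul_pinfty//; exact: le_lt_trans kernel_op_norm Ig_lty.
Qed.

(** The operator is moved to its adjoint on test functions that are O(omega): this is the mechanism
    behind the weak-dual identity. *)
Lemma kernel_op_pairing :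
  \int[m1]_x (kernel_op x * psi x) = \int[m2]_y (g y * \int[m1]_x (kappa (x, y) * psi x)).
Proof.
transitivity (\int[m1]_x (\int[m2]_y (kappa (x, y) * g y * psi x))).
  rewrite /Rintegral; congr fine; apply: ae_eq_integral => //.
  - by have := kernel_op_pairing_integrable; exact: measurable_int.
  - apply/measurable_EFinP; apply: (measurable_Rintegral_snd m2 (f := fun p => kappa p * g p.2 * psi p.1)).
    apply: measurable_funM => //; exact: measurableT_comp mpsi measurable_fst.
  by have := kernel_op_psi; apply: filterS => x -> _.
rewrite (Rintegral12 int_psi) -(Rintegral21 int_psi).
apply: eq_Rintegral => y _ /=.
have msec : measurable_fun setT (fun x => kappa (x, y)).
  by apply: (measurableT_comp mk); exact: measurable_pair2.
rewrite -(RintegralZl (g y) measurableT).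
  by apply: eq_Rintegral => x _; rewrite mulrCA mulrA.
apply/integrableP; split; first by apply/measurable_EFinP; exact: measurable_funM.
apply: (@le_lt_trans _ _ (`|B|%:E * \int[m1]_x (kappa (x, y) * omega x)%:E)%E); last first.
  by rewrite lte_mul_pinfty//; exact: le_lt_trans (kC y) (ltry _).
rewrite -(ge0_integralZl _ measurableT)//; last 2 first.
- by apply/measurable_EFinP; exact: measurable_funM.
- by move=> x _; rewrite lee_fin mulr_ge0.
apply: ge0_le_integral => //.
- by apply/measurable_EFinP; apply: measurableT_comp => //; exact: measurable_funM.
- by apply: emeasurable_funM => //; apply/measurable_EFinP; exact: measurable_funM.
move=> x _; rewrite /= -EFinM lee_fin normrM (ger0_norm (k0 _)) mulrCA ler_wpM2l//.
by apply: (le_trans (psiB _)); rewrite ler_wpM2r// ler_norm.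
Qed.

End kernel_duality.

(** * Measure-preserving maps and reflection of time *)

Section measure_preserving.
Context d (X : measurableType d) (R : realType).
Variables (m : {measure set X -> \bar R}) (rho : X -> X).
Hypothesis mrho : measurable_fun [set: X] rho.
Hypothesis rhoE : forall A, measurable A -> m (rho @^-1` A) = m A.

Lemma ge0_integral_preserving (f : X -> \bar R) : measurable_fun [set: X] f ->
  (forall x, 0 <= f x)%E -> (\int[m]_x f (rho x) = \int[m]_x f x)%E.
Proof.
move=> mf f0; transitivity (\int[m]_(x in rho @^-1` setT) (f \o rho) x)%E.
  by rewrite preimage_setT.
rewrite -(ge0_integral_pushforward mrho m measurableT mf)//.
by apply: eq_measure_integral => A mA _; exact: rhoE.
Qed.

Lemma integral_preserving (f : X -> \bar R) : measurable_fun [set: X] f ->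
  (\int[m]_x f (rho x) = \int[m]_x f x)%E.
Proof.
move=> mf; rewrite integralE [RHS]integralE.
rewrite -(ge0_integral_preserving (measurable_funepos mf)) ?funepos_ge0//.
rewrite -(ge0_integral_preserving (measurable_funeneg mf)) ?funeneg_ge0//.
by congr (_ - _)%E; apply: eq_integral => x _; rewrite ?funeposE ?funenegE.
Qed.

Lemma integrable_preserving (f : X -> \bar R) : m.-integrable [set: X] f ->
  m.-integrable [set: X] (f \o rho).
Proof.
move=> /integrableP[mf foo]; apply/integrableP; split; first exact: measurableT_comp.
rewrite (ge0_integral_preserving (f := fun x => `|f x|%E))//.
exact: measurableT_comp.
Qed.

Lemma ae_preserving (P : X -> Prop) : {ae m, forall x, P x} -> {ae m, forall x, P (rho x)}.
Proof.
move=> [N [mN N0 PN]]; exists (rho @^-1` N); split.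
- by rewrite -[X in measurable X]setTI; exact: mrho.
- by rewrite rhoE.
- by move=> x /= Px; apply: PN.
Qed.

End measure_preserving.

Section time_reflection.
Context {R : realType}.
Variable T : R.
Local Notation leb1 := (@lebesgue_measure R).

Lemma measurable_reflection : measurable_fun [set: measurableTypeR R] (fun t : measurableTypeR R => T - t : measurableTypeR R).
Proof. by apply: measurable_funB; [exact: measurable_cst|exact: measurable_id]. Qed.

(** Uniqueness of Lebesgue measure reduces this to half-open intervals; the reflection exchanges the
    closed and the open end, which does not affect the length. *)
Lemma lebesgue_reflection (A : set (measurableTypeR R)) : measurable A ->
  leb1 [set t | A (T - t)] = leb1 A.
Proof.
move=> mA.
pose rho : {mfun measurableTypeR R >-> measurableTypeR R} :=
  HB.pack (fun t : measurableTypeR R => T - t : measurableTypeR R)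
  (isMeasurableFun.Build _ _ _ _ _ measurable_reflection).
apply/esym; apply: (@lebesgue_measure_unique _ (pushforward leb1 rho)) => // _ [[a b]] _ <-.
transitivity (leb1 `[T - b, T - a[%classic); last first.
  rewrite /pushforward; congr (leb1 _).
  apply/seteqP; split => t /=; rewrite !in_itv/= => /andP[h1 h2]; apply/andP; split; lra.
- rewrite !lebesgue_measure_itv/= !lte_fin ltrD2l ltrN2.
  by case: ifP => // _; rewrite -!EFinD; congr EFin; ring.
Qed.

Context d (Y : measurableType d) (m : {sigma_finite_measure set Y -> \bar R}).

Definition reflection (p : measurableTypeR R * Y) : measurableTypeR R * Y := (T - p.1, p.2).

Lemma measurable_reflection2 : measurable_fun setT reflection.
Proof.
apply/measurable_fun_pairP; split; last exact: measurable_snd.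
exact: measurableT_comp measurable_reflection measurable_fst.
Qed.

Lemma product_reflection A : measurable A ->
  (leb1 \x m)%E (reflection @^-1` A) = (leb1 \x m)%E A.
Proof.
move=> mA.
pose rho : {mfun (measurableTypeR R * Y)%type >-> (measurableTypeR R * Y)%type} :=
  HB.pack reflection (isMeasurableFun.Build _ _ _ _ _ measurable_reflection2).
apply/esym; apply: (@product_measure_unique _ _ _ _ _ leb1 m (pushforward (leb1 \x m)%E rho)) => // B D mB mD.
rewrite -[LHS]/((leb1 \x m)%E ([set t | B (T - t)] `*` D)).
rewrite product_measure1E//; last first.
  by rewrite -[X in measurable X]setTI; exact: measurable_reflection.
by congr (_ * _)%E; exact: lebesgue_reflection.
Qed.

End time_reflection.

(** * Sigma-finiteness of products and of restrictions to a support *)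

Section product_sigma_finite.
Context d1 d2 (X : measurableType d1) (Y : measurableType d2) (R : realType).
Variables (m1 : {sigma_finite_measure set X -> \bar R}) (m2 : {sigma_finite_measure set Y -> \bar R}).

Lemma sigma_finite_product : sigma_finite setT (m1 \x m2)%E.
Proof.
have /sigma_finiteP[S [TS ndS Soo]] := sigma_finiteT m1.
have /sigma_finiteP[U [TU ndU Uoo]] := sigma_finiteT m2.
exists (fun k => S k `*` U k).
  apply/seteqP; split => // -[x y] _.
  have [i _ Six] : (\bigcup_i S i) x by rewrite -TS.
  have [j _ Ujy] : (\bigcup_j U j) y by rewrite -TU.
  exists (maxn i j) => //; split => /=.
  - by move: x Six; exact/subsetPset/ndS/leq_maxl.
  - by move: y Ujy; exact/subsetPset/ndU/leq_maxr.
move=> k; have [mS Skoo] := Soo k; have [mU Ukoo] := Uoo k.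
split; first exact: measurableX.
by rewrite product_measure1E// lte_mul_pinfty// ge0_fin_numE.
Qed.

(** Space-time is itself one of the two factors when Fubini is applied against a space of sources,
    so its product measure has to be packaged as sigma-finite. *)
Definition product_sfmeasure : {sigma_finite_measure set (X * Y)%type -> \bar R} :=
  HB.pack (m1 \x m2)%E (Measure_isSigmaFinite.Build _ _ _ (m1 \x m2)%E sigma_finite_product).

End product_sigma_finite.

Section support_restriction.
Context d (Y : measurableType d) (R : realType).
Variables (m : {measure set Y -> \bar R}) (D : set Y) (mD : measurable D) (g : Y -> R).
Hypothesis ig : m.-integrable [set: Y] (EFin \o g).
Hypothesis Dg : forall y, D y -> g y != 0.

(** By Markov's inequality {|g| >= 1 / (k+1)} has finite measure, and these sets exhaust D because g
    does not vanish there. The measure m itself may fail to be sigma-finite, as surface measure on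
    an irregular boundary does. *)
Lemma support_sigma_finite : sigma_finite setT (mrestr m mD).
Proof.
have mg : measurable_fun setT g by have /measurable_int/measurable_EFinP := ig.
have mag : measurable_fun setT (fun y => `|g y|) by exact: measurableT_comp.
pose S k := [set y | k.+1%:R^-1 <= `|g y|].
have mS k : measurable (S k).
  rewrite -[S k]setTI (_ : S k = (fun y => `|g y|) @^-1` `[k.+1%:R^-1, +oo[%classic).
    exact: mag.
  by apply/seteqP; split => y /=; rewrite in_itv/= andbT.
(* The complement of D is null for the restricted measure; adding it makes the sets cover the whole
   space. *)
exists (fun k => S k `|` ~` D).
  apply/seteqP; split => // y _.
  have [Dy|Dy] := pselect (D y); last by exists 0%N => //; right.
  have gy : 0 < `|g y| by rewrite normr_gt0 Dg.
  exists (Num.truncn (`|g y|^-1)) => //; left => /=.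
  rewrite /S/= -[leRHS]invrK lef_pV2 ?posrE ?invr_gt0//.
  by apply/ltW/truncnS_gt.
move=> k; split; first by apply: measurableU => //; exact: measurableC.
have /integrableP[_ goo] := ig.
rewrite /mrestr; apply: le_lt_trans (_ : (k.+1%:R%:E * \int[m]_y `|g y|%:E < +oo)%E); last first.
  by rewrite lte_mul_pinfty// lee_fin.
rewrite -(ge0_integralZl _ measurableT)//; last exact/measurable_EFinP.
apply: (@le_trans _ _ (m (S k))).
  apply: le_measure; rewrite ?inE//.
    by apply: measurableI => //; apply: measurableU => //; exact: measurableC.
  by move=> y [[//|nDy] Dy].
rewrite -[leLHS]mul1e -(integral_cst m (mS k) 1).
rewrite (integral_mkcond (S k)).
apply: ge0_le_integral => //.
- by move=> y _; rewrite patchE; case: ifPn.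
- apply/(measurable_restrictT _ (mS k)); exact: measurable_cst.
- by apply: emeasurable_funM => //; exact/measurable_EFinP.
move=> y _; rewrite patchE; case: ifPn => [|_]; last by rewrite mule_ge0// lee_fin.
rewrite inE /S/= => h; rewrite -EFinM lee_fin.
by rewrite -ler_pdivrMl// mulr1.
Qed.

Definition support_restr : set Y -> \bar R := mrestr m mD.
HB.instance Definition _ := Measure.copy support_restr (mrestr m mD).
HB.instance Definition _ := Measure_isSigmaFinite.Build _ _ _ support_restr support_sigma_finite.

Definition support_measure : {sigma_finite_measure set Y -> \bar R} := support_restr.

Lemma integral_support (f : Y -> \bar R) : measurable_fun setT f -> (forall y, ~ D y -> f y = 0%E) ->
  (\int[support_measure]_y f y = \int[m]_y f y)%E.
Proof.
move=> mf fD; have fr : f = f \_ D.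
  apply/funext => y; rewrite patchE; case: ifPn => //; rewrite notin_setE; exact: fD.
rewrite fr -!integral_mkcond.
by apply: eq_measure_integral => A mA AD; rewrite -[LHS]/(m (A `&` D)) setIidl.
Qed.

End support_restriction.

Section sequential.
Context {R : realType} {n : nat}.

(** Dominated convergence is a statement on sequences, so continuity up to the boundary will be
    checked along sequences. If it fails at z, points at distance less than 1 / (k+1) give a
    sequence whose values stay e away from f z. *)
Lemma within_continuous_seq (A : set 'rV[R]_n) (f : 'rV[R]_n -> R) :
  (forall z (z_ : nat -> 'rV[R]_n), A z -> (forall k, A (z_ k)) -> z_ k @[k --> \oo] --> z ->
    f (z_ k) @[k --> \oo] --> f z) -> {within A, continuous f}.
Proof.
move=> H; apply/subspace_continuousP => z Az; apply: contrapT => nf.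
have [e e0 He] : exists2 e : R, 0 < e & forall r : R, 0 < r -> exists y,
    [/\ A y, ball z r y & e <= `|f z - f y|].
  apply: contrapT => nH; apply: nf; apply/cvgrPdist_lt => e e0.
  have [r r0 Hr] : exists2 r : R, 0 < r & forall y, A y -> ball z r y -> `|f z - f y| < e.
    apply: contrapT => nr; apply: nH; exists e => // r r0; apply: contrapT => ny.
    apply: nr; exists r => // y Ay zy; rewrite ltNge; apply/negP => h.
    by apply: ny; exists y.
  suff : nbhs z [set y | A y -> `|f z - f y| < e] by [].
  have zr : nbhs z (ball z r) by exact: nbhsx_ballx.
  by apply: filterS zr => y zy Ay; exact: Hr.
have [z_ Hz] := choice (fun k : nat => He k.+1%:R^-1 (ltac:(by rewrite invr_gt0) : 0 < k.+1%:R^-1 :> R)).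
have zz : z_ k @[k --> \oo] --> z.
  apply/cvg_ballP => r r0; near=> k; have [_ zk _] := Hz k.
  apply: le_ball zk; near: k; have := @near_infty_natSinv_lt R (PosNum r0).
  by apply: filterS => k /ltW.
have := H z z_ Az (fun k => let: And3 a _ _ := Hz k in a) zz.
move=> /cvgrPdist_lt /(_ _ e0) [N _ /(_ N (leqnn N))] /=.
by have [_ _] := Hz N; rewrite leNgt => /negP.
Unshelve. all: by end_near. Qed.

End sequential.

Lemma ae_product d1 d2 (X : measurableType d1) (Y : measurableType d2) (R : realType)
    (m1 : {sigma_finite_measure set X -> \bar R}) (m2 : {sigma_finite_measure set Y -> \bar R})
    (P : X * Y -> Prop) : {ae (m1 \x m2)%E, forall p, P p} ->
  {ae m1, forall x, {ae m2, forall y, P (x, y)}}.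
Proof.
move=> [N [mN N0 PN]].
have mx : measurable_fun setT (m2 \o xsection N) by exact: measurable_fun_xsection.
have I0 : (\int[m1]_x `|(m2 \o xsection N) x| = 0)%E.
  by rewrite -[RHS]N0; apply: eq_integral => x _; rewrite gee0_abs.
have := (ae_eq_integral_abs m1 measurableT mx).1 I0.
apply: filterS => x /(_ I) /= h; exists (xsection N x); split => //.
  exact: measurable_xsection.
by move=> y nP; rewrite /xsection/= inE; exact: PN.
Qed.

(** The properties of the eigenpairs that the heat semigroup requires, detached from the Green
    kernel. [F k] is phi k / w, extended continuously to the closure of Omega, and [M k] bounds it
    there. *)
Record spectral_setting (R : realType) (n : nat) (Omega : set 'rV[R]_n) (gamma : R)
    (lambda : nat -> R) (phi F : nat -> 'rV[R]_n -> R) (M : nat -> R) : Prop :=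
  SpectralSetting {
    dim_gt0 : (0 < n)%N;
    domainP : bounded_domain Omega;
    weight_exp_gt0 : 0 < gamma;
    eig_L2 : forall k, L2 Omega (phi k);
    eig_orthonormal : forall i j, inner Omega (phi i) (phi j) = (i == j)%:R;
    eig_complete : forall f, L2 Omega f -> L2_cvg Omega
      (fun N x => \sum_(k < N) inner Omega f (phi k) * phi k x) f;
    eig_value_gt0 : forall k, 0 < lambda 0 <= lambda k;
    eigE : forall k x, Omega x -> phi k x = delta Omega x `^ gamma * F k x;
    eig_cont : forall k, {within closure Omega, continuous (F k)};
    eig_le : forall k z, closure Omega z -> `|F k z| <= M k;
    eig_bound_ge1 : forall k, 1 <= M k;
    eig_summable : forall t, 0 < t ->
      cvgn (series (fun k => expR (- lambda k * t) * M k ^+ 2)) }.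

Lemma green_spectral_setting (R : realType) (n : nat) (s gamma : R)
    (Omega : set 'rV[R]_n) (G : 'rV[R]_n -> 'rV[R]_n -> \bar R)
    (lambda : nat -> R) (phi : nat -> 'rV[R]_n -> R) :
  0 < s -> 0 < gamma -> 2 * s < n%:R -> bounded_domain Omega ->
  nonneg_kernel Omega G -> kernel_estimate Omega gamma G s ->
  eigendecomposition Omega G lambda phi -> green_regular Omega gamma G ->
  exists F M, spectral_setting Omega gamma lambda phi F M.
Proof.
move=> s0 gamma0 sn bO G0 GE ED GR.
have n0 := dimension_gt0 s0 sn.
have [M [M1 phiM sumM]] := eigenfunction_growth s0 gamma0 sn bO G0 GE ED.
have l0 := lambda_gt0 ED.
have F_ k : {F : 'rV[R]_n -> R | {within closure Omega, continuous F} /\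
    forall x, Omega x -> phi k x = delta Omega x `^ gamma * F x}.
  apply: cid; have : Linf_weight Omega gamma (phi k).
    split; first exact: (phi_measurable ED).
    by exists (M k); apply: aeW => x; exact: phiM.
  (* [green_regular] factors G[phi k], that is phi k / lambda k; the factor of phi k itself is
     lambda k F. *)
  move=> /GR[F [cF HF]]; exists (fun x => lambda k * F x); split.
    move=> x; apply: cvgM; [exact: cvg_cst|exact: cF].
  move=> x Ox; have := HF x Ox; rewrite (green_phi ED)// => -[].
  by move=> h; rewrite mulrCA -h mulrA mulfV ?mul1r// gt_eqF.
pose F k := sval (F_ k).
have cF k : {within closure Omega, continuous (F k)} by case: (svalP (F_ k)).
have FE k x : Omega x -> phi k x = delta Omega x `^ gamma * F k x.
  by case: (svalP (F_ k)) => _; apply.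
exists F, M; split => //.
- exact: (phi_L2 ED).
- exact: (phi_on ED).
- by have [_ H _ _ _] := ED.
- by move=> k; rewrite l0/=; exact: (lambda_mono ED).
- move=> k; apply: within_closure_le.
    by move=> x; apply: cvg_norm; exact: cF.
  move=> x Ox; have wx : 0 < delta Omega x `^ gamma by exact: weight_gt0.
  have := phiM k x Ox; rewrite FE// normrM gtr0_norm// mulrC.
  by rewrite ler_pM2r.
Qed.

(** * Spectral series of the heat semigroup, up to the boundary *)

Section spectral_analysis.
Context {R : realType} {n : nat}.
Variables (Omega : set 'rV[R]_n) (gamma : R).
Variables (lambda : nat -> R) (phi F : nat -> 'rV[R]_n -> R) (M : nat -> R).
Hypothesis SS : spectral_setting Omega gamma lambda phi F M.
Local Notation leb := (lebesgue_rV n).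
Local Notation w x := (delta Omega x `^ gamma).
Local Notation E k t := (expR (- lambda k * t)).

Let n_gt0 := dim_gt0 SS.
Let bO := domainP SS.
Let gamma_gt0 := weight_exp_gt0 SS.
Let mO : measurable Omega. Proof. exact: domain_measurable. Qed.
Let cO : measurable (closure Omega).
Proof. by apply: closed_measurable_rV; exact: closed_closure. Qed.
Let mw : measurable_fun Omega (fun x => w x). Proof. exact: measurable_weight. Qed.
Let w0 x : 0 <= w x. Proof. exact: powR_ge0. Qed.
Let wp x : Omega x -> 0 < w x. Proof. exact: weight_gt0. Qed.
Let subO x : Omega x -> closure Omega x. Proof. exact: subset_closure. Qed.
Let M0 k : 0 <= M k. Proof. exact: le_trans (eig_bound_ge1 SS k). Qed.
Let E0 k t : 0 <= E k t. Proof. exact: expR_ge0. Qed.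
Let lam0 k : 0 < lambda k.
Proof. by have /andP[l0 /(lt_le_trans l0)] := eig_value_gt0 SS k. Qed.

Implicit Types (u v g : 'rV[R]_n -> R) (C K t : R) (x y z : 'rV[R]_n) (c d : nat -> R).

Section semigroup.

(** Bound for the heat kernel divided by both weights, finite for each t > 0 but with no control as
    t tends to 0. *)
Definition majorant t : R := limn (series (fun k => E k t * M k ^+ 2)).

(** The function with coefficients c, evolved for a time t and divided by w: with F in place of phi
    it makes sense on the whole closure of Omega. *)
Definition ser t (c : nat -> R) z : R := limn (series (fun k => E k t * c k * F k z)).

(** The growth that the summability of exp(- lambda k t) M k ^+ 2 tolerates. It is met by the
    coefficients of any u in L^1(w) and by the values F k z at a fixed z. *)
Definition coef_bounded K (c : nat -> R) := 0 <= K /\ forall k, `|c k| <= K * M k.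

Lemma term_le K c t z k : coef_bounded K c -> closure Omega z ->
  `|E k t * c k * F k z| <= K * (E k t * M k ^+ 2).
Proof.
move=> [K0 cK] cz; rewrite !normrM ger0_norm// expr2.
rewrite (_ : K * _ = E k t * (K * M k) * M k); last by ring.
apply: ler_pM; [exact: mulr_ge0|exact: normr_ge0| |exact: (eig_le SS)].
by rewrite ler_wpM2l.
Qed.

Lemma cvg_majorant t K : 0 < t -> cvgn (series (fun k => K * (E k t * M k ^+ 2))).
Proof. by move=> t0; apply: is_cvg_seriesZ; exact: (eig_summable SS). Qed.

Lemma lim_majorant t K : 0 < t ->
  limn (series (fun k => K * (E k t * M k ^+ 2))) = K * majorant t.
Proof. by move=> t0; apply: lim_seriesZ; exact: (eig_summable SS). Qed.

Lemma majorant_ge0 t : 0 < t -> 0 <= majorant t.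
Proof.
move=> t0; have := @nonneg_series_le R _ 0 _ (eig_summable SS t0).
by rewrite big_ord0; apply => k; rewrite mulr_ge0// sqr_ge0.
Qed.

Lemma ser_cvg K c t z : 0 < t -> coef_bounded K c -> closure Omega z ->
  cvgn (series (fun k => E k t * c k * F k z)).
Proof.
move=> t0 cK cz; have h k := term_le t k cK cz.

exact: (dominated_series_cvg h (cvg_majorant (K := K) t0)).
Qed.

Lemma ser_le K c t z : 0 < t -> coef_bounded K c -> closure Omega z ->
  `|ser t c z| <= K * majorant t.
Proof.
move=> t0 cK cz; rewrite -lim_majorant//.
have h k := term_le t k cK cz.
exact: dominated_series_le h (cvg_majorant (K := K) t0).
Qed.

Lemma ser_tail K c t z N : 0 < t -> coef_bounded K c -> closure Omega z ->
  `|ser t c z - \sum_(k < N) E k t * c k * F k z| <=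
  K * (majorant t - \sum_(k < N) E k t * M k ^+ 2).
Proof.
move=> t0 cK cz; rewrite mulrBr -lim_majorant// mulr_sumr.
have h k := term_le t k cK cz.
exact: dominated_series_tail h (cvg_majorant (K := K) t0).
Qed.

Lemma serB K K' c d t z : 0 < t -> coef_bounded K c -> coef_bounded K' d ->
  closure Omega z -> ser t (fun k => c k - d k) z = ser t c z - ser t d z.
Proof.
move=> t0 cK dK cz; rewrite /ser.
rewrite -limB; [|exact: ser_cvg t0 cK cz|exact: ser_cvg t0 dK cz].
congr (limn _); apply/funext => N; rewrite /series /= -[RHS]sumrB.
by apply: eq_bigr => k _; ring.
Qed.

Lemma ser_cont K c t : 0 < t -> coef_bounded K c ->
  {within closure Omega, continuous (ser t c)}.
Proof.
move=> t0 cK; apply/subspace_continuousP => z cz.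
have PF : ProperFilter (within (closure Omega) (nbhs z)).
  by apply: within_nbhs_proper; exact: subset_closure.
apply: (tannery _ _ (cvg_majorant (K := K) t0)).
  move=> k; apply: cvgM; first exact: cvg_cst.
  by have /subspace_continuousP := @eig_cont _ _ _ _ _ _ _ _ SS k; apply.
by near=> x => k; apply: term_le => //; near: x; exact: withinT.
Unshelve. all: by end_near. Qed.

Lemma ser_measurable K c t : 0 < t -> coef_bounded K c ->
  measurable_fun Omega (ser t c).
Proof.
move=> t0 cK; apply: (measurable_funS cO); first exact: subset_closure.
by apply: continuous_within_measurable_rV => //; exact: ser_cont cK.
Qed.

End semigroup.

(** * Coefficients of weighted integrable functions and the heat kernel *)

Section coefficients.

Definition weight_norm (u : 'rV[R]_n -> R) : R :=
  fine (\int[leb]_(x in Omega) (`|u x| * w x)%:E).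

Definition coef u k : R := inner Omega u (phi k).

Let mphi k : measurable_fun Omega (phi k).
Proof. by have [] := eig_L2 SS k. Qed.

Lemma eig_weight_le k x : Omega x -> `|phi k x| <= M k * w x.
Proof.
move=> Ox; rewrite (eigE SS)// normrM ger0_norm// mulrC.
by rewrite ler_wpM2r//; apply: (eig_le SS); exact: subO.
Qed.

Lemma L1_weight_prod u g C : L1_weight Omega gamma u -> measurable_fun Omega g ->
  0 <= C -> (forall x, Omega x -> `|g x| <= C * w x) ->
  leb.-integrable Omega (EFin \o (fun x => u x * g x)) /\
  (\int[leb]_(x in Omega) `|u x * g x|%:E <= (C * weight_norm u)%:E)%E.
Proof.
move=> [mu uoo] mg C0 gC.
have I0 : (0 <= \int[leb]_(x in Omega) (`|u x| * w x)%:E)%E.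
  by apply: integral_ge0 => x _; rewrite lee_fin mulr_ge0.
have muw : measurable_fun Omega (fun x => (`|u x| * w x)%:E).
  by apply/measurable_EFinP; apply: measurable_funM => //; exact: measurableT_comp.
have le : (\int[leb]_(x in Omega) `|u x * g x|%:E <= (C * weight_norm u)%:E)%E.
  rewrite EFinM /weight_norm fineK ?ge0_fin_numE//.
  rewrite -(ge0_integralZl _ mO); last 3 first.
  - exact: muw.
  - by move=> x _; rewrite lee_fin mulr_ge0.
  - by rewrite lee_fin.
  apply: (ge0_le_integral _ mO).
  - by move=> x _; rewrite lee_fin.
  - by apply/measurable_EFinP; apply: measurableT_comp => //; exact: measurable_funM.
  - by apply: emeasurable_funM.
  move=> x Ox; rewrite -EFinM lee_fin normrM mulrCA ler_wpM2l//; exact: gC.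
split=> //; apply/integrableP; split; first by apply/measurable_EFinP; exact: measurable_funM.
exact: (le_lt_trans le (ltry _)).
Qed.

Lemma weight_norm_ge0 u : 0 <= weight_norm u.
Proof. by apply: fine_ge0; apply: integral_ge0 => x _; rewrite lee_fin mulr_ge0. Qed.

Lemma inner_weight_le u g C : L1_weight Omega gamma u -> measurable_fun Omega g ->
  0 <= C -> (forall x, Omega x -> `|g x| <= C * w x) ->
  `|inner Omega u g| <= C * weight_norm u.
Proof.
move=> Lu mg C0 gC; have [ii le] := L1_weight_prod Lu mg C0 gC.
rewrite -lee_fin; apply: le_trans le.
rewrite /inner; apply: (@le_trans _ _ (\int[leb]_(x in Omega) `|u x * g x|)%:E).
  by rewrite lee_fin; exact: le_normr_Rintegral.
rewrite /Rintegral fineK//; apply: integrable_fin_num => //.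
have := integrable_abse ii; apply: eq_integrable => // x _.
Qed.

Lemma coef_le u : L1_weight Omega gamma u -> coef_bounded (weight_norm u) (coef u).
Proof.
move=> Lu; split=> [|k]; first exact: weight_norm_ge0.
by rewrite mulrC; apply: inner_weight_le => //; exact: eig_weight_le.
Qed.

Lemma innerB_L1 u v g C : L1_weight Omega gamma u -> L1_weight Omega gamma v ->
  measurable_fun Omega g -> 0 <= C -> (forall x, Omega x -> `|g x| <= C * w x) ->
  inner Omega (fun x => u x - v x) g = inner Omega u g - inner Omega v g.
Proof.
move=> Lu Lv mg C0 gC; have [iu _] := L1_weight_prod Lu mg C0 gC.
have [iv _] := L1_weight_prod Lv mg C0 gC.
by rewrite /inner -RintegralB//; apply: eq_Rintegral => x _; rewrite mulrBl.
Qed.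

Lemma ser_weight_le K c t x : 0 < t -> coef_bounded K c -> Omega x ->
  `|w x * ser t c x| <= K * majorant t * w x.
Proof.
move=> t0 cK Ox; rewrite normrM ger0_norm// mulrC ler_wpM2r//.
by apply: ser_le => //; exact: subO.
Qed.

Lemma ser_weight_measurable K c t : 0 < t -> coef_bounded K c ->
  measurable_fun Omega (fun x => w x * ser t c x).
Proof. by move=> t0 cK; apply: measurable_funM => //; exact: (ser_measurable t0 cK). Qed.

Let KM0 K c t : 0 < t -> coef_bounded K c -> 0 <= K * majorant t.
Proof. by move=> t0 [K0 _]; rewrite mulr_ge0// majorant_ge0. Qed.

Let sum_bound N c x : Omega x ->
  `|\sum_(k < N) c k * phi k x| <= (\sum_(k < N) `|c k| * M k) * w x.
Proof.
move=> Ox; rewrite mulr_suml; apply: (le_trans (ler_norm_sum _ _ _)).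
apply: ler_sum => k _; rewrite normrM -mulrA ler_wpM2l//; exact: eig_weight_le.
Qed.

Let sum_bound_ge0 N c : 0 <= \sum_(k < N) `|c k| * M k.
Proof. by apply: sumr_ge0 => k _; rewrite mulr_ge0. Qed.

Lemma inner_sum_L1 N c g : L1_weight Omega gamma g ->
  inner Omega g (fun x => \sum_(k < N) c k * phi k x) = \sum_(k < N) c k * coef g k.
Proof.
move=> Lg; have mS m : measurable_fun Omega (fun x => \sum_(k < m) c k * phi k x).
  by apply: measurable_sum => k; exact: measurable_funM.
have iphi k : leb.-integrable Omega (EFin \o (fun x => g x * phi k x)).
  by have [] := L1_weight_prod Lg (mphi k) (M0 k) (@eig_weight_le k).
elim: N => [|N IH].
  rewrite big_ord0 /inner (_ : \int[_]_(x in _) _ = \int[leb]_(x in Omega) 0).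
    by rewrite Rintegral_cst// mul0r.
  by apply: eq_Rintegral => x _; rewrite big_ord0 mulr0.
have [iS _] := L1_weight_prod Lg (mS N) (sum_bound_ge0 N c) (@sum_bound N c).
rewrite big_ord_recr/= -IH /coef /inner -RintegralZl// -RintegralD//.
  by apply: eq_Rintegral => x _; rewrite big_ord_recr/= mulrDr mulrCA.
by have := integrableZl mO (c N) (iphi N); apply: eq_integrable.
Qed.

(** The remainder of the series is at most w times a tail of [majorant], uniformly on Omega, so the
    sum and the integral against g in L^1(w) may be exchanged. *)
Lemma inner_ser K c t g : 0 < t -> coef_bounded K c -> L1_weight Omega gamma g ->
  series (fun k => E k t * c k * coef g k) N @[N --> \oo] -->
  inner Omega g (fun y => w y * ser t c y).
Proof.
move=> t0 cK Lg; have [mg _] := Lg.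
have wS := ser_weight_measurable t0 cK.
have tail N x : Omega x -> `|w x * ser t c x - \sum_(k < N) (E k t * c k) * phi k x| <=
    K * (majorant t - \sum_(k < N) E k t * M k ^+ 2) * w x.
  move=> Ox; rewrite (eq_bigr (fun k : 'I_N => w x * (E k t * c k * F k x))); last first.
    by move=> k _; rewrite (eigE SS)// mulrCA.
  rewrite -mulr_sumr -mulrBr normrM ger0_norm// mulrC ler_wpM2r//.
  by apply: ser_tail => //; exact: subO.
have tail0 N : 0 <= K * (majorant t - \sum_(k < N) E k t * M k ^+ 2).
  case: cK => K0 _; rewrite mulr_ge0// subr_ge0.
  apply: nonneg_series_le; last exact: (eig_summable SS).
  by move=> k; rewrite mulr_ge0// sqr_ge0.
have mS N : measurable_fun Omega (fun x => \sum_(k < N) (E k t * c k) * phi k x).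
  by apply: measurable_sum => k; exact: measurable_funM.
have bound N : `|inner Omega g (fun y => w y * ser t c y) -
    series (fun k => E k t * c k * coef g k) N| <=
    K * (majorant t - \sum_(k < N) E k t * M k ^+ 2) * weight_norm g.
  rewrite /series/= big_mkord -(inner_sum_L1 N (fun k => E k t * c k) Lg).
  have [is1 _] := L1_weight_prod Lg wS (KM0 t0 cK) (fun x => @ser_weight_le K c t x t0 cK).
  have [is2 _] := L1_weight_prod Lg (mS N) (sum_bound_ge0 N _) (sum_bound N (fun k => E k t * c k)).
  rewrite /inner -RintegralB//.
  rewrite (_ : \int[_]_(x in _) _ = inner Omega g (fun x => w x * ser t c x - \sum_(k < N) (E k t * c k) * phi k x)).
    apply: inner_weight_le => //; first by apply: measurable_funB.
    - exact: tail0.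
    - by move=> x Ox; exact: tail.
  by apply: eq_Rintegral => x _; rewrite mulrBr.
have h : K * (majorant t - \sum_(k < N) E k t * M k ^+ 2) * weight_norm g @[N --> \oo] --> 0.
  have l0 : K * 0 * weight_norm g = 0 by rewrite mulr0 mul0r.
  rewrite -[X in _ --> X]l0; apply: cvgM; last exact: cvg_cst.
  by apply: cvgM; [exact: cvg_cst|exact: series_tail_cvg0 (eig_summable SS t0)].
apply/cvgrPdist_le => e e0; move/cvgrPdist_le : h => /(_ _ e0); apply: filterS => N.
rewrite sub0r normrN => hN; apply: (le_trans (bound N)).
exact: le_trans (ler_norm _) hN.
Qed.

(** The factor N of the heat kernel w(x) w(y) N(t, x, y), as the spectral series whose coefficients
    are the values F k y. *)
Definition hker t z y : R := ser t (F^~ y) z.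

Lemma hker_sym t z y : hker t z y = hker t y z.
Proof.
by congr (limn (series _)); apply/funext => k; rewrite mulrAC.
Qed.

Lemma hker_coef z : closure Omega z -> coef_bounded 1 (F^~ z).
Proof. by move=> cz; split => // k; rewrite mul1r; exact: (eig_le SS). Qed.

Lemma ser_coefE t u z : 0 < t -> L1_weight Omega gamma u -> closure Omega z ->
  ser t (coef u) z = inner Omega u (fun y => w y * hker t z y).
Proof.
move=> t0 Lu cz; have h := inner_ser t0 (hker_coef cz) Lu.
transitivity (inner Omega u (fun y => w y * ser t (F^~ z) y)).
  rewrite -(cvg_lim _ h)//; congr (limn (series _)); apply/funext => k.
  by rewrite mulrAC.
by congr inner; apply/funext => y; rewrite -/(hker t y z) hker_sym.
Qed.

End coefficients.

(** * The semigroup on L^2 and its continuous representative *)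

Section heat_semigroup.

(** The lemmas reused here were proved for an order s with 0 < s and 2 s < n. No order is at hand in
    this setting, and 1/4 qualifies in every dimension n >= 1. *)
Let s4 : 0 < (4^-1 : R). Proof. by rewrite invr_gt0. Qed.
Let s4n : 2 * (4^-1 : R) < n%:R.
Proof.
have : (1 : R) <= n%:R by rewrite ler1n.
lra.
Qed.

Lemma weight_bounded_L2 u C : measurable_fun Omega u ->
  (forall x, Omega x -> `|u x| <= C * w x) -> L2 Omega u.
Proof. exact: (weighted_bounded_L2 s4 gamma_gt0 s4n bO). Qed.

Lemma L2_L1 u : L2 Omega u -> L1_weight Omega gamma u.
Proof. exact: (L2_L1_weight s4 gamma_gt0 s4n bO). Qed.

Lemma weight_bounded_L1 u C : measurable_fun Omega u ->
  (forall x, Omega x -> `|u x| <= C * w x) -> L1_weight Omega gamma u.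
Proof. by move=> mu uC; apply: L2_L1; exact: weight_bounded_L2 uC. Qed.

Lemma integral_le_cvg0 (h : 'rV[R]_n -> R) (a : nat -> \bar R) :
  measurable_fun Omega h -> (forall x, Omega x -> 0 <= h x) ->
  (forall k, (\int[leb]_(x in Omega) (h x)%:E <= a k)%E) -> a k @[k --> \oo] --> 0%E ->
  {ae leb, forall x, Omega x -> h x = 0}.
Proof.
move=> mh h0 ha a0.
have mh' : measurable_fun Omega (EFin \o h) by apply/measurable_EFinP.
have I0 : (\int[leb]_(x in Omega) `|(EFin \o h) x| = 0)%E.
  apply/eqP; rewrite eq_le integral_ge0// andbT.
  rewrite (eq_integral (fun x => (h x)%:E)); last first.
    by move=> x; rewrite inE => Ox; rewrite gee0_abs//= lee_fin h0.
  rewrite -(cvg_lim _ a0)//; apply: lime_ge; first by apply/cvg_ex; exists 0%E.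
  by apply: nearW => k; exact: ha.
have := (ae_eq_integral_abs leb mO mh').1 I0.
by apply: filterS => x H Ox; have := H Ox => -[].
Qed.

Lemma L2_cvg_unique (u_ : nat -> 'rV[R]_n -> R) u v : (forall k, measurable_fun Omega (u_ k)) ->
  measurable_fun Omega u -> measurable_fun Omega v ->
  L2_cvg Omega u_ u -> L2_cvg Omega u_ v -> {ae leb, forall x, Omega x -> u x = v x}.
Proof.
move=> mu_ mu mv uu uv.
pose a k : \bar R := (2%:E * (\int[leb]_(x in Omega) ((u_ k x - u x) ^+ 2)%:E +
   \int[leb]_(x in Omega) ((u_ k x - v x) ^+ 2)%:E))%E.
have a0 : a k @[k --> \oo] --> 0%E.
  rewrite (_ : 0%E = (2%:E * (0 + 0))%E); last by rewrite adde0 mule0.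
  by apply: cvgeZl => //; apply: cvgeD.
have m2 k (f : _ -> R) : measurable_fun Omega f -> measurable_fun Omega (fun x => ((u_ k x - f x) ^+ 2)%:E).
  by move=> mf; apply/measurable_EFinP; apply: measurable_funX; exact: measurable_funB.
have := @integral_le_cvg0 (fun x => (u x - v x) ^+ 2) a _ _ _ a0.
move=> H; have {}H := H _ (fun x _ => sqr_ge0 _) _.
apply: filterS (H _ _) => [x Hx Ox||k].
- by have /eqP := Hx Ox; rewrite sqrf_eq0 subr_eq0 => /eqP.
- by apply: measurable_funX; exact: measurable_funB.
rewrite /a -(ge0_integralD _ mO) //; [|by move=> x _; rewrite lee_fin sqr_ge0|exact: m2|by move=> x _; rewrite lee_fin sqr_ge0|exact: m2].
rewrite -(ge0_integralZl _ mO) //; last 2 first.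
- by apply: emeasurable_funD; exact: m2.
- by move=> x _; rewrite -EFinD lee_fin addr_ge0// sqr_ge0.
apply: (ge0_le_integral _ mO).
- by move=> x _; rewrite lee_fin sqr_ge0.
- by apply/measurable_EFinP; apply: measurable_funX; exact: measurable_funB.
- by apply: emeasurable_funM => //; apply: emeasurable_funD; exact: m2.
move=> x _; rewrite -EFinD -EFinM lee_fin.
by have := sqr_ge0 ((u_ k x - u x) + (u_ k x - v x)); nra.
Qed.

Lemma L1_weight_cvg_unique (u_ : nat -> 'rV[R]_n -> R) u v : (forall k, measurable_fun Omega (u_ k)) ->
  measurable_fun Omega u -> measurable_fun Omega v ->
  L1_weight_cvg Omega gamma u_ u -> L1_weight_cvg Omega gamma u_ v ->
  {ae leb, forall x, Omega x -> u x = v x}.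
Proof.
move=> mu_ mu mv uu uv.
pose a k : \bar R := (\int[leb]_(x in Omega) (`|u_ k x - u x| * w x)%:E +
   \int[leb]_(x in Omega) (`|u_ k x - v x| * w x)%:E)%E.
have a0 : a k @[k --> \oo] --> 0%E.
  rewrite (_ : 0%E = (0 + 0)%E); last by rewrite adde0.
  by apply: cvgeD.
have m2 k (f : _ -> R) : measurable_fun Omega f -> measurable_fun Omega (fun x => (`|u_ k x - f x| * w x)%:E).
  move=> mf; apply/measurable_EFinP; apply: measurable_funM => //.
  by apply: measurableT_comp => //; exact: measurable_funB.
have := @integral_le_cvg0 (fun x => `|u x - v x| * w x) a _ _ _ a0.
move=> H; have {}H := H _ (fun x _ => mulr_ge0 (normr_ge0 _) (w0 _)) _.
apply: filterS (H _ _) => [x Hx Ox||k].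
- have /eqP := Hx Ox; rewrite mulf_eq0 (gt_eqF (wp Ox)) orbF normr_eq0 subr_eq0.
  by move=> /eqP.
- apply: measurable_funM => //.
  by apply: measurableT_comp => //; exact: measurable_funB.
rewrite /a -(ge0_integralD _ mO) //; [|by move=> x _; rewrite lee_fin mulr_ge0|exact: m2|by move=> x _; rewrite lee_fin mulr_ge0|exact: m2].
apply: (ge0_le_integral _ mO).
- by move=> x _; rewrite lee_fin mulr_ge0.
- apply/measurable_EFinP; apply: measurable_funM => //.
  by apply: measurableT_comp => //; exact: measurable_funB.
- by apply: emeasurable_funD; exact: m2.
move=> x _; rewrite -EFinD lee_fin -mulrDl ler_wpM2r//.
by rewrite (distrC (u_ k x)); exact: ler_distD.
Qed.

Lemma continuous_ae_eq u v : (forall x, Omega x -> {for x, continuous u}) ->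
  (forall x, Omega x -> {for x, continuous v}) ->
  {ae leb, forall x, Omega x -> u x = v x} -> forall x, Omega x -> u x = v x.
Proof.
move=> cu cv [N [mN N0 uvN]] x Ox; apply: contrapT => /eqP uvx.
have oO : open Omega by case: bO.
have cd : u y - v y @[y --> x] --> u x - v x.
  have cu' : u y @[y --> x] --> u x := cu x Ox.
  have cv' : v y @[y --> x] --> v x := cv x Ox.
  exact: cvgB cu' cv'.
have : nbhs x [set y | u y - v y != 0].
  by apply: (cvgr_neq0 _ cd); rewrite subr_eq0.
rewrite nbhsE => -[U [oU Ux] UV].
have : (0 < leb (Omega `&` U))%E.
  by apply: (@lebesgue_open_gt0 _ _ _ x); [exact: openI|].
rewrite lt_neqAle => /andP[/eqP + _]; apply; apply/esym/eqP.
rewrite eq_le measure_ge0 andbT -N0; apply: le_measure; rewrite ?inE//.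
  by apply: open_measurable_rV; exact: openI.
move=> y [Oy Uy]; apply: uvN => /(_ Oy) /eqP; apply/negP.
by have := UV _ Uy; rewrite /= subr_eq0.
Qed.


Lemma L1_weightB u v : L1_weight Omega gamma u -> L1_weight Omega gamma v ->
  L1_weight Omega gamma (fun x => u x - v x).
Proof.
move=> [mu uoo] [mv voo]; split; first exact: measurable_funB.
have m2 (f : _ -> R) : measurable_fun Omega f -> measurable_fun Omega (fun x => (`|f x| * w x)%:E).
  move=> mf; apply/measurable_EFinP; apply: measurable_funM => //.
  exact: measurableT_comp.
apply: (@le_lt_trans _ _ (\int[leb]_(x in Omega) ((`|u x| * w x)%:E + (`|v x| * w x)%:E))%E).
  apply: (ge0_le_integral _ mO).
  - by move=> x _; rewrite lee_fin mulr_ge0.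
  - by apply: m2; exact: measurable_funB.
  - by apply: emeasurable_funD; exact: m2.
  by move=> x _; rewrite -EFinD lee_fin -mulrDl ler_wpM2r// ler_normB.
rewrite (ge0_integralD _ mO); first exact: lte_add_pinfty.
- by move=> x _; rewrite lee_fin mulr_ge0.
- exact: m2.
- by move=> x _; rewrite lee_fin mulr_ge0.
- exact: m2.
Qed.

Lemma coefB u v k : L1_weight Omega gamma u -> L1_weight Omega gamma v ->
  coef (fun x => u x - v x) k = coef u k - coef v k.
Proof.
move=> Lu Lv; have [mphi _] := eig_L2 SS k.
exact: (innerB_L1 Lu Lv mphi (M0 k) (@eig_weight_le k)).
Qed.

(** Candidate for S(t)u, given by one formula for all u in L^1(w) and continuous on Omega; [heatE]
    identifies it with [heat]. *)
Definition flow t u x : R := w x * ser t (coef u) x.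

Lemma flow_le t u x : 0 < t -> L1_weight Omega gamma u -> Omega x ->
  `|flow t u x| <= weight_norm u * majorant t * w x.
Proof. by move=> t0 Lu Ox; apply: ser_weight_le => //; exact: coef_le. Qed.

Lemma flow_measurable t u : 0 < t -> L1_weight Omega gamma u ->
  measurable_fun Omega (flow t u).
Proof. by move=> t0 Lu; apply: (ser_weight_measurable t0); exact: coef_le. Qed.

Lemma flow_L1 t u : 0 < t -> L1_weight Omega gamma u -> L1_weight Omega gamma (flow t u).
Proof.
move=> t0 Lu; apply: weight_bounded_L1; first exact: flow_measurable.
by move=> x; exact: flow_le.
Qed.

Lemma flow_L2 t u : 0 < t -> L1_weight Omega gamma u -> L2 Omega (flow t u).
Proof.
move=> t0 Lu; apply: weight_bounded_L2; first exact: flow_measurable.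
by move=> x; exact: flow_le.
Qed.

Lemma flowB t u v x : 0 < t -> L1_weight Omega gamma u -> L1_weight Omega gamma v -> Omega x ->
  flow t (fun x => u x - v x) x = flow t u x - flow t v x.
Proof.
move=> t0 Lu Lv Ox; rewrite /flow -mulrBr; congr (_ * _).
rewrite -(serB t0 (coef_le Lu) (coef_le Lv) (subO Ox)).
by congr (limn (series _)); apply/funext => k; rewrite coefB.
Qed.

Lemma flow_continuous t u x : 0 < t -> L1_weight Omega gamma u -> Omega x ->
  {for x, continuous (flow t u)}.
Proof.
move=> t0 Lu Ox; have oO : open Omega by case: bO.
have cw : w y @[y --> x] --> w x := continuous_weight n_gt0 bO Ox.
apply: (cvgM cw).
have /(within_closure_cvg)/(_ (subO Ox)) := ser_cont t0 (coef_le Lu).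
by rewrite within_interior//; exact: open_nbhs_nbhs.
Qed.

Lemma flow_cvg t u : 0 < t -> L2 Omega u ->
  L2_cvg Omega (fun N x => \sum_(k < N) E k t * inner Omega u (phi k) * phi k x) (flow t u).
Proof.
move=> t0 Lu; have Lu1 := L2_L1 Lu; have cK := coef_le Lu1.
set K := weight_norm u in cK.
pose r N := K * (majorant t - \sum_(k < N) E k t * M k ^+ 2).
have r0 N : 0 <= r N.
  case: cK => K0 _; rewrite mulr_ge0// subr_ge0.
  apply: nonneg_series_le; last exact: (eig_summable SS).
  by move=> k; rewrite mulr_ge0// sqr_ge0.
have Lw : L2 Omega (fun x => w x).
  by apply: (@weight_bounded_L2 _ 1) => // x Ox; rewrite mul1r ger0_norm.
pose V := \int[leb]_(x in Omega) (w x * w x).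
have rcvg : (r N ^+ 2 * V)%:E @[N --> \oo] --> 0%E.
  apply/fine_cvgP; split; first exact: nearW.
  have l0 : (K * 0) ^+ 2 * V = 0 by rewrite mulr0 expr0n mul0r.
  rewrite -[X in _ --> X]l0; apply: cvgM; last exact: cvg_cst.
  have rl : r N @[N --> \oo] --> K * 0.
    by apply: cvgM; [exact: cvg_cst|exact: series_tail_cvg0 (eig_summable SS t0)].
  by rewrite expr2; apply: cvgM; exact: rl.
apply: (squeeze_cvge _ (cvg_cst 0%E) rcvg).
apply: nearW => N; apply/andP; split.
  by apply: integral_ge0 => x _; rewrite lee_fin sqr_ge0.
have mS : measurable_fun Omega (fun x => \sum_(k < N) E k t * inner Omega u (phi k) * phi k x).
  by apply: measurable_sum => k; apply: measurable_funM => //; have [] := eig_L2 SS k.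
rewrite EFinM -(integral_sqr_inner mO Lw) -(ge0_integralZl _ mO); last 3 first.
- by apply/measurable_EFinP; exact: measurable_funX.
- by move=> x _; rewrite lee_fin sqr_ge0.
- by rewrite lee_fin sqr_ge0.
apply: (ge0_le_integral _ mO).
- by move=> x _; rewrite lee_fin sqr_ge0.
- apply/measurable_EFinP; apply: measurable_funX; apply: measurable_funB => //.
  exact: flow_measurable.
- by apply: emeasurable_funM => //; apply/measurable_EFinP; exact: measurable_funX.
move=> x Ox; rewrite -EFinM lee_fin -exprMn -[X in X <= _](real_normK (num_real _)).
have wx := w0 x; have rN := r0 N.
apply: lerXn2r; rewrite ?nnegrE ?normr_ge0//; first exact: mulr_ge0.
rewrite (eq_bigr (fun k : 'I_N => w x * (E k t * coef u k * F k x))); last first.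
  by move=> k _; rewrite (eigE SS)// mulrCA.
rewrite /flow -mulr_sumr -mulrBr normrM ger0_norm// mulrC ler_wpM2r// distrC.
by apply: ser_tail => //; exact: subO.
Qed.

Lemma flow_heat_L2 t u : 0 < t -> L2 Omega u -> heat_L2 Omega lambda phi t u (flow t u).
Proof. by move=> t0 Lu; split; [exact: flow_L2 (L2_L1 Lu)|exact: flow_cvg]. Qed.

Lemma heat_L2_unique t u v v' : heat_L2 Omega lambda phi t u v ->
  heat_L2 Omega lambda phi t u v' -> {ae leb, forall x, Omega x -> v x = v' x}.
Proof.
move=> [[mv _] uv] [[mv' _] uv']; apply: L2_cvg_unique uv uv' => // N.
by apply: measurable_sum => k; apply: measurable_funM => //; have [] := eig_L2 SS k.
Qed.

End heat_semigroup.

(** * Identification of the extended semigroup and of the heat kernel *)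

Section heat_representation.

(** Truncation to [-c, c]. It approximates data in L^1(w) by bounded data, which lie in L^2, and
    later turns a bound valid almost everywhere into one valid everywhere. *)
Definition clamp (c a : R) : R := Num.max (- c) (Num.min c a).

Lemma clamp_le (c a : R) : 0 <= c -> `|clamp c a| <= c.
Proof. by move=> c0; rewrite /clamp ler_norml; case: (leP c a) => ?; [case: (leP (- c) c)|case: (leP (- c) a)] => ?; lra. Qed.

Lemma clamp_dist (c a : R) : 0 <= c -> `|clamp c a - a| <= `|a|.
Proof.
move=> c0; rewrite /clamp; have [a0|a0] := leP 0 a.
  by rewrite (ger0_norm a0) ler_norml; case: (leP c a) => ?; [case: (leP (- c) c)|case: (leP (- c) a)] => ?; lra.
by rewrite (ltr0_norm a0) ler_norml; case: (leP c a) => ?; [case: (leP (- c) c)|case: (leP (- c) a)] => ?; lra.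
Qed.

Lemma clamp_id (c a : R) : `|a| <= c -> clamp c a = a.
Proof. by rewrite ler_norml /clamp => /andP[? ?]; case: (leP c a) => ?; [case: (leP (- c) c)|case: (leP (- c) a)] => ?; lra. Qed.

Lemma clamp_measurable (disp : measure_display) (S : measurableType disp) (D : set S) (c : R) (f : S -> R) : measurable_fun D f ->
  measurable_fun D (fun p : S => clamp c (f p)).
Proof.
move=> mf; apply: measurable_maxr; first exact: measurable_cst.
by apply: measurable_minr => //; exact: measurable_cst.
Qed.

Lemma clamp_L2 (c : R) u : 0 <= c -> measurable_fun Omega u -> L2 Omega (fun x => clamp c (u x)).
Proof.
move=> c0 mu; apply: (@bounded_L2 _ _ _ bO _ c); first exact: clamp_measurable.
by move=> x _; exact: clamp_le.
Qed.

Lemma clamp_cvg u : L1_weight Omega gamma u ->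
  L1_weight_cvg Omega gamma (fun k x => clamp k%:R (u x)) u.
Proof.
move=> [mu uoo].
have m2 (f : _ -> R) : measurable_fun Omega f -> measurable_fun Omega (fun x => (`|f x| * w x)%:E).
  move=> mf; apply/measurable_EFinP; apply: measurable_funM => //.
  exact: measurableT_comp.
rewrite /L1_weight_cvg (_ : 0%E = (\int[leb]_(x in Omega) 0)%E); last by rewrite integral0.
apply: (dominated_cvg mO (g := fun x => (`|u x| * w x)%:E)) => //.
- move=> k; apply: m2; apply: measurable_funB => //; exact: clamp_measurable.
- move=> x Ox; apply: cvg_near_cst.
  near=> k; rewrite clamp_id ?subrr ?normr0 ?mul0r//.
  by near: k; exact: nbhs_infty_ger.
- apply/integrableP; split; first exact: m2.
  by under eq_integral do rewrite /= ger0_norm ?mulr_ge0//.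
move=> k x Ox; rewrite /= lee_fin ger0_norm ?mulr_ge0//.
by rewrite ler_wpM2r//; exact: clamp_dist.
Unshelve. all: by end_near. Qed.

Lemma weight_norm_cvg (u_ : nat -> 'rV[R]_n -> R) u : L1_weight_cvg Omega gamma u_ u ->
  weight_norm (fun x => u_ k x - u x) @[k --> \oo] --> 0.
Proof. by move=> /fine_cvgP[_]; apply: cvg_trans. Qed.

Lemma flow_L1_cvg t (u_ : nat -> 'rV[R]_n -> R) u : 0 < t -> (forall k, L1_weight Omega gamma (u_ k)) ->
  L1_weight Omega gamma u -> L1_weight_cvg Omega gamma u_ u ->
  L1_weight_cvg Omega gamma (fun k => flow t (u_ k)) (flow t u).
Proof.
move=> t0 Lu_ Lu uu; have wn := weight_norm_cvg uu.
pose V := \int[leb]_(x in Omega) (w x * w x).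
have Lw : L2 Omega (fun x => w x).
  by apply: (weight_bounded_L2 (C := 1)) => // x Ox; rewrite mul1r ger0_norm.
have mj0 := majorant_ge0 t0.
pose c k := weight_norm (fun x => u_ k x - u x) * majorant t.
have rcvg : (c k * V)%:E @[k --> \oo] --> 0%E.
  apply/fine_cvgP; split; first exact: nearW.
  have l0 : 0 * majorant t * V = 0 by rewrite !mul0r.
  rewrite -[X in _ --> X]l0; apply: cvgM; last exact: cvg_cst.
  by apply: cvgM => //; exact: cvg_cst.
have m2 (f : _ -> R) : measurable_fun Omega f -> measurable_fun Omega (fun x => (`|f x| * w x)%:E).
  move=> mf; apply/measurable_EFinP; apply: measurable_funM => //.
  exact: measurableT_comp.
apply: (squeeze_cvge _ (cvg_cst 0%E) rcvg).
apply: nearW => k; apply/andP; split.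
  by apply: integral_ge0 => x _; rewrite lee_fin mulr_ge0.
have LB := L1_weightB (Lu_ k) Lu.
have c0 : 0 <= c k by rewrite /c mulr_ge0// weight_norm_ge0.
rewrite EFinM -(integral_sqr_inner mO Lw) -(ge0_integralZl _ mO); last 3 first.
- by apply/measurable_EFinP; exact: measurable_funX.
- by move=> x _; rewrite lee_fin sqr_ge0.
- by rewrite lee_fin.
apply: (ge0_le_integral _ mO).
- by move=> x _; rewrite lee_fin mulr_ge0.
- by apply: m2; apply: measurable_funB; exact: flow_measurable.
- by apply: emeasurable_funM => //; apply/measurable_EFinP; exact: measurable_funX.
move=> x Ox; rewrite -EFinM lee_fin expr2 mulrA ler_wpM2r//.
rewrite -(flowB)//; exact: flow_le.
Qed.

Lemma flow_heat_L1 t u : 0 < t -> L1_weight Omega gamma u ->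
  heat_L1 Omega gamma lambda phi t u (flow t u).
Proof.
move=> t0 Lu; have [mu _] := Lu.
have L2c k : L2 Omega (fun x => clamp k%:R (u x)) by exact: clamp_L2.
split=> //; first exact: flow_L1.
exists (fun k x => clamp k%:R (u x)), (fun k => flow t (fun x => clamp k%:R (u x))).
split=> //; [exact: clamp_cvg|move=> k; exact: (flow_heat_L2)|].
by apply: flow_L1_cvg => //; [move=> k; exact: (L2_L1)|exact: clamp_cvg].
Qed.

(** Whatever sequences define v, each v_k equals the flow of u_k almost everywhere; these flows
    converge to that of u, and limits in L^1(w) are unique. *)
Lemma heat_L1_unique t u v : 0 < t -> heat_L1 Omega gamma lambda phi t u v ->
  {ae leb, forall x, Omega x -> v x = flow t u x}.
Proof.
move=> t0 [Lu [mv _] [u_ [v_ [Lu_ uu hv vv]]]].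
have Lu1 k := L2_L1 (Lu_ k).
have aev k := heat_L2_unique (hv k) (flow_heat_L2 t0 (Lu_ k)).
have mv_ k : measurable_fun Omega (v_ k) by have [[]] := hv k.
apply: (L1_weight_cvg_unique mv_ mv (flow_measurable t0 Lu) vv).
have := flow_L1_cvg t0 Lu1 Lu uu; apply: cvg_trans; apply: near_eq_cvg; apply: nearW => k.
have m2 (f : _ -> R) : measurable_fun Omega f -> measurable_fun Omega (fun x => (`|f x| * w x)%:E).
  move=> mf; apply/measurable_EFinP; apply: measurable_funM => //.
  exact: measurableT_comp.
have mf k' := flow_measurable t0 (Lu1 k').
have mfu := flow_measurable t0 Lu.
apply: (ae_eq_integral _ _ mO).
- by apply: m2; exact: measurable_funB (mf k) mfu.
- by apply: m2; exact: measurable_funB (mv_ k) mfu.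
by apply: filterS (aev k) => x H Ox; rewrite H.
Qed.

(** The set from which [xget] chooses is nonempty since the flow qualifies. Whatever is chosen
    agrees with the flow almost everywhere, and continuity makes this pointwise. *)
Lemma heatE t u x : 0 < t -> L1_weight Omega gamma u -> Omega x ->
  heat Omega gamma lambda phi t u x = flow t u x.
Proof.
move=> t0 Lu Ox; rewrite /heat; case: xgetP => [v vE [hv cv]|/(_ (flow t u))].
  apply: (continuous_ae_eq cv) Ox => [y Oy|]; first exact: flow_continuous.
  exact: heat_L1_unique.
by case; split; [exact: flow_heat_L1|move=> y Oy; exact: (flow_continuous)].
Qed.

Lemma heat_notin t u : ~ L1_weight Omega gamma u -> heat Omega gamma lambda phi t u = cst 0.
Proof. by move=> Lu; rewrite /heat; case: xgetP => // v _ [[]]. Qed.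

Lemma heat_kernelE t x y : 0 < t -> Omega x -> Omega y ->
  heat_kernel lambda phi t x y = w x * w y * hker t x y.
Proof.
move=> t0 Ox Oy; have := ser_cvg t0 (hker_coef (subO Oy)) (subO Ox).
move=> cv; apply: etrans (lim_seriesZ (w x * w y) cv).
congr (limn (series _)); apply/funext => k.
rewrite (eigE SS k Ox) (eigE SS k Oy) -[RHS]/(w x * w y * (E k t * F k y * F k x)).
by move: (w x) (w y) (E k t) (F k x) (F k y) => *; ring.
Qed.

Lemma normal_derivativeE (v V : 'rV[R]_n -> R) zeta : closure Omega zeta ->
  (forall x, Omega x -> v x = w x * V x) -> {within closure Omega, continuous V} ->
  normal_derivative Omega gamma v zeta = V zeta.
Proof.
move=> cz vV cV; apply: cvg_lim => //.
have PF : ProperFilter (within Omega (nbhs zeta)) by exact: within_closure_proper.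
have := within_closure_cvg cV cz; apply: cvg_trans; apply: near_eq_cvg.
apply: filterS (withinT _ _) => x Ox /=.
by rewrite vV// mulrAC mulfV ?mul1r// gt_eqF// wp.
Qed.

Lemma heat_kernel_normalE t zeta y : 0 < t -> closure Omega zeta -> Omega y ->
  heat_kernel_normal Omega gamma lambda phi t zeta y = w y * hker t zeta y.
Proof.
move=> t0 cz Oy.
have := @normal_derivativeE (heat_kernel lambda phi t ^~ y) (fun x => w y * hker t x y) zeta cz.
apply=> [x Ox|].
  by rewrite heat_kernelE// mulrA.
move=> x; apply: cvgM; first exact: cvg_cst.
exact: (ser_cont t0 (hker_coef (subO Oy))).
Qed.

End heat_representation.

Hypothesis SM : submarkovian Omega lambda phi.

(** * Positivity of the heat kernel *)

Section positivity.

Lemma continuous_ae_ge0 u : (forall x, Omega x -> {for x, continuous u}) ->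
  {ae leb, forall x, Omega x -> 0 <= u x} -> forall x, Omega x -> 0 <= u x.
Proof.
move=> cu au x Ox.
have : (fun y => `|u y| - u y) x = cst 0 x.
  apply: (continuous_ae_eq (u := fun y => `|u y| - u y) (v := cst 0) _ _ _ Ox) => [y Oy|y _|].
  - have c : u z @[z --> y] --> u y := cu y Oy.
    have c' : `|u z| @[z --> y] --> `|u y| by exact: cvg_norm c.
    exact: cvgB c' c.
  - exact: cst_continuous.
  by apply: filterS au => y uy Oy /=; rewrite ger0_norm ?subrr// uy.
by move=> /eqP; rewrite subr_eq0 => /eqP <-.
Qed.

Lemma hker_continuous t x y : 0 < t -> closure Omega x -> Omega y ->
  {for y, continuous (hker t x)}.
Proof.
move=> t0 cx Oy; have oO : open Omega by case: bO.
have := within_closure_cvg (ser_cont t0 (hker_coef cx)) (subO Oy).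
rewrite within_interior//; last exact: open_nbhs_nbhs.
rewrite (_ : ser t (F^~ x) = hker t x)//.
by apply/funext => z; rewrite [RHS]hker_sym.
Qed.

Lemma hker_measurable t x : 0 < t -> closure Omega x -> measurable_fun Omega (hker t x).
Proof.
move=> t0 cx; rewrite (_ : hker t x = ser t (F^~ x)).
  exact: (ser_measurable t0 (hker_coef cx)).
by apply/funext => z; rewrite [LHS]hker_sym.
Qed.

Lemma hker_le t x y : 0 < t -> closure Omega x -> closure Omega y ->
  `|hker t x y| <= majorant t.
Proof. by move=> t0 cx cy; rewrite -[leRHS]mul1r; apply: ser_le => //; exact: hker_coef. Qed.

(** The sub-Markov property is applied to the indicator u of the set where the kernel is negative:
    S(t)u is nonnegative, yet its value at x is w(x) times the integral of a nonpositive function.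
    So the negative part vanishes almost everywhere, and everywhere by continuity. *)
Let hker_ge0_dom t x y : 0 < t -> Omega x -> Omega y -> 0 <= hker t x y.
Proof.
move=> t0 Ox; pose u y : R := (hker t x y < 0)%R%:R.
have mh := hker_measurable t0 (subO Ox).
have mu : measurable_fun Omega u.
  apply: (measurableT_comp (f := fun b : bool => b%:R : R)) => //.
  by apply: measurable_fun_ltr.
have u01 z : 0 <= u z <= 1 by rewrite /u; case: (_ < _); rewrite ?lexx ?ler01.
have Lu2 : L2 Omega u.
  apply: (@bounded_L2 _ _ _ bO _ 1) => // z _; have /andP[? ?] := u01 z.
  by rewrite ger0_norm.
have Lu := L2_L1 Lu2.
have f0 : 0 <= flow t u x.
  apply: continuous_ae_ge0 Ox => [z Oz|]; first exact: flow_continuous.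
  have := SM (ltW t0) mu (aeW _ (fun z _ => u01 z)) (flow_heat_L2 t0 Lu2).
  by apply: filterS => z H Oz; have /andP[] := H Oz.
have s0 : 0 <= inner Omega u (fun y => w y * hker t x y).
  by move: f0; rewrite /flow (ser_coefE t0 Lu (subO Ox)) pmulr_rge0// wp.
have hle z : Omega z -> `|w z * hker t x z| <= majorant t * w z.
  move=> Oz; rewrite normrM ger0_norm// mulrC ler_wpM2r//.
  by apply: hker_le => //; exact: subO.
have mwh : measurable_fun Omega (fun z => w z * hker t x z) by exact: measurable_funM.
have [ii _] := L1_weight_prod Lu mwh (majorant_ge0 t0) hle.
have uE z : u z * (w z * hker t x z) = - (w z * ((`|hker t x z| - hker t x z) / 2)).
  rewrite /u; case: ltP => h /=.
    by rewrite (ltr0_norm h) mul1r -mulrN; congr (_ * _); field.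
  by rewrite (ger0_norm h) subrr !mul0r mulr0 oppr0.
have a0 : {ae leb, forall z, Omega z -> w z * ((`|hker t x z| - hker t x z) / 2) = 0}.
  apply: (integral_le_cvg0 (a := fun=> 0%E)) => //; last exact: cvg_cst.
  - apply: measurable_funM => //; apply: measurable_funM => //.
    by apply: measurable_funB => //; exact: measurableT_comp.
  - by move=> z Oz; rewrite mulr_ge0// divr_ge0// subr_ge0 ler_norm.
  move=> k.
  have -> : (\int[leb]_(z in Omega) (w z * ((`|hker t x z| - hker t x z) / 2))%:E =
     \int[leb]_(z in Omega) (- (u z * (w z * hker t x z))%:E))%E.
    by apply: eq_integral => z _; rewrite uE EFinN oppeK.
  rewrite integralN; last first.
    by apply: integrable_add_def.
  rewrite oppe_le0 -(@fineK _ (\int[leb]_(z in Omega) _)%E).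
    by rewrite lee_fin.
  exact: integrable_fin_num ii.
apply: continuous_ae_ge0 => [z Oz|]; first exact: hker_continuous (subO Ox) Oz.
apply: filterS a0 => z H Oz; have /eqP := H Oz.
rewrite mulf_eq0 (gt_eqF (wp Oz))/= mulf_eq0 invr_eq0 pnatr_eq0 orbF subr_eq0.
by move=> /eqP <-.
Qed.

Lemma hker_ge0 t z y : 0 < t -> closure Omega z -> Omega y -> 0 <= hker t z y.
Proof.
move=> t0 cz Oy; rewrite -oppr_le0.
apply: (within_closure_le (f := fun z => - hker t z y)) cz => [|x Ox].
  move=> x; apply: cvgN; exact: (ser_cont t0 (hker_coef (subO Oy))).
by rewrite oppr_le0; exact: hker_ge0_dom.
Qed.

Lemma ser_coef_ge0 t u z : 0 < t -> L1_weight Omega gamma u -> closure Omega z ->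
  (forall x, Omega x -> 0 <= u x) -> 0 <= ser t (coef u) z.
Proof.
move=> t0 Lu cz u0; rewrite (ser_coefE t0 Lu cz).
apply: Rintegral_ge0 => x Ox; apply: mulr_ge0; first exact: u0.
by apply: mulr_ge0 => //; exact: hker_ge0.
Qed.

End positivity.

(** * Monotonicity in time and behaviour at time 0 *)

Section contraction.

Let E_deriv k t : is_derive t 1 (fun t => E k t) (- lambda k * E k t).
Proof.
have h : is_derive t 1 (fun t => - lambda k * t) (- lambda k).
  have := @is_deriveZ _ _ _ id (- lambda k) t 1 1 (is_derive_id _ _).
  by move=> /is_derive_eq; apply; rewrite [LHS]mulr1.
have := is_derive1_comp (is_derive_expR (- lambda k * t)) h.
by move=> /is_derive_eq; apply; rewrite [LHS]mulrC.
Qed.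

Let partial_deriv N c z t : is_derive t 1
  (fun t => \sum_(k < N) E k t * (c k / lambda k) * F k z)
  (- \sum_(k < N) E k t * c k * F k z).
Proof.
have h (k : 'I_N) : is_derive t 1 (fun t => E k t * (c k / lambda k) * F k z)
    (- (E k t * c k * F k z)).
  rewrite (_ : (fun t => _) = (fun t => (c k / lambda k * F k z) * E k t)); last first.
    by apply/funext => r; ring.
  have := @is_deriveZ _ _ _ (fun t => E k t) (c k / lambda k * F k z) t 1 _ (E_deriv k t).
  move=> /is_derive_eq; apply; rewrite /GRing.scale/=.
  by have := lam0 k => lk; field; rewrite gt_eqF.
have -> : - \sum_(k < N) E k t * c k * F k z = \sum_(k < N) - (E k t * c k * F k z).
  by rewrite sumrN.
rewrite (_ : (fun t => _) = \sum_(k < N) (fun t => E k t * (c k / lambda k) * F k z)).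
  exact: is_derive_sum.
by apply/funext => r; rewrite fct_sumE.
Qed.

Lemma coef_bounded_div K c : coef_bounded K c ->
  coef_bounded (K / lambda 0) (fun k => c k / lambda k).
Proof.
move=> [K0 cK]; have l0 := lam0 0; split=> [|k]; first by rewrite divr_ge0// ltW.
have lk := lam0 k; have /andP[_ l0k] := eig_value_gt0 SS k.
rewrite normrM normfV (gtr0_norm lk) mulrAC.
apply: ler_pM => //; first by rewrite invr_ge0 ltW.
by rewrite lef_pV2 ?posrE.
Qed.

(* The time derivative of the first series is minus the second one. *)
Lemma ser_div_nonincreasing K c z t1 t2 : 0 < t1 -> t1 <= t2 -> coef_bounded K c ->
  closure Omega z -> (forall t, 0 < t -> 0 <= ser t c z) ->
  ser t2 (fun k => c k / lambda k) z <= ser t1 (fun k => c k / lambda k) z.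
Proof.
move=> t10; rewrite le_eqVlt => /orP[/eqP <- //|t12] cK cz c0.
have t20 := lt_trans t10 t12; have dK := coef_bounded_div cK.
pose r N := limn (series (fun k => K * (E k t1 * M k ^+ 2))) - \sum_(k < N) K * (E k t1 * M k ^+ 2).
have r0 : r N @[N --> \oo] --> 0 by exact: series_tail_cvg0 (cvg_majorant (K := K) t10).
pose f N t := \sum_(k < N) E k t * (c k / lambda k) * F k z.
(* The mean value theorem is applied to partial sums, so the series is never differentiated. At an
   intermediate time the derivative differs from minus a nonnegative sum by at most r N, because the
   dominating terms are largest at t1. *)
have fr N : f N t2 - f N t1 <= r N * (t2 - t1).
  have [||s] := @MVT R (f N) (fun t => - \sum_(k < N) E k t * c k * F k z) t1 t2 t12.
  - by move=> t _; exact: partial_deriv.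
  - apply: derivable_within_continuous => t _.
    by have [] := partial_deriv N c z t.
  rewrite in_itv/= => /andP[t1s st2] ->; rewrite ler_wpM2r ?subr_ge0 ?(ltW t12)//.
  have s0 := lt_trans t10 t1s.
  have hk k : `|E k s * c k * F k z| <= K * (E k t1 * M k ^+ 2).
    apply: (le_trans (term_le s k cK cz)); have [K0 _] := cK.
    rewrite ler_wpM2l// ler_wpM2r ?sqr_ge0// ler_expR.
    by rewrite !mulNr lerN2 ler_wpM2l ?(ltW (lam0 k))// ltW.
  have := dominated_series_tail N hk (cvg_majorant (K := K) t10).
  rewrite -/(ser s c z) -/(r N) ler_norml => /andP[_ h].
  have := c0 s s0; lra.
have f1 : f N t1 @[N --> \oo] --> ser t1 (fun k => c k / lambda k) z.
  have := ser_cvg t10 dK cz; rewrite /f.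
  by under [in X in _ -> X]eq_fun do rewrite -(big_mkord xpredT (fun k => E k t1 * (c k / lambda k) * F k z)).
have f2 : f N t2 @[N --> \oo] --> ser t2 (fun k => c k / lambda k) z.
  have := ser_cvg t20 dK cz; rewrite /f.
  by under [in X in _ -> X]eq_fun do rewrite -(big_mkord xpredT (fun k => E k t2 * (c k / lambda k) * F k z)).
rewrite -subr_le0.
have fB : f N t2 - f N t1 @[N --> \oo] --> ser t2 (fun k => c k / lambda k) z - ser t1 (fun k => c k / lambda k) z.
  by apply: cvgB; [exact: f2|exact: f1].
have rB : r N * (t2 - t1) @[N --> \oo] --> 0 * (t2 - t1).
  by apply: cvgM => //; exact: cvg_cst.
rewrite mul0r in rB; rewrite -(cvg_lim _ fB)// -(cvg_lim _ rB)//.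
apply: ler_lim; [by apply/cvg_ex; eexists; exact: fB|by apply/cvg_ex; eexists; exact: rB|].
by apply: nearW.
Qed.

Let sqr3 (a b c : R) : (a + b + c) ^+ 2 <= 3 * (a ^+ 2 + b ^+ 2 + c ^+ 2).
Proof. by have := sqr_ge0 (a - b); have := sqr_ge0 (b - c); have := sqr_ge0 (a - c); nra. Qed.

(** Partial sums of S(t)u and of u are inserted between the two; the outer differences vanish in the
    limit, and the middle one is computed by orthonormality. The factor 3 is that of (a + b + c)^2
    <= 3 (a^2 + b^2 + c^2). *)
Lemma flow_dist_le t u : 0 < t -> L2 Omega u ->
  (\int[leb]_(x in Omega) ((flow t u x - u x) ^+ 2)%:E <=
   (3 * limn (series (fun k => (1 - E k t) ^+ 2 * coef u k ^+ 2)))%:E)%E.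
Proof.
move=> t0 Lu; have Lf := flow_L2 t0 (L2_L1 Lu).
have on := eig_orthonormal SS; have LP := eig_L2 SS.
pose c := coef u.
pose S1 N x := \sum_(k < N) E k t * inner Omega u (phi k) * phi k x.
pose S2 N x := \sum_(k < N) inner Omega u (phi k) * phi k x.
have E1 k : 0 <= 1 - E k t <= 1.
  by rewrite subr_ge0 gerBl E0 andbT -expR0 ler_expR mulNr oppr_le0 mulr_ge0// ltW.
pose q k := (1 - E k t) ^+ 2 * c k ^+ 2.
have q0 k : 0 <= q k by rewrite mulr_ge0// sqr_ge0.
have cq : cvgn (series q).
  apply: (nonneg_series_cvg (B := inner Omega u u)) => // N.
  apply: le_trans (bessel mO LP on N Lu); apply: ler_sum => k _.
  rewrite -[leRHS]mul1r ler_wpM2r ?sqr_ge0//; have /andP[? ?] := E1 k.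
  by rewrite expr_le1.
have LS1 N : L2 Omega (S1 N) := L2_sum mO N (fun k => E k t * inner Omega u (phi k)) LP.
have LS2 N : L2 Omega (S2 N) := L2_sum mO N (fun k => inner Omega u (phi k)) LP.
have mdiff (f g : _ -> R) : L2 Omega f -> L2 Omega g ->
    measurable_fun Omega (fun x => ((f x - g x) ^+ 2)%:E).
  move=> [mf _] [mg _]; apply/measurable_EFinP; apply: measurable_funX.
  exact: measurable_funB.
have SS2 N : (\int[leb]_(x in Omega) ((S1 N x - S2 N x) ^+ 2)%:E <= (limn (series q))%:E)%E.
  rewrite (eq_integral (fun x => ((\sum_(k < N) ((E k t - 1) * c k) * phi k x) ^+ 2)%:E)); last first.
    move=> x _; congr ((_ ^+ 2)%:E); rewrite /S1 /S2 -sumrB; apply: eq_bigr => k _.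
    by rewrite /c /coef; ring.
  rewrite (norm_sum_phi mO LP on N (fun k => (E k t - 1) * c k)) lee_fin.
  rewrite (eq_bigr (fun k : 'I_N => q k)); first exact: nonneg_series_le.
  by move=> k _; rewrite /q; ring.
pose a N := (3%:E * (\int[leb]_(x in Omega) ((S1 N x - flow t u x) ^+ 2)%:E +
   (limn (series q))%:E + \int[leb]_(x in Omega) ((S2 N x - u x) ^+ 2)%:E))%E.
have al : a N @[N --> \oo] --> (3 * limn (series q))%:E.
  rewrite (_ : (3 * _)%:E = (3%:E * (0 + (limn (series q))%:E + 0))%E); last first.
    by rewrite add0e adde0 EFinM.
  apply: cvgeZl => //; apply: cvgeD => //; last exact: (eig_complete SS).
  apply: cvgeD => //; last exact: cvg_cst.
  exact: flow_cvg.
rewrite -(cvg_lim _ al)//; apply: lime_ge; first by apply/cvg_ex; eexists; exact: al.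
apply: nearW => N; rewrite /a.
apply: (@le_trans _ _ (3%:E * (\int[leb]_(x in Omega) ((S1 N x - flow t u x) ^+ 2)%:E +
   \int[leb]_(x in Omega) ((S1 N x - S2 N x) ^+ 2)%:E + \int[leb]_(x in Omega) ((S2 N x - u x) ^+ 2)%:E))%E); last first.
  by apply: lee_wpmul2l => //; apply: leeD => //; apply: leeD.
have sq (f g : _ -> R) x : (0 <= ((f x - g x) ^+ 2)%:E)%E by rewrite lee_fin sqr_ge0.
rewrite -(ge0_integralD _ mO); [|by move=> x _; exact: sq|exact: mdiff|by move=> x _; exact: sq|exact: mdiff].
rewrite -(ge0_integralD _ mO); last 4 first.
- by move=> x _; apply: adde_ge0; exact: sq.
- by apply: emeasurable_funD; exact: mdiff.
- by move=> x _; exact: sq.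
- exact: mdiff.
rewrite -(ge0_integralZl _ mO); last 3 first.
- by apply: emeasurable_funD; [apply: emeasurable_funD; exact: mdiff|exact: mdiff].
- by move=> x _; apply: adde_ge0; [apply: adde_ge0|]; exact: sq.
- by [].
apply: (ge0_le_integral _ mO).
- by move=> x _; exact: sq.
- exact: mdiff.
- apply: emeasurable_funM => //.
  by apply: emeasurable_funD; [apply: emeasurable_funD; exact: mdiff|exact: mdiff].
move=> x _; rewrite -!EFinD -EFinM lee_fin.
have -> : flow t u x - u x = - (S1 N x - flow t u x) + (S1 N x - S2 N x) + (S2 N x - u x) by ring.
by apply: (le_trans (sqr3 _ _ _)); rewrite sqrrN.
Qed.

(** Each factor 1 - exp(- lambda k t) lies in [0, 1] and tends to 0, so the series of [flow_dist_le]
    tends to 0 by [tannery]; it is dominated by the squared coefficients, summable by Bessel. *)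
Lemma flow_strong_cvg (t_ : R^nat) u : (forall j, 0 < t_ j) -> t_ j @[j --> \oo] --> 0 ->
  L2 Omega u -> L2_cvg Omega (fun j => flow (t_ j) u) u.
Proof.
move=> t0 tj Lu; have LP := eig_L2 SS; have on := eig_orthonormal SS.
pose c := coef u.
have E1 k j : 0 <= 1 - E k (t_ j) <= 1.
  by rewrite subr_ge0 gerBl E0 andbT -expR0 ler_expR mulNr oppr_le0 mulr_ge0// ltW.
have lim0 : limn (series (fun k => (1 - E k (t_ j)) ^+ 2 * c k ^+ 2)) @[j --> \oo] -->
    limn (series (fun k : nat => 0 : R)).
  apply: (tannery (a := fun k => c k ^+ 2)).
  - move=> k; have e1 : E k (t_ j) @[j --> \oo] --> (1 : R).
      rewrite -expR0 -[X in expR X](mulr0 (- lambda k)).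
      apply: continuous_cvg; first exact: continuous_expR.
      by apply: cvgM => //; exact: cvg_cst.
    have l0 : (1 - 1) ^+ 2 * c k ^+ 2 = 0 :> R by rewrite subrr expr0n mul0r.
    rewrite -[X in _ --> X]l0; apply: cvgM; last exact: cvg_cst.
    have d1 : 1 - E k (t_ j) @[j --> \oo] --> (1 - 1 : R) by apply: cvgB => //; exact: cvg_cst.
    by rewrite expr2; apply: cvgM; exact: d1.
  - apply: nearW => j k; rewrite ger0_norm; last by rewrite mulr_ge0// sqr_ge0.
    rewrite -[leRHS]mul1r ler_wpM2r ?sqr_ge0//; have /andP[? ?] := E1 k j.
    by rewrite expr_le1.
  - apply: (nonneg_series_cvg (B := inner Omega u u)) => [k|N]; first exact: sqr_ge0.
    exact: (bessel mO LP on N Lu).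
have z0 : limn (series (fun k : nat => 0 : R)) = 0.
  rewrite (_ : series _ = cst 0) ?lim_cst//; apply/funext => N.
  by rewrite /series/= big1.
rewrite z0 in lim0.
have l3 : (3 * limn (series (fun k => (1 - E k (t_ j)) ^+ 2 * c k ^+ 2)))%:E @[j --> \oo] --> 0%E.
  apply/fine_cvgP; split; first exact: nearW.
  have l0 : 3 * 0 = 0 :> R by rewrite mulr0.
  by rewrite -[X in _ --> X]l0; apply: cvgM => //; exact: cvg_cst.
apply: (squeeze_cvge _ (cvg_cst 0%E) l3).
apply: nearW => j; apply/andP; split; last exact: flow_dist_le.
by apply: integral_ge0 => x _; rewrite lee_fin sqr_ge0.
Qed.

End contraction.

(** * Uniform bound for the evolution of the weight *)

Section weight_bound.
Variables (s : R) (G : 'rV[R]_n -> 'rV[R]_n -> \bar R).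
Hypothesis s_gt0 : 0 < s.
Hypothesis sn : 2 * s < n%:R.
Hypothesis G0 : nonneg_kernel Omega G.
Hypothesis GE : kernel_estimate Omega gamma G s.
Hypothesis GO : green_L2_operator Omega G.
Hypothesis ED : eigendecomposition Omega G lambda phi.

Let Lw : L2 Omega (fun x => w x).
Proof. by apply: (weight_bounded_L2 (C := 1)) => // x Ox; rewrite mul1r ger0_norm. Qed.

Let W := fgreen Omega G (fun x => w x).

Let LW : L2 Omega W. Proof. by have [H _ _ _ _] := GO; exact: H. Qed.

Let inner_weight_gt0 : 0 < inner Omega (fun x => w x) (fun x => w x).
Proof.
have [_ _ [x Ox] _] := bO.
rewrite lt_neqAle Rintegral_ge0 ?andbT; last by move=> y _; rewrite mulr_ge0.
apply/eqP => I0.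
have : {ae leb, forall x, Omega x -> w x ^+ 2 = 0}.
  apply: (integral_le_cvg0 (a := fun=> 0%E)) => //; last exact: cvg_cst.
  - exact: measurable_funX.
  - by move=> y _; exact: sqr_ge0.
  by move=> _; rewrite (integral_sqr_inner mO Lw) -I0.
move=> H; have {}H : {ae leb, forall x, Omega x -> w x = cst 0 x}.
  by apply: filterS H => y H Oy; have /eqP := H Oy; rewrite sqrf_eq0 => /eqP.
have c0 y : Omega y -> {for y, continuous (cst 0 : 'rV[R]_n -> R)}.
  by move=> _; exact: cst_continuous.
have /eqP := continuous_ae_eq (fun y Oy => continuous_weight n_gt0 bO Oy) c0 H Ox.
by rewrite gt_eqF// wp.
Qed.

(** The lower bound is G(x, y) >= c w(x) w(y) integrated against w(y); the constant acquires the
    integral of w^2 as a factor, which is positive. *)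
Lemma green_weight_bounds : exists c C : R, [/\ 0 < c, 0 < C &
  forall x, Omega x -> c * w x <= W x <= C * w x].
Proof.
have [C0 [C0_gt0 nearC _]] := green_near_far s_gt0 gamma_gt0 sn bO G0 GE.
have [C C_gt0 HC] := green_weight_le s_gt0 sn bO C0_gt0 nearC.
have [c c_gt0 Hc] := green_lower s_gt0 gamma_gt0 sn bO GE.
exists (c * inner Omega (fun x => w x) (fun x => w x)), C; split => //.
  exact: mulr_gt0.
move=> x Ox; have mG : measurable_fun Omega (G x) by exact: measurable_green_l.
have Gw0 : (0 <= \int[leb]_(y in Omega) (G x y * (w y)%:E))%E.
  apply: integral_ge0 => y Oy; apply: mule_ge0; last by rewrite lee_fin.
  by have [H _] := G0; exact: H.
have Wfin : (W x)%:E = (\int[leb]_(y in Omega) (G x y * (w y)%:E))%E.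
  rewrite /W /fgreen fineK//; rewrite ge0_fin_numE//.
  exact: le_lt_trans (HC x Ox) (ltry _).
rewrite -!lee_fin Wfin HC// andbT.
rewrite mulrAC EFinM -(integral_sqr_inner mO Lw) -(ge0_integralZl _ mO); last 3 first.
- by apply/measurable_EFinP; exact: measurable_funX.
- by move=> y _; rewrite lee_fin sqr_ge0.
- by rewrite lee_fin mulr_ge0// ltW.
apply: (ae_ge0_le_integral mO).
- by move=> y _; rewrite -EFinM lee_fin mulr_ge0 ?sqr_ge0// mulr_ge0// ltW.
- by apply: emeasurable_funM => //; apply/measurable_EFinP; exact: measurable_funX.
- move=> y Oy; apply: mule_ge0; last by rewrite lee_fin.
  by have [H _] := G0; exact: H.
- by apply: emeasurable_funM => //; exact/measurable_EFinP.
apply: filterS (ae_neq_rV x n_gt0) => y yx Oy.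
rewrite expr2 -EFinM.
have -> : c * w x * (w y * w y) = c * (w x * w y) * w y by rewrite !mulrA.
rewrite EFinM; apply: lee_wpmul2r; first by rewrite lee_fin.
by apply: Hc => //; rewrite eq_sym.
Qed.

(** Self-adjointness moves the Green operator to phi k, where it is division by lambda k. This puts
    S(t)W into the form required by [ser_div_nonincreasing]. *)
Let coefW k : coef W k = coef (fun x => w x) k / lambda k.
Proof.
have [_ _ SA _ _] := GO; rewrite /coef (SA _ _ Lw (eig_L2 SS k)).
have -> : inner Omega (fun x => w x) (fgreen Omega G (phi k)) =
    inner Omega (fun x => w x) (fun x => (lambda k)^-1 * phi k x).
  by apply: eq_Rintegral => x; rewrite inE => Ox; rewrite /fgreen (green_phi ED).
rewrite innerC (innerZl mO)//; last exact: (eig_L2 SS).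
by rewrite mulrC innerC.
Qed.

Let Lw1 := L2_L1 Lw.
Let LW1 := L2_L1 LW.

Let serW_mono t1 t2 z : 0 < t1 -> t1 <= t2 -> closure Omega z ->
  ser t2 (coef W) z <= ser t1 (coef W) z.
Proof.
move=> t10 t12 cz; rewrite (_ : coef W = fun k => coef (fun x => w x) k / lambda k); last first.
  by apply/funext => k; exact: coefW.
apply: (ser_div_nonincreasing t10 t12 (coef_le Lw1) cz) => t t0.
by apply: (ser_coef_ge0 t0 Lw1 cz) => x _.
Qed.

(** S(t)W <= S(t_j)W for t_j = t / (j+1), and S(t_j)W tends to W in L^2; hence S(t)W <= W almost
    everywhere. With W <= C w and continuity the bound holds on Omega, then on its closure. *)
Let serW_le C t z : 0 < t -> (forall x, Omega x -> W x <= C * w x) ->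
  closure Omega z -> ser t (coef W) z <= C.
Proof.
move=> t0 WC; have [mW _] := LW.
apply: within_closure_le; first exact: (ser_cont t0 (coef_le LW1)).
have mf := flow_measurable t0 LW1.
have mfW : measurable_fun Omega (fun x => flow t W x - W x) by exact: measurable_funB mf mW.
have mabs : measurable_fun Omega (fun x => (`|flow t W x - W x| + (flow t W x - W x)) ^+ 2).
  by apply: measurable_funX; apply: measurable_funD => //; exact: measurableT_comp.
(* (|a| + a)^2 is 4 times the square of the positive part of a; it is compared with 4 (S(t_j)W -
   W)^2, whose integral tends to 0. *)
have ae1 : {ae leb, forall x, Omega x -> (`|flow t W x - W x| + (flow t W x - W x)) ^+ 2 = 0}.
  pose t_ j : R := t / j.+1%:R.
  have tj0 j : 0 < t_ j by rewrite divr_gt0.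
  have tjt j : t_ j <= t by rewrite ler_pdivrMr// ler_peMr ?(ltW t0)// ler1n.
  have tjcvg : t_ j @[j --> \oo] --> 0.
    have l0 : t * 0 = 0 by rewrite mulr0.
    rewrite -[X in _ --> X]l0; apply: cvgM; first exact: cvg_cst.
    exact: cvg_harmonic.
  have := flow_strong_cvg tj0 tjcvg LW.
  move=> /(cvgeZl (y := 4%:E) isT) /=; rewrite mule0 => cv.
  apply: (integral_le_cvg0 _ _ _ cv).
  - exact: mabs.
  - by move=> x _; exact: sqr_ge0.
  move=> j; have mfj := flow_measurable (tj0 j) LW1.
  rewrite -(ge0_integralZl _ mO); last 3 first.
  - by apply/measurable_EFinP; apply: measurable_funX; exact: measurable_funB.
  - by move=> x _; rewrite lee_fin sqr_ge0.
  - by [].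
  apply: (ge0_le_integral _ mO).
  - by move=> x _; rewrite lee_fin sqr_ge0.
  - exact/measurable_EFinP.
  - by apply: emeasurable_funM => //; apply/measurable_EFinP; apply: measurable_funX; exact: measurable_funB.
  move=> x Ox; rewrite -EFinM lee_fin.
  have : flow t W x <= flow (t_ j) W x.
    by rewrite /flow ler_wpM2l//; apply: serW_mono => //; exact: subO.
  move: (flow t W x) (flow (t_ j) W x) (W x) => a b c ab.
  have [ac|ca] := leP 0 (a - c); first by rewrite ger0_norm//; nra.
  by rewrite ltr0_norm// addNr expr0n/= mulr_ge0// sqr_ge0.
have ae2 : {ae leb, forall x, Omega x -> 0 <= C * w x - flow t W x}.
  apply: filterS ae1 => x H Ox; have /eqP := H Ox; rewrite sqrf_eq0 => /eqP h.
  have := WC x Ox; move: h; move: (flow t W x) (C * w x) (W x) => a b c h cb.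
  by have := ler_norm (a - c); have := normr_ge0 (a - c); lra.
move=> x Ox; have h : 0 <= C * w x - flow t W x.
  apply: (continuous_ae_ge0 (u := fun x => C * w x - flow t W x) _ ae2 Ox) => y Oy.
  have cw : w z @[z --> y] --> w y := continuous_weight n_gt0 bO Oy.
  have cf : flow t W z @[z --> y] --> flow t W y := flow_continuous t0 LW1 Oy.
  have c2 : C * w z @[z --> y] --> C * w y by exact: (cvgM (cvg_cst C) cw).
  have c3 : C * w z - flow t W z @[z --> y] --> C * w y - flow t W y.
    exact: cvgB c2 cf.
  exact: c3.
move: h; rewrite subr_ge0 /flow mulrC -subr_ge0 -mulrBl pmulr_lge0 ?wp//.
by rewrite subr_ge0.
Qed.

(** A positive kernel preserves order: c w <= W gives c S(t)w <= S(t)W <= C w, and after division by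
    w this reaches boundary points too. Hence the constant C / c. *)
Lemma ser_weight_bounded : exists2 C : R, 0 < C &
  forall t z, 0 < t -> closure Omega z -> ser t (coef (fun x => w x)) z <= C.
Proof.
have [c [C [c0 C0 HW]]] := green_weight_bounds.
exists (C / c) => [|t z t0 cz]; first by rewrite divr_gt0.
have WC x : Omega x -> W x <= C * w x by move=> /HW /andP[].
rewrite ler_pdivlMr// mulrC; apply: le_trans (serW_le t0 WC cz).
rewrite (ser_coefE t0 Lw1 cz) (ser_coefE t0 LW1 cz).
have mh := hker_measurable t0 cz.
have hle x : Omega x -> `|w x * hker t z x| <= majorant t * w x.
  move=> Ox; rewrite normrM ger0_norm// mulrC ler_wpM2r//.
  by apply: hker_le => //; exact: subO.
have mwh : measurable_fun Omega (fun x => w x * hker t z x) by exact: measurable_funM.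
have [iw _] := L1_weight_prod Lw1 mwh (majorant_ge0 t0) hle.
have [iW _] := L1_weight_prod LW1 mwh (majorant_ge0 t0) hle.
rewrite /inner -RintegralZl//; apply: le_Rintegral => //.
  by have := integrableZl mO c iw; apply: eq_integrable.
move=> x Ox; rewrite mulrA ler_wpM2r//; last by have /andP[] := HW x Ox.
by apply: mulr_ge0 => //; apply: hker_ge0.
Qed.

End weight_bound.

Variable C : R.
Hypothesis C_gt0 : 0 < C.
Hypothesis serC : forall t z, 0 < t -> closure Omega z -> ser t (coef (fun x => w x)) z <= C.
Variable T : R.
Hypothesis T_gt0 : 0 < T.
Let CT : 0 <= C * T. Proof. by rewrite mulr_ge0 ?ltW. Qed.

Local Notation leb1 := (@lebesgue_measure R).
Local Notation X := (measurableTypeR R * 'rV[R]_n)%type.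
Local Notation mu := (leb1 \x leb)%E.

(** * The kernel as a function of time, source point and observation point *)

Section heat_density.

Definition density_dom : set (measurableTypeR R * ('rV[R]_n * 'rV[R]_n)) :=
  [set t | 0 < t] `*` (closure Omega `*` Omega).

(** The kernel w(x) N(t, z, x) with source z in the closure of Omega and observation point x in
    Omega. Extension by 0 makes it jointly measurable on the whole space, and its vanishing for t <=
    0 keeps sources from acting before their time. *)
Definition density : measurableTypeR R * ('rV[R]_n * 'rV[R]_n) -> R :=
  (fun p => w p.2.2 * hker p.1 p.2.1 p.2.2) \_ density_dom.

Lemma density_dom_measurable : measurable density_dom.
Proof.
apply: measurableX; last exact: measurableX.
rewrite (_ : [set t | _] = `]0, +oo[%classic) //.
by apply/seteqP; split => t /=; rewrite in_itv/= andbT.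
Qed.

Lemma densityE t z x : 0 < t -> closure Omega z -> Omega x ->
  density (t, (z, x)) = w x * hker t z x.
Proof. by move=> t0 cz Ox; rewrite /density patchE mem_set. Qed.

Lemma density_out p : ~ density_dom p -> density p = 0.
Proof. by move=> np; rewrite /density patchE memNset. Qed.

Lemma density_ge0 p : 0 <= density p.
Proof.
have [dp|dp] := pselect (density_dom p); last by rewrite density_out.
case: p dp => t [z x] [/= t0 [/= cz Ox]]; rewrite densityE//.
by apply: mulr_ge0 => //; apply: hker_ge0.
Qed.

Lemma density_measurable : measurable_fun setT density.
Proof.
have mD := density_dom_measurable.
pose f k := F k \_ (closure Omega).
have mf k : measurable_fun setT (f k).
  apply/(measurable_restrictT _ cO); apply: continuous_within_measurable_rV => //.
  exact: (eig_cont SS).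
have mE k : measurable_fun setT (fun t : measurableTypeR R => E k t).
  apply: (measurableT_comp (f := expR)); first exact: measurable_expR.
  by apply: measurable_funM => //; exact: measurable_id.
apply/(measurable_restrictT _ mD); apply: measurable_funM.
  apply: measurable_funTS; apply: (measurableT_comp (measurable_weight gamma n_gt0 bO measurableT)).
  exact: measurableT_comp measurable_snd measurable_snd.
apply: (measurable_fun_cvg (h := fun N (p : measurableTypeR R * ('rV[R]_n * 'rV[R]_n)) =>
   \sum_(k < N) E k p.1 * f k p.2.2 * f k p.2.1)).
  move=> N; apply: measurable_funTS; apply: measurable_sum => k.
  apply: measurable_funM; first apply: measurable_funM.
  - exact: measurableT_comp (mE k) measurable_fst.
  - apply: (measurableT_comp (mf k)); exact: measurableT_comp measurable_snd measurable_snd.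
  - apply: (measurableT_comp (mf k)); exact: measurableT_comp measurable_fst measurable_snd.
move=> [t [z x]] [/= t0 [/= cz Ox]].
have := ser_cvg t0 (hker_coef (subO Ox)) cz.
apply: cvg_trans; apply: near_eq_cvg; apply: nearW => N.
rewrite /series/= big_mkord; apply: eq_bigr => k _.
by rewrite /f !patchE !mem_set//; exact: subO.
Qed.

Let Lw1 : L1_weight Omega gamma (fun x => w x).
Proof. by apply: (weight_bounded_L1 (C := 1)) => // x Ox; rewrite mul1r ger0_norm. Qed.

Lemma density_inner t z u : 0 < t -> closure Omega z ->
  \int[leb]_y ((u \_ Omega) y * density (t, (z, y))) =
  inner Omega u (fun y => w y * hker t z y).
Proof.
move=> t0 cz; rewrite /inner [RHS]Rintegral_mkcond; apply: eq_Rintegral => y _.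
rewrite !patchE; case: ifPn => [|Oy]; last by rewrite mul0r.
by rewrite inE => Oy; rewrite densityE.
Qed.

Lemma density_integrable t z u : 0 < t -> closure Omega z -> L1_weight Omega gamma u ->
  leb.-integrable setT (EFin \o (fun y => (u \_ Omega) y * density (t, (z, y)))).
Proof.
move=> t0 cz Lu.
have mh := hker_measurable t0 cz.
have hle x : Omega x -> `|w x * hker t z x| <= majorant t * w x.
  move=> Ox; rewrite normrM ger0_norm// mulrC ler_wpM2r//.
  by apply: hker_le => //; exact: subO.
have mwh : measurable_fun Omega (fun x => w x * hker t z x) by exact: measurable_funM.
have [iw _] := L1_weight_prod Lu mwh (majorant_ge0 t0) hle.
rewrite (_ : EFin \o _ = (EFin \o (fun y => u y * (w y * hker t z y))) \_ Omega).
  exact/(integrable_mkcond _ mO).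
apply/funext => y /=; rewrite !patchE; case: ifPn => [|Oy]; last by rewrite mul0r.
by rewrite inE => Oy; rewrite densityE.
Qed.

(** For t > 0 and z in the closure the integral is S(t)w / w at z, hence at most C by [serC];
    otherwise it is 0. *)
Lemma density_weight_le t z :
  (\int[leb]_y (density (t, (z, y)) * ((fun x => w x) \_ Omega) y)%:E <= C%:E)%E.
Proof.
have [[t0 cz]|nd] := pselect (0 < t /\ closure Omega z); last first.
  rewrite integral0_eq ?lee_fin ?ltW// => y _; rewrite density_out ?mul0r//.
  by move=> [/= t0 [/= cz _]]; apply: nd.
have ii := density_integrable t0 cz Lw1.
under eq_integral do rewrite mulrC.
rewrite -(@fineK _ (\int[leb]_y _)%E); last exact: integrable_fin_num ii.
rewrite lee_fin -[X in X <= _]/(\int[leb]_y (((fun x => w x) \_ Omega) y * density (t, (z, y)))).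
by rewrite density_inner// -(ser_coefE t0 Lw1 cz); exact: serC.
Qed.

End heat_density.

(** * Sources and potentials on the cylinder *)

Section heat_source.

Definition cylinder : set X := `]0, T[ `*` Omega.

Definition cyl_weight : X -> R := (fun p => w p.2) \_ cylinder.

Let mcyl : measurable cylinder. Proof. exact: measurableX. Qed.

Lemma cyl_weightE p : cylinder p -> cyl_weight p = w p.2.
Proof. by move=> cp; rewrite /cyl_weight patchE mem_set. Qed.

Lemma cyl_weight_out p : ~ cylinder p -> cyl_weight p = 0.
Proof. by move=> cp; rewrite /cyl_weight patchE memNset. Qed.

Lemma cyl_weight_ge0 p : 0 <= cyl_weight p.
Proof. by rewrite /cyl_weight patchE; case: ifP. Qed.

Lemma cyl_weight_measurable : measurable_fun setT cyl_weight.
Proof.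
apply/(measurable_restrictT _ mcyl); apply: measurable_funTS.
exact: measurableT_comp (measurable_weight gamma n_gt0 bO measurableT) measurable_snd.
Qed.

Lemma cyl_weight_le t x : cyl_weight (t, x) <= ((fun x => w x) \_ Omega) x.
Proof.
rewrite /cyl_weight !patchE; case: ifPn => [|_]; last by case: ifP.
by rewrite inE => -[/= _ Ox]; rewrite mem_set.
Qed.

Lemma cylinder_reflection p : cylinder (reflection T p) <-> cylinder p.
Proof.
case: p => t x; rewrite /cylinder/reflection/= !in_itv/=.
by split => -[/andP[h1 h2] ?]; split => //; apply/andP; split; lra.
Qed.

Lemma cyl_weight_reflection p : cyl_weight (reflection T p) = cyl_weight p.
Proof.
have [cp|cp] := pselect (cylinder p).
  by rewrite !cyl_weightE//; exact/cylinder_reflection.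
by rewrite !cyl_weight_out// => /cylinder_reflection.
Qed.

Lemma reflectionK p : reflection T (reflection T p) = p :> X.
Proof. by case: p => t x; rewrite /reflection/=; congr pair; rewrite opprB addrC subrK. Qed.

Section source.
Context dY (Y : measurableType dY) (s : Y -> R) (z : Y -> 'rV[R]_n).
Hypothesis ms : measurable_fun [set: Y] s.
Hypothesis mz : measurable_fun [set: Y] z.

(** Effect at (t, x) of a source at time s y and place z y. Initial data (s = 0, z = id), interior
    data (time and place in space-time) and boundary data (time and place on the lateral boundary)
    are its three instances. *)
Definition source_kernel (q : X * Y) : R :=
  \1_(`]0, T[%classic) q.1.1 * density (q.1.1 - s q.2, (z q.2, q.1.2)).

Lemma source_kernel_ge0 q : 0 <= source_kernel q.
Proof. by rewrite /source_kernel mulr_ge0// density_ge0. Qed.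

Lemma source_kernel_measurable : measurable_fun setT source_kernel.
Proof.
apply: measurable_funM.
  apply: (measurableT_comp (f := \1_(`]0, T[%classic) : measurableTypeR R -> R)).
    exact: measurable_indic.
  exact: measurableT_comp measurable_fst measurable_fst.
apply: (measurableT_comp density_measurable).
apply/measurable_fun_pairP; split.
  apply: measurable_funB.
    exact: measurableT_comp measurable_fst measurable_fst.
  exact: measurableT_comp ms measurable_snd.
apply/measurable_fun_pairP; split.
  exact: measurableT_comp mz measurable_snd.
exact: measurableT_comp measurable_snd measurable_fst.
Qed.

(** At each time the mass is at most C by [density_weight_le], and the indicator confines time to an
    interval of length T. *)
Lemma source_kernel_le (y : Y) :
  (\int[mu]_p (source_kernel (p, y) * cyl_weight p)%:E <= (C * T)%:E)%E.
Proof.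
have msec : measurable_fun setT (fun p : X => source_kernel (p, y)).
  by apply: (measurableT_comp source_kernel_measurable); exact: measurable_pair2.
have mint : measurable_fun setT (fun p : X => (source_kernel (p, y) * cyl_weight p)%:E).
  by apply/measurable_EFinP; apply: measurable_funM => //; exact: cyl_weight_measurable.
have int0 p : (0 <= (source_kernel (p, y) * cyl_weight p)%:E)%E.
  by rewrite lee_fin mulr_ge0 ?source_kernel_ge0 ?cyl_weight_ge0.
rewrite (fubini_tonelli1 (fun p : X => (source_kernel (p, y) * cyl_weight p)%:E)) //.
have mI : measurable_fun setT (\1_(`]0, T[%classic) : measurableTypeR R -> R) by exact: measurable_indic.
apply: (@le_trans _ _ (\int[leb1]_t (C%:E * (\1_(`]0, T[%classic) t)%:E))%E); last first.
  rewrite (ge0_integralZl _ measurableT); [|exact/measurable_EFinP|by []|by rewrite lee_fin ltW].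
  rewrite integral_indic// setIT EFinM; apply: lee_wpmul2l; first by rewrite lee_fin ltW.
  have hT : leb1 `]0, T[%classic = T%:E.
    by rewrite lebesgue_measure_itv/= lte_fin T_gt0 oppr0 adde0.
  by apply: (@le_trans _ _ (leb1 `]0, T[%classic)) => //; rewrite hT.
apply: ge0_le_integral => //.
- by move=> t _; apply: integral_ge0.
- exact: (measurable_fun_fubini_tonelli_F (fun p : X => (source_kernel (p, y) * cyl_weight p)%:E)).
- by apply: emeasurable_funM => //; exact/measurable_EFinP.
move=> t _; rewrite /fubini_F; under eq_integral do rewrite /source_kernel/= indicE.
rewrite indicE; case: (t \in _); last first.
  by rewrite mule0 integral0_eq// => x _; rewrite mul0r mul0r.
rewrite mule1; apply: le_trans (density_weight_le (t - s y) (z y)).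
have mdens : measurable_fun setT (fun x => density (t - s y, (z y, x))).
  apply: (measurableT_comp density_measurable).
  exact: measurableT_comp (measurable_pair1 _) (measurable_pair1 _).
apply: ge0_le_integral => //.
- by move=> x _; rewrite lee_fin mul1r mulr_ge0 ?density_ge0 ?cyl_weight_ge0.
- apply/measurable_EFinP; apply: measurable_funM.
    by apply: measurable_funM => //.
  by apply: (measurableT_comp cyl_weight_measurable); exact: measurable_pair1.
- apply/measurable_EFinP; apply: measurable_funM => //.
  exact/(measurable_restrictT _ mO).
move=> x _; rewrite lee_fin mul1r ler_wpM2l ?(density_ge0)//.
exact: cyl_weight_le.
Qed.

End source.

(** For a test function v this is H[0, v, 0] divided by w. It also makes sense for z on the
    boundary, where it is the normal derivative. *)
Definition potential (v : X -> R) t z : R :=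
  \int[leb1]_(r in `]0, t[) (\int[leb]_x (v (r, x) * density (t - r, (z, x)))).

Section bounded_potential.
Variables (v : X -> R) (B : R).
Hypothesis mv : measurable_fun [set: X] v.
Hypothesis vB : forall p, `|v p| <= B * cyl_weight p.

Let v_out p : ~ cylinder p -> v p = 0.
Proof.
move=> np; have := vB p; rewrite cyl_weight_out// mulr0 => h.
by apply/eqP; rewrite -normr_le0.
Qed.

Let vBw r x : `|v (r, x)| <= `|B| * ((fun x => w x) \_ Omega) x.
Proof.
apply: (le_trans (vB _)); apply: (@le_trans _ _ (`|B| * cyl_weight (r, x))).
  by rewrite ler_wpM2r ?cyl_weight_ge0// ler_norm.
by rewrite ler_wpM2l//; exact: cyl_weight_le.
Qed.

Let mdens t z : measurable_fun setT (fun x => density (t, (z, x))).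
Proof.
apply: (measurableT_comp density_measurable).
exact: measurableT_comp (measurable_pair1 _) (measurable_pair1 _).
Qed.

Let mvr r : measurable_fun setT (fun x => v (r, x)).
Proof. by apply: (measurableT_comp mv); exact: measurable_pair1. Qed.

Lemma potential_density_le r t z : (\int[leb]_x `|v (r, x) * density (t, (z, x))|%:E <= (`|B| * C)%:E)%E.
Proof.
apply: (@le_trans _ _ (\int[leb]_x (`|B|%:E * (density (t, (z, x)) * ((fun x => w x) \_ Omega) x)%:E))%E).
  apply: ge0_le_integral => //.
  - apply/measurable_EFinP; apply: measurableT_comp => //; exact: measurable_funM.
  - apply: emeasurable_funM => //; apply/measurable_EFinP; apply: measurable_funM => //.
    exact/(measurable_restrictT _ mO).
  move=> x _; rewrite -EFinM lee_fin normrM (ger0_norm (density_ge0 _)).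
  by rewrite mulrC mulrCA ler_wpM2l ?density_ge0.
rewrite (ge0_integralZl _ measurableT)//; last 2 first.
- apply/measurable_EFinP; apply: measurable_funM => //.
  exact/(measurable_restrictT _ mO).
- move=> x _; rewrite lee_fin mulr_ge0 ?(density_ge0)//.
  by rewrite patchE; case: ifP.
rewrite EFinM; apply: lee_wpmul2l => //.
exact: density_weight_le.
Qed.

Let pint r t z : R := \int[leb]_x (v (r, x) * density (t - r, (z, x))).

Let pint_integrable r t z : leb.-integrable setT (EFin \o (fun x => v (r, x) * density (t, (z, x)))).
Proof.
apply/integrableP; split; first by apply/measurable_EFinP; exact: measurable_funM.
exact: le_lt_trans (potential_density_le r t z) (ltry _).
Qed.

Lemma potential_section_le r t z : `|pint r t z| <= `|B| * C.
Proof.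
apply: (le_trans (le_normr_Rintegral measurableT (pint_integrable r (t - r) z))).
rewrite -lee_fin; apply: le_trans (potential_density_le r (t - r) z).
rewrite /Rintegral fineK//.
have := integrable_fin_num measurableT (integrable_abse (pint_integrable r (t - r) z)).
by [].
Qed.

Lemma potential_section_measurable t z : measurable_fun setT (fun r : measurableTypeR R => pint r t z).
Proof.
apply: (measurable_Rintegral_snd leb (f := fun p : X => v p * density (t - p.1, (z, p.2)))).
apply: measurable_funM => //; apply: (measurableT_comp density_measurable).
apply/measurable_fun_pairP; split.
  by apply: measurable_funB => //; exact: measurable_fst.
exact: measurableT_comp (measurable_pair1 z) measurable_snd.
Qed.

Lemma bounded_section_L1 r : L1_weight Omega gamma (fun x => v (r, x)).
Proof.
apply: (weight_bounded_L1 (C := `|B|)) => [|x Ox]; first exact: measurable_funTS.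
by have := vBw r x; rewrite patchE mem_set.
Qed.

Let pintE r t z : r < t -> closure Omega z ->
  pint r t z = ser (t - r) (coef (fun x => v (r, x))) z.
Proof.
move=> rt cz; rewrite (ser_coefE _ (bounded_section_L1 r) cz) ?subr_gt0//.
rewrite -density_inner ?subr_gt0//; apply: eq_Rintegral => x _.
rewrite patchE; case: ifPn => //; rewrite notin_setE => Ox.
by rewrite v_out// => -[].
Qed.

(** At each time r < t the integrand is continuous up to the boundary. It is dominated by |B| C for
    all r, even as r tends to t where [majorant] gives no control: here the uniform bound on S(t)w
    is essential. *)
Lemma potential_continuous t : {within closure Omega, continuous (potential v t)}.
Proof.
apply: within_continuous_seq => z z_ cz cz_ zz.
have mI : measurable (`]0, t[%classic : set (measurableTypeR R)) by [].
have Icst : leb1.-integrable `]0, t[ (EFin \o cst (`|B| * C)).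
  apply: measurable_bounded_integrable => //.
    have Ioo : (leb1 `]0%R, t[%classic < +oo)%E.
      by rewrite lebesgue_measure_itv/=; case: ifP => _; rewrite ?ltry// -EFinD ltry.
    exact: Ioo.
  exists (`|B| * C); split; first exact: num_real.
  move=> M' hM' x _ /=; rewrite ger0_norm ?mulr_ge0 ?(ltW C_gt0)//; exact: ltW.
have h : (\int[leb1]_(r in `]0%R, t[) (pint r t (z_ k))%:E)%E @[k --> \oo] -->
    (\int[leb1]_(r in `]0%R, t[) (pint r t z)%:E)%E.
  apply: (dominated_cvg mI (g := EFin \o cst (`|B| * C))) => //.
  - by move=> k; apply/measurable_EFinP; apply: measurable_funTS; exact: potential_section_measurable.
  - move=> r; rewrite /= in_itv/= => /andP[r0 rt].
    apply/cvg_EFin; first exact: nearW.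
    rewrite (pintE rt cz) (_ : fine \o _ = fun k => ser (t - r) (coef (fun x => v (r, x))) (z_ k)); last first.
      by apply/funext => k /=; rewrite pintE.
    have tr : 0 < t - r by rewrite subr_gt0.
    have := ser_cont tr (coef_le (bounded_section_L1 r)).
    move=> /subspace_continuousP /(_ z cz) sc.
    have zw : z_ k @[k --> \oo] --> within (closure Omega) (nbhs z).
      move=> P wP; have : \forall k \near \oo, closure Omega (z_ k) -> P (z_ k) := zz _ wP.
      by apply: filterS => k h; exact: h (cz_ k).
    exact: cvg_comp zw sc.
  - by move=> k r _; rewrite /= lee_fin; exact: potential_section_le.
apply: (fine_cvg (a := potential v t z)); rewrite /potential /Rintegral fineK.
  exact: h.
apply: integrable_fin_num => //.
apply: (le_integrable mI _ _ Icst); first by apply/measurable_EFinP; apply: measurable_funTS; exact: potential_section_measurable.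
move=> r _ /=; rewrite lee_fin [leRHS]ger0_norm ?mulr_ge0 ?(ltW C_gt0)//; exact: potential_section_le.
Qed.

End bounded_potential.
End heat_source.

Local Notation heat := (heat Omega gamma lambda phi).
Local Notation HpsiN psi := (heat_solution Omega gamma lambda phi (cst 0) psi (fun _ => cst 0)).
Let mcyl : measurable cylinder. Proof. exact: measurableX. Qed.
Let mus := product_sfmeasure leb1 leb.
Let mrefl := @measurable_reflection2 R T _ ('rV[R]_n).
Let reflE := @product_reflection R T _ ('rV[R]_n) leb.
Let momega := cyl_weight_measurable.
Let omega0 p : 0 <= cyl_weight p. Proof. exact: cyl_weight_ge0. Qed.

(** * Duhamel's formula and pairing with sources *)

Section duhamel.

Section pairing.
Context dY (Y : measurableType dY) (s : Y -> R) (z : Y -> 'rV[R]_n).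
Hypothesis ms : measurable_fun [set: Y] s.
Hypothesis mz : measurable_fun [set: Y] z.
Variables (v : X -> R) (B : R).
Hypothesis mv : measurable_fun [set: X] v.
Hypothesis vB : forall p, `|v p| <= B * cyl_weight p.

Let v_out p : ~ cylinder p -> v p = 0.
Proof.
move=> np; have := vB p; rewrite cyl_weight_out// mulr0 => h.
by apply/eqP; rewrite -normr_le0.
Qed.

Let mvr : measurable_fun setT (fun p : X => v (reflection T p)).
Proof. exact: measurableT_comp mv mrefl. Qed.

Lemma reflected_bound p : `|v (reflection T p)| <= B * cyl_weight p.
Proof. by rewrite -(cyl_weight_reflection p). Qed.

Let msec (y : Y) : measurable_fun setT (fun p : X => source_kernel s z (p, y)).
Proof.
by apply: (measurableT_comp (source_kernel_measurable ms mz)); exact: measurable_pair2.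
Qed.

Lemma source_pairing_integrable (y : Y) :
  mu.-integrable setT (EFin \o (fun p => source_kernel s z (p, y) * v (reflection T p))).
Proof.
apply/integrableP; split; first by apply/measurable_EFinP; exact: measurable_funM.
apply: (@le_lt_trans _ _ (`|B|%:E * (C * T)%:E)%E); last by rewrite -EFinM ltry.
apply: (@le_trans _ _ (`|B|%:E * \int[mu]_p (source_kernel s z (p, y) * cyl_weight p)%:E)%E); last first.
  by apply: lee_wpmul2l => //; exact: (source_kernel_le ms mz).
have k0 p : 0 <= source_kernel s z (p, y) by exact: source_kernel_ge0.
rewrite -(ge0_integralZl _ measurableT)//; last 2 first.
- by apply/measurable_EFinP; exact: measurable_funM.
- by move=> p _; rewrite lee_fin mulr_ge0.
apply: ge0_le_integral => //.
- by apply/measurable_EFinP; apply: measurableT_comp => //; exact: measurable_funM.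
- by apply: emeasurable_funM => //; apply/measurable_EFinP; exact: measurable_funM.
move=> p _; rewrite /= -EFinM lee_fin normrM (ger0_norm (k0 p)) mulrCA ler_wpM2l//.
by apply: (le_trans (reflected_bound p)); rewrite ler_wpM2r// ler_norm.
Qed.

(** After the change r = T - t the elapsed time in the kernel is T - r - s y = (T - s y) - r, which
    is that of the potential at time T - s y. *)
Lemma source_pairing (y : Y) : 0 <= s y < T ->
  \int[mu]_p (source_kernel s z (p, y) * v (reflection T p)) = potential v (T - s y) (z y).
Proof.
move=> /andP[s0 sT]; pose h (p : X) := source_kernel s z (reflection T p, y) * v p.
have mh : measurable_fun setT (EFin \o h).
  apply/measurable_EFinP; apply: measurable_funM => //.
  exact: measurableT_comp (msec y) mrefl.
have ih : mu.-integrable setT (EFin \o h).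
  have := integrable_preserving mrefl reflE (source_pairing_integrable y).
  apply: eq_integrable => // p _.
  by rewrite /h /= reflectionK.
transitivity (\int[mu]_p h p).
  have e1 := integral_preserving mrefl reflE mh.
  rewrite /Rintegral; congr fine; apply: etrans e1.
  by apply: eq_integral => p _; rewrite /h /= reflectionK.
rewrite -(Rintegral12 ih) /potential [RHS]Rintegral_mkcond.
apply: eq_Rintegral => r _; rewrite patchE; case: ifPn.
  rewrite inE /= in_itv/= => /andP[r0 rT]; apply: eq_Rintegral => x _.
  rewrite /h /source_kernel/= indicE mem_set ?mul1r; last first.
    rewrite /= in_itv/= subr_gt0 gtrBl r0 andbT (lt_le_trans rT)//.
    by rewrite gerBl.
  by rewrite mulrC addrAC.
(* Outside ]0, T - s y[ the integrand vanishes: for r <= 0 because v does, for r >= T - s y because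
   the density does. *)
rewrite notin_setE /= in_itv/= => /negP nr.
rewrite (_ : \int[_]_y _ = \int[leb]_(y in setT) (cst 0) y); first by rewrite Rintegral_cst// mul0r.
apply: eq_Rintegral => x _; rewrite /h /source_kernel/=.
have [r0|r0] := leP r 0.
  by rewrite v_out ?mulr0// => -[/= + _]; rewrite in_itv/= ltNge r0.
rewrite [density _]density_out ?mulr0 ?mul0r// => -[/= tr _].
by move: nr; rewrite r0/= -subr_gt0 addrAC tr.
Qed.

End pairing.

Section heat_sections.
Variable v : R -> 'rV[R]_n -> R.
Hypothesis mv : measurable_fun cylinder (fun p : X => v p.1 p.2).

Definition zero_ext : X -> R := (fun p => v p.1 p.2) \_ cylinder.

Lemma zero_ext_measurable : measurable_fun setT zero_ext.
Proof. exact/(measurable_restrictT _ mcyl). Qed.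

Lemma zero_extE r x : 0 < r < T -> zero_ext (r, x) = (v r \_ Omega) x.
Proof.
move=> rT; rewrite /zero_ext !patchE.
case: ifPn; rewrite ?inE ?notin_setE.
  by move=> [/= _ Ox]; rewrite mem_set.
by move=> nc; rewrite memNset// => Ox; apply: nc; split => //=; rewrite in_itv.
Qed.

Let mzr r : measurable_fun setT (fun x => zero_ext (r, x)).
Proof. by apply: (measurableT_comp zero_ext_measurable); exact: measurable_pair1. Qed.

Lemma section_measurable r : 0 < r < T -> measurable_fun Omega (v r).
Proof.
move=> rT; have := measurable_funTS (D := Omega) (mzr r).
apply: eq_measurable_fun => x; rewrite inE => Ox.
by rewrite zero_extE// patchE mem_set.
Qed.

Let secint r t z : R := \int[leb]_y (zero_ext (r, y) * density (t - r, (z, y))).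

Lemma heat_sectionE r t x : 0 < r < T -> r < t -> Omega x -> L1_weight Omega gamma (v r) ->
  heat (t - r) (v r) x = w x * secint r t x.
Proof.
move=> rT rt Ox Lv; have tr : 0 < t - r by rewrite subr_gt0.
rewrite (heatE tr Lv Ox) /flow; congr (_ * _).
rewrite (ser_coefE tr Lv (subO Ox)) -(density_inner _ tr (subO Ox)).
by apply: eq_Rintegral => y _; rewrite zero_extE.
Qed.

(** [heat] is 0 by convention when the section v r is not in L^1(w). As a function of r it is thus a
    case distinction on the finiteness of the norm [N] r, in which the condition and the integral
    [secint] are both measurable. *)
Lemma heat_section_measurable t x : t <= T -> Omega x ->
  measurable_fun (`]0, t[%classic : set (measurableTypeR R)) (fun r : measurableTypeR R => heat (t - r) (v r) x).
Proof.
move=> tT Ox.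
pose N (r : measurableTypeR R) := (\int[leb]_y (`|zero_ext (r, y)| * ((fun x => w x) \_ Omega) y)%:E)%E.
have mN : measurable_fun setT N.
  apply: (measurable_fun_fubini_tonelli_F (m2 := leb)
    (fun p : X => (`|zero_ext p| * ((fun x => w x) \_ Omega) p.2)%:E)).
    apply/measurable_EFinP; apply: measurable_funM.
      by apply: measurableT_comp => //; exact: zero_ext_measurable.
    apply: (measurableT_comp _ measurable_snd).
    exact/(measurable_restrictT _ mO).
  by move=> p; rewrite lee_fin mulr_ge0// patchE; case: ifP.
have ms : measurable_fun setT (fun r : measurableTypeR R => secint r t x).
  apply: (measurable_Rintegral_snd leb (f := fun p : X => zero_ext p * density (t - p.1, (x, p.2)))).
  apply: measurable_funM; first exact: zero_ext_measurable.
  apply: (measurableT_comp density_measurable).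
  apply/measurable_fun_pairP; split.
    by apply: measurable_funB => //; exact: measurable_fst.
  exact: measurableT_comp (measurable_pair1 x) measurable_snd.
have : measurable_fun (`]0, t[%classic : set (measurableTypeR R))
    (fun r : measurableTypeR R => if (N r < +oo)%E then w x * secint r t x else 0).
  apply: measurable_funTS; apply: measurable_fun_ifT.
  - by apply: measurable_fun_lte => //; exact: measurable_cst.
  - by apply: measurable_funM => //; exact: measurable_cst.
  - exact: measurable_cst.
apply: eq_measurable_fun => r; rewrite inE/= in_itv/= => /andP[r0 rt].
have rT : 0 < r < T by rewrite r0 (lt_le_trans rt).
have NE : N r = (\int[leb]_(y in Omega) (`|v r y| * w y)%:E)%E.
  rewrite /N [RHS]integral_mkcond; apply: eq_integral => y _.
  rewrite zero_extE//.
  by rewrite !patchE; case: ifP; rewrite ?mulr0.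
rewrite NE; case: ifPn => [foo|nfoo].
  by rewrite heat_sectionE//; split => //; exact: section_measurable.
by rewrite heat_notin// => -[_]; rewrite (negbTE nfoo).
Qed.

End heat_sections.

Section duhamel_bounded.
Variables (psi : R -> 'rV[R]_n -> R) (v : X -> R) (B : R).
Hypothesis mpsi : measurable_fun cylinder (fun p : X => psi p.1 p.2).
Hypothesis mv : measurable_fun [set: X] v.
Hypothesis vB : forall p, `|v p| <= B * cyl_weight p.
Hypothesis psiv : {ae mu, forall p, zero_ext psi p = v p}.

(** psi agrees with the everywhere bounded v only almost everywhere. For almost every r the sections
    agree almost everywhere, and S(t - r) depends on the section only through an integral. *)
Lemma duhamelE t x : t <= T -> Omega x ->
  \int[leb1]_(r in `]0, t[) heat (t - r) (psi r) x = w x * potential v t x.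
Proof.
move=> tT Ox; have mI : measurable (`]0, t[%classic : set (measurableTypeR R)) by [].
have mp := potential_section_measurable mv t x.
have pB := potential_section_le mv vB.
have mz := zero_ext_measurable mpsi.
have ip : leb1.-integrable (`]0, t[%classic : set (measurableTypeR R))
    (EFin \o (fun r => \int[leb]_y (v (r, y) * density (t - r, (x, y))))).
  apply: measurable_bounded_integrable => //.
  - have Ioo : (leb1 `]0%R, t[%classic < +oo)%E.
      by rewrite lebesgue_measure_itv/=; case: ifP => _; rewrite ?ltry// -EFinD ltry.
    exact: Ioo.
  - exact: measurable_funTS.
  - exists (`|B| * C); split; first exact: num_real.
    by move=> M' hM' r _; apply: le_trans (ltW hM'); exact: pB.
rewrite /potential -(RintegralZl (w x) mI ip) /Rintegral; congr fine.
apply: ae_eq_integral => //.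
- by apply/measurable_EFinP; exact: heat_section_measurable.
- apply/measurable_EFinP; apply: measurable_funM; first exact: measurable_cst.
  exact: measurable_funTS.
have := ae_product psiv; apply: filterS => r aer; rewrite /= in_itv/= => /andP[r0 rt].
have rT : 0 < r < T by rewrite r0 (lt_le_trans rt).
have mzr : measurable_fun setT (fun y => zero_ext psi (r, y)).
  by apply: (measurableT_comp mz); exact: measurable_pair1.
have mvr : measurable_fun setT (fun y => v (r, y)).
  by apply: (measurableT_comp mv); exact: measurable_pair1.
have ms := section_measurable mpsi rT.
have [_ Lv] := bounded_section_L1 mv vB r.
have Lpsi : L1_weight Omega gamma (psi r).
  split=> //; rewrite (_ : (\int[leb]_(y in Omega) _ = \int[leb]_(y in Omega) (`|v (r, y)| * w y)%:E)%E)//.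
  apply: ae_eq_integral => //.
  - by apply/measurable_EFinP; apply: measurable_funM => //; exact: measurableT_comp.
  - apply/measurable_EFinP; apply: measurable_funM => //; apply: measurableT_comp => //.
    exact: measurable_funTS.
  apply: filterS aer => y <- Oy.
  by rewrite zero_extE// patchE mem_set.
rewrite heat_sectionE//; congr ((_ * fine _)%:E).
have md : measurable_fun setT (fun y => density (t - r, (x, y))).
  apply: (measurableT_comp density_measurable).
  exact: measurableT_comp (measurable_pair1 _) (measurable_pair1 _).
apply: ae_eq_integral => //.
- by apply/measurable_EFinP; exact: measurable_funM.
- by apply/measurable_EFinP; exact: measurable_funM.
by apply: filterS aer => y -> _.
Qed.

End duhamel_bounded.
End duhamel.

(** * Testing against bounded multiples of the weight *)

Section weak_dual.

Let mww : measurable_fun setT (fun p : X => w p.2).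
Proof. exact: measurableT_comp (measurable_weight gamma n_gt0 bO measurableT) measurable_snd. Qed.

Lemma L1_L1_norm (f : R -> 'rV[R]_n -> R) : measurable_fun cylinder (fun p : X => f p.1 p.2) ->
  (\int[leb1]_(t in `]0%R, T[) \int[leb]_(x in Omega) (`|f t x| * w x)%:E =
   \int[mu]_p (`|zero_ext f p| * cyl_weight p)%:E)%E.
Proof.
move=> mf; have mz := zero_ext_measurable mf.
rewrite (fubini_tonelli1 (fun p : X => (`|zero_ext f p| * cyl_weight p)%:E)); last 2 first.
- by apply/measurable_EFinP; apply: measurable_funM => //; exact: measurableT_comp.
- by move=> p; rewrite lee_fin mulr_ge0.
rewrite integral_mkcond; apply: eq_integral => t _; rewrite patchE /fubini_F.
case: ifPn => [|nt].
  rewrite inE/= in_itv/= => tT; rewrite integral_mkcond; apply: eq_integral => x _.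
  rewrite patchE zero_extE// patchE; case: ifPn; last by rewrite normr0 mul0r.
  by rewrite inE => Ox; rewrite cyl_weightE//; split => //=; rewrite in_itv.
rewrite integral0_eq// => x _; rewrite cyl_weight_out ?mulr0// => -[/= tT _].
by move: nt; rewrite notin_setE/= tT.
Qed.

Lemma L1_L1_integrable (f : R -> 'rV[R]_n -> R) : L1_L1_weight Omega gamma T f ->
  mu.-integrable setT (EFin \o (fun p => zero_ext f p * cyl_weight p)).
Proof.
move=> [mf foo]; have mz := zero_ext_measurable mf.
apply/integrableP; split; first by apply/measurable_EFinP; exact: measurable_funM.
move: foo; rewrite (L1_L1_norm mf); apply: le_lt_trans.
apply: ge0_le_integral => //.
- by apply/measurable_EFinP; apply: measurableT_comp => //; exact: measurable_funM.
- by apply/measurable_EFinP; apply: measurable_funM => //; exact: measurableT_comp.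
by move=> p _ /=; rewrite lee_fin normrM (ger0_norm (omega0 p)).
Qed.

Section test_function.
Variables (psi : R -> 'rV[R]_n -> R) (v : X -> R) (B : R).
Hypothesis mpsi : measurable_fun cylinder (fun p : X => psi p.1 p.2).
Hypothesis mv : measurable_fun [set: X] v.
Hypothesis vB : forall p, `|v p| <= B * cyl_weight p.
Hypothesis psiv : {ae mu, forall p, zero_ext psi p = v p}.

Let mvr : measurable_fun setT (fun p : X => v (reflection T p)).
Proof. exact: measurableT_comp mv mrefl. Qed.

Lemma test_integrable (f : R -> 'rV[R]_n -> R) : L1_L1_weight Omega gamma T f ->
  mu.-integrable setT (EFin \o (fun p => zero_ext f p * v (reflection T p))).
Proof.
move=> Lf; have [mf _] := Lf; have mz := zero_ext_measurable mf.
apply: (le_integrable measurableT _ _ (integrableZl measurableT `|B| (L1_L1_integrable Lf))).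
  by apply/measurable_EFinP; exact: measurable_funM.
move=> p _ /=; rewrite lee_fin !normrM normr_id mulrCA ler_wpM2l//.
rewrite (ger0_norm (omega0 p)); apply: (le_trans (reflected_bound vB p)).
by rewrite ler_wpM2r// ler_norm.
Qed.

(** Fubini turns the iterated integral into one over space-time. psi at time T - t is v after
    reflection, up to a null set since reflection preserves null sets. *)
Lemma test_pairing (f : R -> 'rV[R]_n -> R) : L1_L1_weight Omega gamma T f ->
  \int[leb]_(x in Omega) (\int[leb1]_(t in `]0, T[) (f t x * psi (T - t) x)) =
  \int[mu]_p (zero_ext f p * v (reflection T p)).
Proof.
move=> Lf; have [mf _] := Lf; have mz := zero_ext_measurable mf.
have mzp := zero_ext_measurable mpsi.
pose k p := zero_ext f p * zero_ext psi (reflection T p).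
have mk : measurable_fun setT k.
  by apply: measurable_funM => //; exact: measurableT_comp mzp mrefl.
have ifv := test_integrable Lf.
have kae : {ae mu, forall p, k p = zero_ext f p * v (reflection T p)}.
  have := ae_preserving mrefl reflE psiv.
  by apply: filterS => p hp; rewrite /k hp.
have ik : mu.-integrable setT (EFin \o k).
  apply/integrableP; split; first exact/measurable_EFinP.
  have /integrableP[_] := ifv; apply: le_lt_trans.
  rewrite le_eqVlt; apply/orP; left; apply/eqP.
  apply: ae_eq_integral => //.
  - by apply/measurable_EFinP; exact: measurableT_comp.
  - apply/measurable_EFinP; apply: measurableT_comp => //; exact: measurable_funM.
  by apply: filterS kae => p /= -> _.
transitivity (\int[mu]_p k p); last first.
  rewrite /Rintegral; congr fine; apply: ae_eq_integral => //.
  - exact/measurable_EFinP.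
  - by apply/measurable_EFinP; exact: measurable_funM.
  by apply: filterS kae => p -> _.
rewrite -(Rintegral21 ik) Rintegral_mkcond; apply: eq_Rintegral => x _.
rewrite patchE; case: ifPn => [|nx].
  rewrite inE => Ox; rewrite Rintegral_mkcond; apply: eq_Rintegral => t _.
  rewrite patchE /k; case: ifPn => [|nt].
    rewrite inE/= in_itv/= => /andP[t0 tT].
    rewrite /reflection/= !zero_extE ?subr_gt0 ?tT ?gtrBl ?t0//.
    by rewrite !patchE mem_set.
  rewrite /zero_ext patchE memNset ?mul0r// => -[/= tT _].
  by move: nt; rewrite notin_setE/= tT.
rewrite (_ : \int[_]_t _ = \int[leb1]_(t in setT) (cst 0) t); first by rewrite Rintegral_cst// mul0r.
apply: eq_Rintegral => t _; rewrite /k /zero_ext patchE memNset ?mul0r// => -[/= _ Ox].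
by move: nx; rewrite notin_setE.
Qed.

Lemma test_solutionE t x : 0 < t <= T -> Omega x -> HpsiN psi t x = w x * potential v t x.
Proof.
move=> /andP[t0 tT] Ox; rewrite /heat_solution (duhamelE mpsi mv vB psiv tT Ox).
have L0 : L1_weight Omega gamma (cst 0).
  apply: (weight_bounded_L1 (C := 0)); first exact: measurable_cst.
  by move=> y _; rewrite /= normr0 mul0r.
rewrite (heatE t0 L0 Ox) /flow (ser_coefE t0 L0 (subO Ox)).
have -> : inner Omega (cst 0) (fun y => w y * hker t x y) = 0.
  rewrite /inner (_ : \int[_]_(y in _) _ = \int[leb]_(y in Omega) (cst 0) y).
    by rewrite Rintegral_cst// mul0r.
  by apply: eq_Rintegral => y _; rewrite mul0r.
rewrite mulr0 add0r [X in _ + X](_ : _ = 0) ?addr0// /Rintegral integral0_eq//.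
by move=> p _; rewrite mulr0.
Qed.

Lemma test_normal_derivative t zeta : 0 < t <= T -> closure Omega zeta ->
  normal_derivative Omega gamma (HpsiN psi t) zeta = potential v t zeta.
Proof.
move=> tT cz; apply: (normal_derivativeE cz); last exact: (potential_continuous mv vB).
by move=> x Ox; exact: test_solutionE.
Qed.

Section source_term.
Context dY (Y : measurableType dY) (s : Y -> R) (z : Y -> 'rV[R]_n).
Variable m2 : {sigma_finite_measure set Y -> \bar R}.
Variable g : Y -> R.
Hypothesis ms : measurable_fun [set: Y] s.
Hypothesis mz : measurable_fun [set: Y] z.
Hypothesis ig : m2.-integrable setT (EFin \o g).
Hypothesis gs : forall y : Y, g y != 0 -> 0 <= s y < T.

Let Q (y : Y) := \int[mu]_p (source_kernel s z (p, y) * v (reflection T p)).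

Lemma source_potential_measurable : measurable_fun setT Q.
Proof.
have h : measurable_fun setT (fun q : X * Y => source_kernel s z q * v (reflection T q.1)).
  apply: measurable_funM; first exact: (source_kernel_measurable ms mz).
  exact: measurableT_comp mvr measurable_fst.
exact: (measurable_Rintegral_fst mus h).
Qed.

(** [source_pairing] requires 0 <= s y < T, which is known only where g is nonzero; the factor g y
    settles the other points. *)
Lemma source_potentialE (y : Y) : g y * Q y = g y * potential v (T - s y) (z y).
Proof.
have [->|gy] := eqVneq (g y) 0; first by rewrite !mul0r.
by rewrite /Q (source_pairing ms mz mv vB)// gs.
Qed.

Let Q_le (y : Y) : `|Q y| <= `|B| * (C * T).
Proof.
have iQ := source_pairing_integrable ms mz mv vB y.
apply: (le_trans (le_normr_Rintegral measurableT iQ)).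
have k0 p : 0 <= source_kernel s z (p, y) by exact: source_kernel_ge0.
have msec : measurable_fun setT (fun p : X => source_kernel s z (p, y)).
  by apply: (measurableT_comp (source_kernel_measurable ms mz)); exact: measurable_pair2.
rewrite -lee_fin /Rintegral fineK; last exact: integrable_fin_num (integrable_abse iQ).
apply: (@le_trans _ _ (`|B|%:E * \int[mu]_p (source_kernel s z (p, y) * cyl_weight p)%:E)%E); last first.
  by rewrite EFinM; apply: lee_wpmul2l => //; exact: (source_kernel_le ms mz).
rewrite -(ge0_integralZl _ measurableT)//; last 2 first.
- by apply/measurable_EFinP; exact: measurable_funM.
- by move=> p _; rewrite lee_fin mulr_ge0.
apply: ge0_le_integral => //.
- by apply/measurable_EFinP; apply: measurableT_comp => //; exact: measurable_funM.
- by apply: emeasurable_funM => //; apply/measurable_EFinP; exact: measurable_funM.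
move=> p _; rewrite /= -EFinM lee_fin normrM (ger0_norm (k0 p)) mulrCA ler_wpM2l//.
by apply: (le_trans (reflected_bound vB p)); rewrite ler_wpM2r// ler_norm.
Qed.

Lemma source_potential_integrable : m2.-integrable setT (EFin \o (fun y : Y => g y * Q y)).
Proof.
have mg : measurable_fun setT g by have /measurable_int/measurable_EFinP := ig.
apply: (le_integrable measurableT _ _ (integrableZl measurableT (`|B| * (C * T)) ig)).
  by apply/measurable_EFinP; apply: measurable_funM => //; exact: source_potential_measurable.
move=> y _ /=; rewrite lee_fin !normrM mulrC ler_wpM2r//.
rewrite normr_id -normrM; apply: le_trans (Q_le y) _.
by rewrite ler_wpM2l// ler_norm.
Qed.

Lemma source_duality :
  \int[mu]_p (kernel_op m2 (source_kernel s z) g p * v (reflection T p)) =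
  \int[m2]_y (g y * Q y).
Proof.
exact: (kernel_op_pairing (m1 := mus) (source_kernel_measurable ms mz)
  (source_kernel_ge0 s z) momega omega0 CT
  (source_kernel_le ms mz) ig mvr (reflected_bound vB)).
Qed.

End source_term.
End test_function.
End weak_dual.

(** * Initial and interior data as sources *)

Section solution.

Section source_facts.
Context dY (Y : measurableType dY) (s : Y -> R) (z : Y -> 'rV[R]_n).
Variable m2 : {sigma_finite_measure set Y -> \bar R}.
Variable g : Y -> R.
Hypothesis ms : measurable_fun [set: Y] s.
Hypothesis mz : measurable_fun [set: Y] z.
Hypothesis ig : m2.-integrable setT (EFin \o g).

Lemma source_op_measurable : measurable_fun setT (kernel_op m2 (source_kernel s z) g).
Proof. exact: (kernel_op_measurable (source_kernel_measurable ms mz) ig). Qed.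

Lemma source_op_norm : (\int[mu]_p (`|kernel_op m2 (source_kernel s z) g p| * cyl_weight p)%:E <=
  (C * T)%:E * \int[m2]_y `|g y|%:E)%E.
Proof.
exact: (kernel_op_norm (m1 := mus) (source_kernel_measurable ms mz)
  (source_kernel_ge0 s z) momega omega0 CT
  (source_kernel_le ms mz) ig).
Qed.

Lemma source_op_pairing_integrable (v : X -> R) (B : R) : measurable_fun setT v ->
  (forall p, `|v p| <= B * cyl_weight p) ->
  mu.-integrable setT (EFin \o (fun p => kernel_op m2 (source_kernel s z) g p * v (reflection T p))).
Proof.
move=> mv vB; have mvr : measurable_fun setT (fun p : X => v (reflection T p)).
  exact: measurableT_comp mv mrefl.
exact: (kernel_op_pairing_integrable (m1 := mus) (source_kernel_measurable ms mz)
  (source_kernel_ge0 s z) momega omega0 CT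
  (source_kernel_le ms mz) ig mvr (reflected_bound vB)).
Qed.

Lemma source_op_integrable :
  {ae mu, forall p, cyl_weight p != 0 -> m2.-integrable setT (EFin \o (fun y : Y => source_kernel s z (p, y) * g y))}.
Proof.
exact: (kernel_op_integrable (m1 := mus) (source_kernel_measurable ms mz)
  (source_kernel_ge0 s z) momega omega0 CT
  (source_kernel_le ms mz) ig).
Qed.

End source_facts.

(** The bound on psi holds only almost everywhere, while the duality lemmas want it at every point;
    clamping at |B| w alters psi on a null set only. *)
Lemma test_function_clamp (psi : R -> 'rV[R]_n -> R) : Linf_Linf_weight Omega gamma T psi ->
  exists (v : X -> R) (B : R), [/\ measurable_fun setT v, forall p, `|v p| <= B * cyl_weight p &
    {ae mu, forall p, zero_ext psi p = v p}].
Proof.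
move=> [mpsi [B psiB]]; pose b p := `|B| * cyl_weight p.
have b0 p : 0 <= b p by rewrite mulr_ge0.
have mz := zero_ext_measurable mpsi.
have mb : measurable_fun setT b by apply: measurable_funM => //.
exists (fun p => clamp (b p) (zero_ext psi p)), `|B|; split.
- rewrite /clamp; apply: measurable_maxr; first exact: measurableT_comp.
  exact: measurable_minr.
- by move=> p; exact: clamp_le.
apply: filterS psiB => p psiBp; rewrite clamp_id//.
have [cp|cp] := pselect (cylinder p); last first.
  by rewrite /zero_ext patchE memNset// normr0.
rewrite /b cyl_weightE// /zero_ext patchE mem_set//.
by apply: (le_trans (psiBp cp)); rewrite ler_wpM2r// ler_norm.
Qed.

Section initial_term.
Variable u0 : 'rV[R]_n -> R.
Hypothesis Lu0 : L1_weight Omega gamma u0.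

(** The weight w y goes with the data: the heat kernel is w(x) w(y) N, and [density] contains only
    the weight at the observation point. *)
Definition initial_density : 'rV[R]_n -> R := (fun y => u0 y * w y) \_ Omega.

Lemma initial_density_norm : (\int[leb]_y `|initial_density y|%:E =
  \int[leb]_(y in Omega) (`|u0 y| * w y)%:E)%E.
Proof.
rewrite [RHS]integral_mkcond; apply: eq_integral => y _; rewrite /initial_density !patchE.
by case: ifP => _; rewrite ?normr0// normrM (ger0_norm (w0 y)).
Qed.

Lemma initial_density_integrable : leb.-integrable setT (EFin \o initial_density).
Proof.
have [mu0 uoo] := Lu0; apply/integrableP; split.
  by apply/measurable_EFinP/(measurable_restrictT _ mO); exact: measurable_funM.
by rewrite [X in (X < _)%E]initial_density_norm.
Qed.

Lemma initial_termE t x : 0 < t < T -> Omega x ->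
  kernel_op leb (source_kernel (fun=> 0) id) initial_density (t, x) = heat t u0 x.
Proof.
move=> /andP[t0 tT] Ox; have cx := subO Ox.
rewrite (heatE t0 Lu0 Ox) /flow (ser_coefE t0 Lu0 cx).
rewrite -(density_inner u0 t0 cx).
rewrite -(RintegralZl (w x) measurableT (density_integrable t0 cx Lu0)).
apply: eq_Rintegral => y _; rewrite /source_kernel /initial_density/= indicE mem_set; last first.
  by rewrite /= in_itv/= t0.
rewrite mul1r subr0 !patchE; case: ifPn => [|_]; last by rewrite mulr0 mul0r mulr0.
rewrite inE => Oy; rewrite (densityE t0 (subO Oy) Ox) (densityE t0 cx Oy).
rewrite (hker_sym t y x).
by move: (w x) (w y) (u0 y) (hker t x y) => *; ring.
Qed.

End initial_term.

Section interior_term.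
Variable f : R -> 'rV[R]_n -> R.
Hypothesis Lf : L1_L1_weight Omega gamma T f.

Definition interior_density (p : X) : R := zero_ext f p * cyl_weight p.

Let mf : measurable_fun cylinder (fun p : X => f p.1 p.2). Proof. by have [] := Lf. Qed.

Lemma interior_density_norm : (\int[mu]_p `|interior_density p|%:E =
  \int[leb1]_(t in `]0%R, T[) \int[leb]_(x in Omega) (`|f t x| * w x)%:E)%E.
Proof.
rewrite (L1_L1_norm mf); apply: eq_integral => p _.
by rewrite /interior_density normrM (ger0_norm (omega0 p)).
Qed.

Lemma section_L1 : {ae leb1, forall r : measurableTypeR R, 0 < r < T -> L1_weight Omega gamma (f r)}.
Proof.
have mz := zero_ext_measurable mf.
have mN : measurable_fun setT (fun p : X => (`|zero_ext f p| * cyl_weight p)%:E).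
  by apply/measurable_EFinP; apply: measurable_funM => //; exact: measurableT_comp.
have N0 p : (0 <= (`|zero_ext f p| * cyl_weight p)%:E)%E by rewrite lee_fin mulr_ge0.
have : leb1.-integrable setT (fun t : measurableTypeR R => \int[leb]_x (`|zero_ext f (t, x)| * cyl_weight (t, x))%:E)%E.
  apply/integrableP; split; first exact: (measurable_fun_fubini_tonelli_F _ mN N0).
  have [_ foo] := Lf; move: foo; rewrite (L1_L1_norm mf) (fubini_tonelli1 _ mN N0).
  apply: le_lt_trans; rewrite le_eqVlt; apply/orP; left; apply/eqP; apply: eq_integral => t _.
  by rewrite gee0_abs//; apply: integral_ge0 => x _; exact: N0.
move=> /(integrable_ae measurableT); apply: filterS => r /(_ I) fin rT.
split; first exact: (section_measurable mf).
have NE : (\int[leb]_(y in Omega) (`|f r y| * w y)%:E =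
    \int[leb]_x (`|zero_ext f (r, x)| * cyl_weight (r, x))%:E)%E.
  rewrite [LHS]integral_mkcond; apply: eq_integral => y _.
  rewrite zero_extE// !patchE; case: ifPn => [|_]; last by rewrite normr0 mul0r.
  by rewrite inE => Oy; rewrite cyl_weightE//; split => //=; rewrite in_itv.
by rewrite NE; move/fin_numPlt : fin => /andP[].
Qed.

(** Almost everywhere only: the integral over sources in space-time is made iterated by Fubini,
    which needs the section of the kernel at p to be integrable. *)
Lemma interior_termE : {ae mu, forall p, cylinder p ->
  kernel_op mus (source_kernel (fun p : X => p.1) (fun p : X => p.2)) interior_density p =
  \int[leb1]_(r in `]0, p.1[) heat (p.1 - r) (f r) p.2}.
Proof.
have ms : measurable_fun setT (fun p : X => p.1) by exact: measurable_fst.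
have mz : measurable_fun setT (fun p : X => p.2) by exact: measurable_snd.
have ig : mus.-integrable setT (EFin \o interior_density).
  exact (L1_L1_integrable Lf).
have := source_op_integrable ms mz ig; apply: filterS => -[t x] hi cp.
have [/= tT Ox] := cp; move: tT; rewrite in_itv/= => /andP[t0 tT].
have {}hi := hi _; rewrite cyl_weightE//= in hi.
have {}hi := hi (lt0r_neq0 (wp Ox)).
rewrite /kernel_op -(Rintegral12 hi) [RHS]Rintegral_mkcond /Rintegral; congr fine.
have mI : measurable (`]0, t[%classic : set (measurableTypeR R)) by [].
apply: ae_eq_integral => //.
- have /measurable_int/measurable_EFinP mhi := hi.
  apply/measurable_EFinP; exact: (measurable_Rintegral_snd leb mhi).
- apply/measurable_EFinP/(measurable_restrictT _ mI).
  exact: (heat_section_measurable mf (ltW tT) Ox).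
have := section_L1; apply: filterS => r Lr _; congr EFin; rewrite patchE; case: ifPn => [|nr].
  rewrite inE/= in_itv/= => /andP[r0 rt].
  have rT : 0 < r < T by rewrite r0 (lt_trans rt).
  have tr : 0 < t - r by rewrite subr_gt0.
  rewrite (heat_sectionE rT rt Ox (Lr rT)).
  have fE (y : 'rV[R]_n) : zero_ext f (r, y) = (f r \_ Omega) y by exact: zero_extE.
  have di := density_integrable tr (subO Ox) (Lr rT).
  rewrite [X in _ = w x * X](_ : _ = \int[leb]_y ((f r \_ Omega) y * density (t - r, (x, y)))); last first.
    by apply: eq_Rintegral => y _; rewrite fE.
  rewrite -(RintegralZl (w x) measurableT di); apply: eq_Rintegral => y _.
  rewrite /source_kernel /interior_density/= indicE mem_set; last by rewrite /= in_itv/= t0.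
  rewrite mul1r fE !patchE; case: ifPn => [|_]; last by rewrite !mul0r !mulr0.
  rewrite inE => Oy; rewrite cyl_weightE; last by split => //=; rewrite in_itv.
  rewrite (densityE tr (subO Oy) Ox) (densityE tr (subO Ox) Oy).
  rewrite (hker_sym (t - r) y x) /=.
  by move: (w x) (w y) (f r y) (hker (t - r) x y) => *; ring.
rewrite integral0_eq// => y _; congr EFin; rewrite /source_kernel /interior_density/=.
(* Sources at r <= 0 carry no density and those at r >= t have not yet acted, so the integral over
   all r is one over ]0, t[. *)
have [r0|r0] := leP r 0.
  by rewrite cyl_weight_out ?mulr0// => -[/= + _]; rewrite in_itv/= ltNge r0.
rewrite [density _]density_out ?mulr0 ?mul0r// => -[/= tr _].
by move: nr; rewrite notin_setE/= in_itv/= r0/= -subr_gt0 tr.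
Qed.

End interior_term.
End solution.

#[local] Opaque surface_measure lateral_measure.

(** * Boundary data and the assembled solution *)

Section conclusion.

Local Notation lat := (@lateral_measure R n).
Local Notation Z := ('rV[R]_n * measurableTypeR R)%type.

Let mbd : measurable (boundary Omega).
Proof.
apply: measurableD => //; apply: open_measurable_rV; exact: open_interior.
Qed.

Section boundary_term.
Variable h : R -> 'rV[R]_n -> R.
Hypothesis Lh : L1_lateral Omega T h.

Definition lateral_boundary : set Z := boundary Omega `*` `]0, T[.

(** No weight appears, in contrast to the other two densities: taking the normal derivative of the
    heat kernel has already divided it by the weight at the source point. *)
Definition boundary_density : Z -> R := (fun p => h p.2 p.1) \_ lateral_boundary.

Let mlb : measurable lateral_boundary. Proof. exact: measurableX. Qed.

Lemma boundary_density_measurable : measurable_fun setT boundary_density.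
Proof. by apply/(measurable_restrictT _ mlb); have [] := Lh. Qed.

Lemma boundary_density_norm : (\int[lat]_p `|boundary_density p|%:E =
  \int[lat]_(p in boundary Omega `*` `]0%R, T[) `|h p.2 p.1|%:E)%E.
Proof.
rewrite [RHS]integral_mkcond; apply: eq_integral => p _; rewrite /boundary_density !patchE.
by rewrite /lateral_boundary; case: ifP => _; rewrite ?normr0.
Qed.

Lemma boundary_density_integrable : lat.-integrable setT (EFin \o boundary_density).
Proof.
have [mh hoo] := Lh; apply/integrableP; split.
  by apply/measurable_EFinP; exact: boundary_density_measurable.
by rewrite [X in (X < _)%E]boundary_density_norm.
Qed.

Definition boundary_support : set Z := [set p | boundary_density p != 0].

Lemma boundary_support_measurable : measurable boundary_support.
Proof.
rewrite (_ : boundary_support = setT `&` boundary_density @^-1` (~` [set 0])); last first.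
  by rewrite setTI; apply/seteqP; split => p /= /eqP.
apply: boundary_density_measurable => //; apply: measurableC; exact: measurable_set1.
Qed.

(** The lateral measure restricted to where the boundary data are nonzero: sigma-finite even if the
    boundary is not, and without effect on integrals that contain the factor [boundary_density]. *)
Definition boundary_measure : {sigma_finite_measure set Z -> \bar R} :=
  support_measure boundary_support_measurable boundary_density_integrable (fun _ nz => nz).

Lemma integral_boundary_measure (k : Z -> \bar R) : measurable_fun setT k ->
  (forall p, boundary_density p = 0 -> k p = 0%E) ->
  (\int[boundary_measure]_p k p = \int[lat]_p k p)%E.
Proof.
move=> mk k0; apply: integral_support => // p /negP; rewrite negbK => /eqP; exact: k0.
Qed.

Lemma boundary_measure_integrable : boundary_measure.-integrable setT (EFin \o boundary_density).
Proof.
have /integrableP[mb boo] := boundary_density_integrable; apply/integrableP; split; first exact: mb.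
rewrite (integral_boundary_measure (k := fun p => `|(EFin \o boundary_density) p|%E)).
- exact: boo.
- exact: measurableT_comp.
- by move=> p /= ->; rewrite normr0.
Qed.

Let ms : measurable_fun setT (fun p : Z => p.2). Proof. exact: measurable_snd. Qed.
Let mz : measurable_fun setT (fun p : Z => p.1). Proof. exact: measurable_fst. Qed.

Lemma boundary_termE t x : 0 < t < T -> Omega x ->
  kernel_op boundary_measure (source_kernel (fun p : Z => p.2) (fun p : Z => p.1)) boundary_density (t, x) =
  \int[lat]_(p in boundary Omega `*` `]0, t[)
    (heat_kernel_normal Omega gamma lambda phi (t - p.2) p.1 x * h p.2 p.1).
Proof.
move=> /andP[t0 tT] Ox; rewrite [RHS]Rintegral_mkcond /kernel_op /Rintegral; apply: (congr1 fine).
have mk : measurable_fun setT (fun p : Z =>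
    (source_kernel (fun p : Z => p.2) (fun p : Z => p.1) ((t, x), p) * boundary_density p)%:E).
  apply/measurable_EFinP; apply: measurable_funM; last exact: boundary_density_measurable.
  by apply: (measurableT_comp (source_kernel_measurable ms mz)); exact: measurable_pair1.
rewrite (integral_boundary_measure mk); last by move=> p ->; rewrite mulr0.
apply: eq_integral => -[zeta r] _; congr EFin; rewrite /source_kernel/= indicE mem_set; last first.
  by rewrite /= in_itv/= t0.
rewrite mul1r /boundary_density !patchE; case: ifPn => [|nb]; last first.
  rewrite mulr0 ifF//; apply: contraNF nb; rewrite !inE => -[/= bz].
  by rewrite !in_itv/= => /andP[r0 rt]; split => //=; rewrite in_itv/= r0 (lt_trans rt).
rewrite inE => -[/= bz]; rewrite in_itv/= => /andP[r0 rT].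
have cz : closure Omega zeta by case: bz.
have [rt|tr] := ltP r t.
  have trp : 0 < t - r by rewrite subr_gt0.
  rewrite mem_set; last by split => //=; rewrite in_itv/= r0.
  by rewrite (densityE trp cz Ox) (heat_kernel_normalE trp cz Ox).
rewrite memNset; last by move=> [_ /=]; rewrite in_itv/= r0/= ltNge tr.
by rewrite density_out ?mul0r// => -[/=]; rewrite subr_gt0 ltNge tr.
Qed.

End boundary_term.

Section representation.
Variables (u0 : 'rV[R]_n -> R) (f h : R -> 'rV[R]_n -> R).
Hypothesis Lu0 : L1_weight Omega gamma u0.
Hypothesis Lf : L1_L1_weight Omega gamma T f.
Hypothesis Lh : L1_lateral Omega T h.

Let ms1 : measurable_fun setT (fun _ : 'rV[R]_n => 0 : R). Proof. exact: measurable_cst. Qed.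
Let mz1 : measurable_fun setT (@id 'rV[R]_n). Proof. exact: measurable_id. Qed.
Let ms2 : measurable_fun setT (fun p : X => p.1). Proof. exact: measurable_fst. Qed.
Let mz2 : measurable_fun setT (fun p : X => p.2). Proof. exact: measurable_snd. Qed.
Let ms3 : measurable_fun setT (fun p : Z => p.2). Proof. exact: measurable_snd. Qed.
Let mz3 : measurable_fun setT (fun p : Z => p.1). Proof. exact: measurable_fst. Qed.
Let g1 := initial_density u0.
Let g2 := interior_density f.
Let g3 := boundary_density h.
Let nu := boundary_measure Lh.
Let ig1 : leb.-integrable setT (EFin \o g1) := initial_density_integrable Lu0.
Let ig2 : mus.-integrable setT (EFin \o g2). Proof. exact (L1_L1_integrable Lf). Qed.
Let ig3 : nu.-integrable setT (EFin \o g3) := boundary_measure_integrable Lh.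
Let U1 : X -> R := kernel_op leb (source_kernel (fun=> 0) id) g1.
Let U2 : X -> R := kernel_op mus (source_kernel (fun p : X => p.1) (fun p : X => p.2)) g2.
Let U3 : X -> R := kernel_op nu (source_kernel (fun p : Z => p.2) (fun p : Z => p.1)) g3.
Let mU1 : measurable_fun setT U1 := source_op_measurable ms1 mz1 ig1.
Let mU2 : measurable_fun setT U2 := source_op_measurable ms2 mz2 ig2.
Let mU3 : measurable_fun setT U3 := source_op_measurable ms3 mz3 ig3.

(** A sum of three integrals over sources, measurable by construction; the iterated integral in
    [heat_solution] is recovered almost everywhere in [representationE]. *)
Definition representation t x : R := U1 (t, x) + U2 (t, x) + U3 (t, x).

Let U (p : X) := U1 p + U2 p + U3 p.

Let mU : measurable_fun setT U.
Proof. by apply: measurable_funD => //; exact: measurable_funD. Qed.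

Let mrep : measurable_fun cylinder (fun p : X => representation p.1 p.2).
Proof.
rewrite (_ : (fun p : X => _) = U); first exact: measurable_funTS.
by apply/funext => -[].
Qed.

Let rep_weight p : zero_ext representation p * cyl_weight p = U p * cyl_weight p.
Proof.
have [cp|cp] := pselect (cylinder p); last by rewrite cyl_weight_out// !mulr0.
by case: p cp => t x cp; rewrite /zero_ext patchE mem_set.
Qed.

Let data_ge0 : (0 <= \int[leb]_(x in Omega) (`|u0 x| * w x)%:E)%E /\
  (0 <= \int[leb1]_(t in `]0%R, T[) \int[leb]_(x in Omega) (`|f t x| * w x)%:E)%E /\
  (0 <= \int[lat]_(p in boundary Omega `*` `]0%R, T[) `|h p.2 p.1|%:E)%E.
Proof.
split; first by apply: integral_ge0 => x _; rewrite lee_fin mulr_ge0.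
split; last by apply: integral_ge0 => p _; rewrite lee_fin.
by apply: integral_ge0 => t _; apply: integral_ge0 => x _; rewrite lee_fin mulr_ge0.
Qed.

Lemma representation_norm :
  (\int[leb1]_(t in `]0%R, T[) \int[leb]_(x in Omega) (`|representation t x| * w x)%:E
   <= (C * T)%:E * (\int[leb]_(x in Omega) (`|u0 x| * w x)%:E
     + \int[leb1]_(t in `]0%R, T[) \int[leb]_(x in Omega) (`|f t x| * w x)%:E
     + \int[lat]_(p in boundary Omega `*` `]0%R, T[) `|h p.2 p.1|%:E))%E.
Proof.
rewrite (L1_L1_norm mrep).
have m_ (V : X -> R) : measurable_fun setT V ->
    measurable_fun setT (fun p : X => (`|V p| * cyl_weight p)%:E).
  move=> mV; apply/measurable_EFinP; apply: measurable_funM => //; exact: measurableT_comp.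
have p_ (V : X -> R) p : (0 <= (`|V p| * cyl_weight p)%:E)%E by rewrite lee_fin mulr_ge0.
have mzr := zero_ext_measurable mrep.
have m1 := m_ U1 mU1; have m2 := m_ U2 mU2; have m3 := m_ U3 mU3.
have m12 := emeasurable_funD m1 m2.
apply: (@le_trans _ _ (\int[mu]_p ((`|U1 p| * cyl_weight p)%:E + (`|U2 p| * cyl_weight p)%:E
    + (`|U3 p| * cyl_weight p)%:E))%E).
  apply: ge0_le_integral => //.
  - exact: (m_ _ mzr).
  - exact: emeasurable_funD m12 m3.
  move=> p _; rewrite -!EFinD lee_fin -!mulrDl.
  rewrite -[X in _ * X](ger0_norm (omega0 p)) -normrM rep_weight normrM (ger0_norm (omega0 p)).
  by rewrite ler_wpM2r// (le_trans (ler_normD _ _))// lerD2r ler_normD.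
rewrite (ge0_integralD _ measurableT (fun p _ => adde_ge0 (p_ U1 p) (p_ U2 p)) m12 (fun p _ => p_ U3 p) m3).
rewrite (ge0_integralD _ measurableT (fun p _ => p_ U1 p) m1 (fun p _ => p_ U2 p) m2).
have n1 := source_op_norm ms1 mz1 ig1.
have n2 := source_op_norm ms2 mz2 ig2.
have n3 := source_op_norm ms3 mz3 ig3.
have e3 : (\int[nu]_p `|g3 p|%:E = \int[lat]_p `|g3 p|%:E)%E.
  apply: integral_boundary_measure; last by move=> p; rewrite -/g3 => ->; rewrite normr0.
  apply/measurable_EFinP; apply: measurableT_comp => //; exact: boundary_density_measurable.
rewrite e3 (boundary_density_norm h) in n3.
have e2 := interior_density_norm Lf.
have e2' : (\int[mus]_p `|g2 p|%:E = \int[mu]_p `|g2 p|%:E)%E by [].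
rewrite e2' e2 in n2; rewrite (initial_density_norm u0) in n1.
have [A0 [B0 D0]] := data_ge0.
have sum3 (x1 x2 x3 a b d c : \bar R) : (0 <= a -> 0 <= b -> 0 <= d ->
    x1 <= c * a -> x2 <= c * b -> x3 <= c * d -> x1 + x2 + x3 <= c * (a + b + d))%E.
  move=> a0 b0 d0 h1 h2 h3; rewrite (ge0_muleDr _ (adde_ge0 a0 b0) d0) (ge0_muleDr _ a0 b0).
  exact: (leeD (leeD h1 h2) h3).
exact: (sum3 _ _ _ _ _ _ _ A0 B0 D0 n1 n2 n3).
Qed.

Lemma representation_L1 : L1_L1_weight Omega gamma T representation.
Proof.
split; first exact: mrep.
apply: (le_lt_trans representation_norm); have [_ uoo] := Lu0; have [_ foo] := Lf; have [_ hoo] := Lh.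
have [A0 [B0 D0]] := data_ge0.
apply: lte_mul_pinfty; [by rewrite lee_fin|by []|].
exact: (lte_add_pinfty (lte_add_pinfty uoo foo) hoo).
Qed.

Lemma representationE : {ae mu, forall p : X, cylinder p ->
  representation p.1 p.2 = heat_solution Omega gamma lambda phi u0 f h p.1 p.2}.
Proof.
have := interior_termE Lf; apply: filterS => -[t x] hp cp /=.
have [/= tT Ox] := cp; rewrite in_itv/= in tT.
rewrite /representation /heat_solution /U1 (initial_termE Lu0 tT Ox).
by rewrite /U3 /nu (boundary_termE Lh tT Ox) /U2 hp.
Qed.

(** Duality turns each term into the integral of its density against the potential at time T - s y.
    In the interior w times the potential is H[0, psi, 0], which accounts for the first two terms;
    at the boundary the potential is the normal derivative, which accounts for the third. *)
Lemma representation_weak : weak_dual_solution Omega gamma lambda phi T u0 f h representation.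
Proof.
move=> psi Lpsi /=; have [mpsi _] := Lpsi.
have [v [B [mv vB psiv]]] := test_function_clamp Lpsi.
rewrite (test_pairing mpsi mv vB psiv representation_L1).
have mvr : measurable_fun setT (fun p : X => v (reflection T p)).
  exact: measurableT_comp mv mrefl.
have i1 := source_op_pairing_integrable ms1 mz1 ig1 mv vB.
have i2 := source_op_pairing_integrable ms2 mz2 ig2 mv vB.
have i3 := source_op_pairing_integrable ms3 mz3 ig3 mv vB.
have vr0 p : ~ cylinder p -> v (reflection T p) = 0.
  move=> cp; have := reflected_bound vB p; rewrite cyl_weight_out// mulr0 => le0.
  by apply/eqP; rewrite -normr_le0.
transitivity (\int[mu]_p (U1 p * v (reflection T p)) + \int[mu]_p (U2 p * v (reflection T p))
   + \int[mu]_p (U3 p * v (reflection T p))).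
  rewrite -(RintegralD measurableT i1 i2) -(RintegralD measurableT _ i3).
    apply: eq_Rintegral => p _; have [cp|cp] := pselect (cylinder p); last first.
      by rewrite !vr0// !mulr0 !addr0.
    by case: p cp => t x cp; rewrite /zero_ext patchE mem_set//= /representation !mulrDl.
  by have := integrableD measurableT i1 i2; apply: eq_integrable.
have gs1 (y : 'rV[R]_n) : g1 y != 0 -> 0 <= (0 : R) < T by rewrite lexx T_gt0.
have gs2 (p : X) : g2 p != 0 -> 0 <= p.1 < T.
  have [[/= tT _] _|cp] := pselect (cylinder p).
    by move: tT; rewrite in_itv/= => /andP[/ltW -> ->].
  by rewrite /g2 /interior_density cyl_weight_out// mulr0 eqxx.
have gs3 (p : Z) : g3 p != 0 -> 0 <= p.2 < T.
  rewrite /g3 /boundary_density patchE; case: ifPn => [|_]; last by rewrite eqxx.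
  by rewrite inE => -[_ /=]; rewrite in_itv/= => /andP[/ltW -> ->].
rewrite /U1 (source_duality mv vB ms1 mz1 ig1).
rewrite /U2 (source_duality mv vB ms2 mz2 ig2).
rewrite /U3 (source_duality mv vB ms3 mz3 ig3).
have E1 := source_potentialE mv vB ms1 mz1 gs1.
have E2 := source_potentialE mv vB ms2 mz2 gs2.
have E3 := source_potentialE mv vB ms3 mz3 gs3.
have HE := test_solutionE mpsi mv vB psiv.
have add3 (a1 a2 a3 b1 b2 b3 : R) : a1 = b1 -> a2 = b2 -> a3 = b3 ->
  a1 + a2 + a3 = b1 + b2 + b3 by move=> -> -> ->.
apply: add3.
- rewrite [RHS]Rintegral_mkcond; apply: eq_Rintegral => y _; rewrite E1 subr0.
  rewrite /g1 /initial_density !patchE; case: ifPn => [|_]; last by rewrite mul0r.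
  by rewrite inE => Oy; rewrite HE ?T_gt0 ?lexx// mulrA.
- have iQ := source_potential_integrable mv vB ms2 mz2 ig2.
  apply: etrans (esym (Rintegral21 iQ)) _.
  rewrite [RHS]Rintegral_mkcond; apply: eq_Rintegral => x _; rewrite patchE.
  case: ifPn => [|nx].
    rewrite inE => Ox; rewrite [RHS]Rintegral_mkcond; apply: eq_Rintegral => t _.
    rewrite E2 patchE; case: ifPn => [|nt].
      rewrite inE/= in_itv/= => tT; have /andP[t0 tT'] := tT.
      have Tt : 0 < T - t <= T by rewrite subr_gt0 tT' gerBl ltW.
      rewrite HE// /g2 /interior_density zero_extE// patchE mem_set//.
      by rewrite cyl_weightE ?mulrA//; split => //=; rewrite in_itv.
    rewrite /g2 /interior_density cyl_weight_out ?mulr0 ?mul0r// => -[/= tT _].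
    by move: nt; rewrite notin_setE/= tT.
  rewrite /Rintegral integral0_eq// => t _; rewrite E2 /g2 /interior_density.
  rewrite cyl_weight_out ?mulr0 ?mul0r// => -[/= _ Ox].
  by move: nx; rewrite notin_setE.
- rewrite [RHS]Rintegral_mkcond /Rintegral; apply: (congr1 fine).
  rewrite integral_boundary_measure; last 2 first.
  + apply/measurable_EFinP; apply: measurable_funM; first exact: boundary_density_measurable.
    exact: (source_potential_measurable mv ms3 mz3).
  + by move=> p; rewrite -/g3 => ->; rewrite mul0r.
  apply: eq_integral => p _; congr EFin; rewrite E3 /g3 /boundary_density !patchE /lateral_boundary.
  case: ifPn => [|_]; last by rewrite mul0r.
  rewrite inE => -[/= bp]; rewrite in_itv/= => /andP[t0 tT].
  rewrite (test_normal_derivative mpsi mv vB psiv)//; last by case: bp.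
  by rewrite subr_gt0 tT gerBl ltW.
Qed.

End representation.
End conclusion.

(** * Uniqueness of weak-dual solutions *)

Section uniqueness.

Let sign (a : R) : R := (0 < a)%R%:R - (a < 0)%R%:R.

Let sign_mul a : a * sign a = `|a|.
Proof.
by rewrite /sign; case: (ltrgt0P a) => [a0|a0|->]; rewrite /= ?subr0 ?sub0r ?mulr1 ?mulrN1 ?mul0r.
Qed.

Let sign_le a : `|sign a| <= 1.
Proof.
rewrite /sign; case: (ltrgt0P a) => _ /=.
- by rewrite subr0 normr1.
- by rewrite sub0r normrN normr1.
- by rewrite subr0 normr0.
Qed.

Lemma weak_dual_unique (u0 : 'rV[R]_n -> R) (f h u1 u2 : R -> 'rV[R]_n -> R) :
  L1_L1_weight Omega gamma T u1 -> L1_L1_weight Omega gamma T u2 ->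
  weak_dual_solution Omega gamma lambda phi T u0 f h u1 ->
  weak_dual_solution Omega gamma lambda phi T u0 f h u2 ->
  {ae mu, forall p : X, cylinder p -> u1 p.1 p.2 = u2 p.1 p.2}.
Proof.
move=> Lu1 Lu2 wu1 wu2; have [mu1 _] := Lu1; have [mu2 _] := Lu2.
have mz1 := zero_ext_measurable mu1; have mz2 := zero_ext_measurable mu2.
pose d p := zero_ext u1 p - zero_ext u2 p.
have md : measurable_fun setT d by exact: measurable_funB mz1 mz2.
have mb : measurable_fun setT (fun b : bool => b%:R : R) by [].
have msd : measurable_fun setT (fun p => sign (d p)).
  apply: measurable_funB.
  - apply: (measurableT_comp mb); apply: measurable_fun_ltr => //; exact: measurable_cst.
  - apply: (measurableT_comp mb); apply: measurable_fun_ltr => //; exact: measurable_cst.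
(* The formulation pairs u at time t with psi at time T - t, so the sign is reflected beforehand and
   u1 - u2 meets its own sign times w. *)
pose v p := sign (d (reflection T p)) * cyl_weight p.
have mv : measurable_fun setT v.
  by apply: measurable_funM => //; exact: measurableT_comp msd mrefl.
have vB p : `|v p| <= 1 * cyl_weight p.
  by rewrite normrM (ger0_norm (omega0 p)) ler_wpM2r.
pose psi t x := sign (d (T - t, x)) * w x.
have psivE p : cylinder p -> psi p.1 p.2 = v p.
  by move=> cp; rewrite /v cyl_weightE.
have mpsi : measurable_fun cylinder (fun p : X => psi p.1 p.2).
  apply: (eq_measurable_fun v); last exact: measurable_funTS.
  by move=> p; rewrite inE => cp; rewrite psivE.
have psiv : {ae mu, forall p, zero_ext psi p = v p}.
  apply: aeW => p; have [cp|cp] := pselect (cylinder p).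
    by rewrite /zero_ext patchE mem_set//; exact: psivE.
  by rewrite /zero_ext patchE memNset// /v cyl_weight_out// mulr0.
have Lpsi : Linf_Linf_weight Omega gamma T psi.
  split; first exact: mpsi.
  exists 1; apply: aeW => p cp; rewrite psivE//; apply: le_trans (vB p) _.
  by rewrite cyl_weightE.
have e1 := wu1 psi Lpsi; have e2 := wu2 psi Lpsi.
have := etrans e1 (esym e2).
rewrite (test_pairing mpsi mv vB psiv Lu1) (test_pairing mpsi mv vB psiv Lu2) => e12.
have i1 := test_integrable mv vB Lu1; have i2 := test_integrable mv vB Lu2.
pose k p := `|d p| * cyl_weight p.
have kE p : zero_ext u1 p * v (reflection T p) - zero_ext u2 p * v (reflection T p) = k p.
  rewrite -mulrBl -/(d p) /v reflectionK cyl_weight_reflection mulrA.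
  by rewrite sign_mul.
have ik : mu.-integrable setT (EFin \o k).
  have := integrableB measurableT i1 i2; apply: eq_integrable => // p _.
  by rewrite /= -EFinB kE.
have k0 : \int[mu]_p k p = 0.
  rewrite (_ : \int[mu]_p k p = \int[mu]_p (zero_ext u1 p * v (reflection T p)
    - zero_ext u2 p * v (reflection T p))); last by apply: eq_Rintegral => p _; rewrite kE.
  by rewrite (RintegralB measurableT i1 i2) e12 subrr.
have ka : (\int[mu]_p `|(EFin \o k) p| = 0)%E.
  rewrite (eq_integral (EFin \o k)); last first.
    by move=> p _; rewrite gee0_abs// lee_fin mulr_ge0.
  rewrite -(fineK (integrable_fin_num measurableT ik)).
  by congr EFin; exact: k0.
have mk : measurable_fun setT (EFin \o k) by exact: measurable_int ik.
have := (ae_eq_integral_abs mu measurableT mk).1 ka.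
apply: filterS => p /(_ I) [] /eqP; rewrite mulf_eq0 => /orP[|].
  rewrite normr_eq0 subr_eq0 => /eqP e cp; move: e.
  by rewrite /zero_ext !patchE mem_set.
move=> /eqP e cp; move: e; rewrite cyl_weightE// => e.
by have [_ /= Op] := cp; have := wp Op; rewrite e ltxx.
Qed.

End uniqueness.

End spectral_analysis.

Theorem theorem1p1 (R : realType) (n : nat) (s gamma : R)
    (Omega : set 'rV[R]_n) (G : 'rV[R]_n -> 'rV[R]_n -> \bar R)
    (lambda : nat -> R) (phi : nat -> 'rV[R]_n -> R) (T : R) :
  0 < s < 1 -> 0 < gamma <= 1 -> 2 * s < n%:R ->
  bounded_domain Omega ->
  nonneg_kernel Omega G ->
  green_L2_operator Omega G ->
  eigendecomposition Omega G lambda phi ->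
  kernel_estimate Omega gamma G s ->
  green_regular Omega gamma G -> green_continuous Omega gamma G ->
  submarkovian Omega lambda phi ->
  green_normal_derivative Omega gamma G ->
  0 < T ->
  exists2 C : R, 0 < C &
    forall (u0 : 'rV[R]_n -> R) (f h : R -> 'rV[R]_n -> R),
      L1_weight Omega gamma u0 ->
      L1_L1_weight Omega gamma T f ->
      L1_lateral Omega T h ->
      exists u : R -> 'rV[R]_n -> R,
        [/\ L1_L1_weight Omega gamma T u,
            weak_dual_solution Omega gamma lambda phi T u0 f h u,
            forall v : R -> 'rV[R]_n -> R,
              L1_L1_weight Omega gamma T v ->
              weak_dual_solution Omega gamma lambda phi T u0 f h v ->
              {ae (@lebesgue_measure R \x lebesgue_rV n)%E,
                forall p : measurableTypeR R * 'rV[R]_n,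
                (`]0, T[ `*` Omega) p -> v p.1 p.2 = u p.1 p.2},
            {ae (@lebesgue_measure R \x lebesgue_rV n)%E,
              forall p : measurableTypeR R * 'rV[R]_n,
              (`]0, T[ `*` Omega) p -> u p.1 p.2 =
                heat_solution Omega gamma lambda phi u0 f h p.1 p.2} &
            (\int[@lebesgue_measure R]_(t in `]0%R, T[)
               \int[lebesgue_rV n]_(x in Omega)
                 (`|u t x| * delta Omega x `^ gamma)%:E
             <= C%:E * (\int[lebesgue_rV n]_(x in Omega)
                          (`|u0 x| * delta Omega x `^ gamma)%:E
                 + \int[@lebesgue_measure R]_(t in `]0%R, T[)
                     \int[lebesgue_rV n]_(x in Omega)
                       (`|f t x| * delta Omega x `^ gamma)%:E
                 + \int[lateral_measure]_(p in boundary Omega `*` `]0%R, T[)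
                     `|h p.2 p.1|%:E))%E].
Proof.
move=> /andP[s0 _] /andP[g0 _] sn bO G0 GO ED GE GR _ SM _ T0.
have [F [M SS]] := green_spectral_setting s0 g0 sn bO G0 GE ED GR.
have [C C0 serC] := ser_weight_bounded SS SM s0 sn G0 GE GO ED.
(* C bounds S(t)w / w uniformly in time, and T is the length of the time interval over which this
   bound is integrated. *)
exists (C * T); first exact: mulr_gt0.
move=> u0 f h Lu0 Lf Lh.
have repL := representation_L1 SS SM C0 serC T0 Lu0 Lf Lh.
have repW := representation_weak SS SM C0 serC T0 Lu0 Lf Lh.
exists (representation gamma lambda F u0 f Lh); split.
- exact: repL.
- exact: repW.
- by move=> v Lv wv; exact: (weak_dual_unique SS Lv repL wv repW).
- exact: (representationE SS SM C0 serC T0 Lu0 Lf Lh).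
- exact: (representation_norm SS SM C0 serC T0 Lu0 Lf Lh).
Qed.
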